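(* Let $n\ge 1$, let $h:[0,\infty)\to[0,\infty)$ be a continuous function with $\int_0^\infty r^{2m+2n-1}e^{-2h(r)}\,dr<\infty$ for every $m\in\mathbb{N}_0$, let $\mathbf{m}=(b_1,\dots,b_k)$ be a partition of $n=b_1+\dots+b_k$, and assume that $\varphi\in L^{\infty}(\mathbb{C}^n)$ is invariant under $\mathbf{U_m}=\mathrm{U}(b_1)\times\dots\times\mathrm{U}(b_k)$, with $\varphi(z)=\mathbf{a}_\varphi(|z_{(1)}|,\dots,|z_{(k)}|)$ for almost every $z\in\mathbb{C}^n$. Then for every $\mathbf{s}=(s_1,\dots,s_k)\in\mathbb{N}_0^k$, $$T_\varphi|_{P^{s_1}(\mathbb{C}^{b_1})\otimes\dots\otimes P^{s_k}(\mathbb{C}^{b_k})}=\lambda_{\varphi,\mathbf{s}}\,\mathrm{I},$$ where $$\lambda_{\varphi,\mathbf{s}}=\frac{\displaystyle\int_{\mathbb{R}_+^k}\mathbf{a}_{\varphi}(r_1,\dots,r_k)\prod_{j=1}^k r_j^{2s_j+2b_j-1}\,e^{-2h(|\mathbf{r}|)}\,d\mathbf{r}}{\displaystyle\int_{\mathbb{R}_+^k}\prod_{j=1}^k r_j^{2s_j+2b_j-1}\,e^{-2h(|\mathbf{r}|)}\,d\mathbf{r}},$$ with $d\mathbf{r}=dr_1\cdots dr_k$ and $|\mathbf{r}|=\sqrt{r_1^2+\dots+r_k^2}$.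
   Context: $\mathbb{N}_0=\{0,1,2,\dots\}$, $\mathbb{R}_+=(0,\infty)$. Put $h(z):=h(|z|)$ for $z\in\mathbb{C}^n$. $L^2_h(\mathbb{C}^n)$ is the Hilbert space of (classes of) Lebesgue measurable functions $f$ on $\mathbb{C}^n$ with $\|f\|_h^2=\int_{\mathbb{C}^n}|f(z)|^2e^{-2h(z)}\,dz<\infty$, where $dz$ is Lebesgue measure. The radially weighted Fock space $\mathcal{A}_h(\mathbb{C}^n)$ is the closed subspace of entire functions in $L^2_h(\mathbb{C}^n)$, and $P:L^2_h(\mathbb{C}^n)\to\mathcal{A}_h(\mathbb{C}^n)$ is the orthogonal projection. For $\varphi\in L^\infty(\mathbb{C}^n)$ the Toeplitz operator on $\mathcal{A}_h(\mathbb{C}^n)$ is $T_\varphi f=P(\varphi f)$. For the partition $\mathbf{m}$ (positive integers summing to $n$) write $z=(z_{(1)},\dots,z_{(k)})\in\mathbb{C}^{b_1}\times\dots\times\mathbb{C}^{b_k}=\mathbb{C}^n$; $\mathbf{U_m}$ is embedded block-diagonally in $\mathrm{U}(n)$. $\varphi$ is $\mathbf{U_m}$-invariant if $\varphi(A^{-1}z)=\varphi(z)$ (as elements of $L^\infty(\mathbb{C}^n)$) for all $A\in\mathbf{U_m}$; it is known that this holds if and only if there is a (measurable) function $\mathbf{a}_\varphi:\mathbb{R}_+^k\to\mathbb{C}$ with $\varphi(z)=\mathbf{a}_\varphi(|z_{(1)}|,\dots,|z_{(k)}|)$ for almost every $z$. $P^{s}(\mathbb{C}^{b})$ is the space of homogeneous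 holomorphic polynomials of degree $s$ on $\mathbb{C}^b$, and $P^{s_1}(\mathbb{C}^{b_1})\otimes\dots\otimes P^{s_k}(\mathbb{C}^{b_k})$ is identified with the span in $\mathcal{A}_h(\mathbb{C}^n)$ of the products $p_1(z_{(1)})\cdots p_k(z_{(k)})$ with $p_j\in P^{s_j}(\mathbb{C}^{b_j})$. $\mathrm{I}$ is the identity operator. *)

(* Defs.v *)
From HB Require Import structures.
From mathcomp Require Import all_boot all_order all_algebra.
From mathcomp Require Import complex.
From mathcomp Require mpoly.
(* The notations of mpoly clash with those of the analysis library, and its
   module Measure must not hide the one defined there. *)
Import -(notations) mpoly.
From mathcomp Require Import all_classical all_reals all_analysis.

Set Implicit Arguments.
Unset Strict Implicit.
Unset Printing Implicit Defensive.
Import Order.TTheory GRing.Theory Num.Theory.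
Import numFieldNormedType.Exports.
Local Open Scope classical_set_scope.
Local Open Scope ring_scope.
Local Open Scope complex_scope.

Section pushforward_sigma_finite.
Context d1 d2 (T1 : measurableType d1) (T2 : measurableType d2) (R : realType).
Variables (mu : set T1 -> \bar R) (f : T1 -> T2) (g : T2 -> T1).

Lemma pushforward_sigma_finite : sigma_finite setT mu ->
  measurable_fun setT f -> measurable_fun setT g -> cancel f g ->
  sigma_finite setT (pushforward mu f).
Proof.
move=> [F UF mF] mf mg fK.
exists (fun i => g @^-1` F i).
  by rewrite -preimage_bigcup -UF preimage_setT.
move=> i; have [mFi Fioo] := mF i; split.
  by rewrite -[X in measurable X]setTI; exact: mg.
rewrite /pushforward -comp_preimage.
by rewrite (_ : g \o f = id) //; apply/funext => x /=; rewrite fK.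
Qed.
End pushforward_sigma_finite.

(* In the library this fact is hidden: inference on \x selects the instances
   for finite measures. *)
Lemma product_sigma_finite d1 d2 (T1 : measurableType d1)
    (T2 : measurableType d2) (R : realType)
    (m1 : {sigma_finite_measure set T1 -> \bar R})
    (m2 : {sigma_finite_measure set T2 -> \bar R}) :
  sigma_finite setT (m1 \x m2)%E.
Proof.
have /sigma_finiteP[F [TF ndF Foo]] := sigma_finiteT m1.
have /sigma_finiteP[G [TG ndG Goo]] := sigma_finiteT m2.
exists (fun n => F n `*` G n).
  apply/seteqP; split => // -[x y] _.
  have [i _ Fix] : (\bigcup_i F i) x by rewrite -TF.
  have [j _ Gjy] : (\bigcup_j G j) y by rewrite -TG.
  exists (maxn i j) => //; split => /=.
    by move: x Fix; exact/subsetPset/ndF/leq_maxl.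
  by move: y Gjy; exact/subsetPset/ndG/leq_maxr.
move=> i; have [mF Fi] := Foo i; have [mG Gi] := Goo i.
split; first exact: measurableX.
by rewrite product_measure1E// lte_mul_pinfty// ge0_fin_numE.
Qed.

(* Lebesgue measure on R^d, by R^(d+1) = R x R^d. *)
Section lebesgue_tuple.
Variable R : realType.
Local Notation RT := (measurableTypeR R).

Definition cons_pair d (p : RT * d.-tuple RT) : d.+1.-tuple RT :=
  [the d.+1.-tuple RT of p.1 :: p.2].

Lemma measurable_cons_pair d : measurable_fun setT (@cons_pair d).
Proof. exact: measurable_cons. Qed.

Definition uncons_pair d (t : d.+1.-tuple RT) : RT * d.-tuple RT :=
  (tnth t ord0, [tuple of behead t]).

Lemma measurable_uncons_pair d : measurable_fun setT (@uncons_pair d).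
Proof.
apply/measurable_fun_pairP; split => /=; first exact: measurable_tnth.
exact: measurable_behead.
Qed.

Lemma cons_pairK d : cancel (@cons_pair d) (@uncons_pair d).
Proof. by move=> [x t]; congr pair; exact/val_inj. Qed.

Section step.
Variables (d : nat) (mu : {sigma_finite_measure set (d.-tuple RT) -> \bar R}).

Definition lebesgue_tupleS : set (d.+1.-tuple RT) -> \bar R :=
  pushforward (@lebesgue_measure R \x mu)%E (@cons_pair d).

HB.instance Definition _ := Measure.copy lebesgue_tupleS
  (measure_function_pushforward__canonical__measure_function_Measure
     (@lebesgue_measure R \x mu)%E (@measurable_cons_pair d)).

Let sigma_finite_lebesgue_tupleS : sigma_finite setT lebesgue_tupleS.
Proof.
apply: (@pushforward_sigma_finite _ _ _ _ _ _ _ (@uncons_pair d)).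
- exact: product_sigma_finite.
- exact: measurable_cons_pair.
- exact: measurable_uncons_pair.
- exact: cons_pairK.
Qed.

HB.instance Definition _ := Measure_isSigmaFinite.Build _ _ _ lebesgue_tupleS
  sigma_finite_lebesgue_tupleS.
End step.

Fixpoint lebesgue_tuple d : {sigma_finite_measure set (d.-tuple RT) -> \bar R} :=
  if d is d'.+1 then lebesgue_tupleS (lebesgue_tuple d')
  else dirac ([tuple] : 0.-tuple RT).
End lebesgue_tuple.

(* C^n is the type 'cV[R[i]]_n.  Its sigma-algebra and Lebesgue measure are
   those of R^n x R^n, transported along the bijection (x, y) |-> x + i y. *)
Section complex_space.
Variable R : realType.
Local Notation RT := (measurableTypeR R).
Local Notation C := R[i].

Definition of_real_pair n (p : n.-tuple RT * n.-tuple RT) : 'cV[C]_n :=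
  \col_j (tnth p.1 j +i* tnth p.2 j).

Definition to_real_pair n (z : 'cV[C]_n) : n.-tuple RT * n.-tuple RT :=
  ([tuple complex.Re (z j 0) | j < n], [tuple complex.Im (z j 0) | j < n]).

Lemma of_real_pairK n : cancel (@of_real_pair n) (@to_real_pair n).
Proof.
by move=> [x y]; congr pair; apply: eq_from_tnth => j; rewrite tnth_mktuple mxE.
Qed.

Lemma to_real_pairK n : cancel (@to_real_pair n) (@of_real_pair n).
Proof.
move=> z; apply/matrixP => j l; rewrite !ord1 mxE /= !tnth_mktuple.
by case: (z j 0).
Qed.

Fact complex_display : measure_display. Proof. exact: default_measure_display. Qed.

(* The library gives the topology and norm of R[i] on the alias C^o only. *)
HB.instance Definition _ := NormedModule.copy C C^o.

Section sigma_algebra.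
Variable n : nat.

Definition complex_measurable : set (set 'cV[C]_n) :=
  [set A | measurable (@of_real_pair n @^-1` A)].

Let complex_measurable0 : complex_measurable set0.
Proof. by rewrite /complex_measurable /= preimage_set0. Qed.

Let complex_measurableC A : complex_measurable A -> complex_measurable (~` A).
Proof. by rewrite /complex_measurable /= preimage_setC; exact: measurableC. Qed.

Let complex_measurable_bigcup (F : (set 'cV[C]_n)^nat) :
  (forall i, complex_measurable (F i)) -> complex_measurable (\bigcup_i F i).
Proof.
by move=> mF; rewrite /complex_measurable /= preimage_bigcup; exact: bigcupT_measurable.
Qed.

HB.instance Definition _ := @isMeasurable.Build complex_display 'cV[C]_n
  complex_measurable complex_measurable0 complex_measurableC
  complex_measurable_bigcup.
End sigma_algebra.

Lemma measurable_of_real_pair n : measurable_fun setT (@of_real_pair n).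
Proof. by move=> _ A mA; rewrite setTI. Qed.

Lemma measurable_to_real_pair n : measurable_fun setT (@to_real_pair n).
Proof.
move=> _ A mA; rewrite setTI /measurable /= /complex_measurable /= -comp_preimage.
by rewrite (_ : _ \o _ = id) //; apply/funext => p /=; rewrite of_real_pairK.
Qed.

Definition lebesgue_complex n : set 'cV[C]_n -> \bar R :=
  pushforward (lebesgue_tuple R n \x lebesgue_tuple R n)%E (@of_real_pair n).

HB.instance Definition _ n := Measure.copy (@lebesgue_complex n)
  (measure_function_pushforward__canonical__measure_function_Measure
     (lebesgue_tuple R n \x lebesgue_tuple R n)%E (@measurable_of_real_pair n)).

Let sigma_finite_lebesgue_complex n : sigma_finite setT (@lebesgue_complex n).
Proof.
apply: (@pushforward_sigma_finite _ _ _ _ _ _ _ (@to_real_pair n)).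
- exact: product_sigma_finite.
- exact: measurable_of_real_pair.
- exact: measurable_to_real_pair.
- exact: of_real_pairK.
Qed.

HB.instance Definition _ n := Measure_isSigmaFinite.Build _ _ _
  (@lebesgue_complex n) (@sigma_finite_lebesgue_complex n).

(* Euclidean norm; the library norm on matrices is the maximum norm. *)
Definition enorm n (z : 'cV[C]_n) : R :=
  Num.sqrt (\sum_(j < n) ComplexField.Normc.normc (z j 0) ^+ 2).
End complex_space.
Arguments lebesgue_complex {R} n.

Section complex_functions.
Context d (T : measurableType d) (R : realType).
Variables (mu : {measure set T -> \bar R}) (D : set T).
Implicit Type f : T -> R[i].

(* Measurability with respect to the completion of mu: f agrees almost
   everywhere on D with a function measurable for the sigma-algebra of T. *)
Definition lebesgue_measurable_fun f : Prop :=
  exists g : T -> R[i],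
    [/\ measurable_fun D (fun x => complex.Re (g x)),
        measurable_fun D (fun x => complex.Im (g x)) &
        {ae mu, forall x, D x -> f x = g x}].

Definition essentially_bounded f : Prop :=
  exists M : R, {ae mu, forall x, D x -> ComplexField.Normc.normc (f x) <= M}.

Definition cintegral f : R[i] :=
  (\int[mu]_(x in D) complex.Re (f x)) +i* (\int[mu]_(x in D) complex.Im (f x)).
End complex_functions.

Section fock_space.
Variables (R : realType) (h : R -> R) (n : nat).
Local Notation C := R[i].
Local Notation mu := (@lebesgue_complex R n).
Implicit Types f g u phi : 'cV[C]_n -> C.

Definition weight (z : 'cV[C]_n) : R := expR (- (2 * h (enorm z))).

Definition L2h : set ('cV[C]_n -> C) := [set f |
  lebesgue_measurable_fun mu setT f /\
  (\int[mu]_z (ComplexField.Normc.normc (f z) ^+ 2 * weight z)%:E < +oo)%E].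

(* Functions in [L2h] are considered up to equality almost everywhere. *)
Definition inner_h f g : C :=
  cintegral mu setT (fun z => f z * conjc (g z) * (weight z)%:C).

(* Frechet differentiability over C at every point. *)
Definition entire f : Prop :=
  forall z, differentiable f z.

Definition fock : set ('cV[C]_n -> C) := entire `&` L2h.

(* An entire function is determined by its class, so that the projection of a
   class is represented by exactly one function; the default value 0 is never
   used when f is in [L2h], [fock] being closed there. *)
Definition fock_proj f : 'cV[C]_n -> C :=
  xget (fun=> 0) [set g | fock g /\
    forall u, fock u -> inner_h (fun z => f z - g z) u = 0].

Definition toeplitz phi f : 'cV[C]_n -> C := fock_proj (fun z => phi z * f z).

Definition Linfty : set ('cV[C]_n -> C) := [set phi |
  lebesgue_measurable_fun mu setT phi /\ essentially_bounded mu setT phi].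
End fock_space.

Section blocks.
Variables (R : realType) (k : nat) (b : 'I_k -> nat).
Local Notation C := R[i].
Local Notation n := (\sum_(j < k) b j)%N.
Local Notation RT := (measurableTypeR R).

(* The block z_(j) of z is [submxcol z j : 'cV_(b j)]. *)
Definition block_norms (z : 'cV[C]_n) : k.-tuple RT :=
  [tuple enorm (submxcol z j) | j < k].

Definition block_unitary_invariant (phi : 'cV[C]_n -> C) : Prop :=
  forall A : forall j, 'M[C]_(b j), (forall j, A j \is unitarymx) ->
    {ae lebesgue_complex n,
      forall z, phi (invmx (\mxdiag_(j < k) A j) *m z) = phi z}.

Definition homogeneous_polynomials (c s : nat) : set ('cV[C]_c -> C) :=
  [set f | exists2 p : mpoly c C,
     p \is ishomog1 s (@mdeg c) &
     f = fun w : 'cV[C]_c => meval (fun i => w i 0) p].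

Definition linear_span (T : Type) (S : set (T -> C)) : set (T -> C) :=
  [set f | exists (N : nat) (c : 'I_N -> C) (g : 'I_N -> T -> C),
     (forall i, S (g i)) /\ f = fun x => \sum_(i < N) c i * g i x].

Definition polynomial_tensor (s : 'I_k -> nat) : set ('cV[C]_n -> C) :=
  linear_span [set f | exists p : forall j, 'cV[C]_(b j) -> C,
    (forall j, homogeneous_polynomials (s j) (p j)) /\
    f = fun z => \prod_(j < k) p j (submxcol z j)].

Definition positive_orthant : set (k.-tuple RT) :=
  [set r | forall j, 0 < tnth r j].

Definition radial_weight (h : R -> R) (s : 'I_k -> nat) (r : k.-tuple RT) : R :=
  (\prod_(j < k) tnth r j ^+ (2 * s j + 2 * b j - 1)) *
  expR (- (2 * h (Num.sqrt (\sum_(j < k) tnth r j ^+ 2)))).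

Definition toeplitz_eigenvalue (h : R -> R) (a : k.-tuple RT -> C)
    (s : 'I_k -> nat) : C :=
  cintegral (lebesgue_tuple R k) positive_orthant
    (fun r => a r * (radial_weight h s r)%:C) /
  (\int[lebesgue_tuple R k]_(r in positive_orthant) radial_weight h s r)%:C.
End blocks.

(* Main.v *)
Require Import Defs.
From HB Require Import structures.
From mathcomp Require Import all_boot all_order all_algebra.
From mathcomp Require Import complex.
From mathcomp Require mpoly.
From mathcomp Require Import all_classical all_reals all_analysis.
From mathcomp Require Import measurable_realfun ring lra.
Import Order.TTheory GRing.Theory Num.Theory.
Import numFieldNormedType.Exports.
Local Open Scope classical_set_scope.
Local Open Scope ring_scope.
Local Open Scope complex_scope.

(* Write N(z) = (|z_(1)|, ..., |z_(k)|).  Pairing with an arbitrary u of the Fock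
   space, the claim is that the integral of g(N) conj(f) u against a radial
   density is a multiple, independent of g, of the integral of g(N) times
   prod_j N_j^(2 s_j).  It is enough to take for g the indicator of a box
   {N <= l}, where it amounts to the scaling in l of the integral of conj(f) u.
   This scaling follows from holomorphy alone: for real tau, the function
     w |-> conj(f(z)) u(e^(w tau) z) e^(- w sum_j s_j tau_j)
   is entire, and translating w by i y amounts to rotating z, which preserves
   Lebesgue measure and N.  After integration over {N <= 1} the contributions of
   two opposite sides of the unit square to Cauchy's theorem therefore cancel,
   so that w = 0 and w = 1 give the same integral.  Polar coordinates are
   replaced by the same principle: the image of Lebesgue measure under N and the
   measure of density prod_j 2 b_j r_j^(2 b_j - 1) agree on boxes up to a constant. *)

Set Implicit Arguments.
Unset Strict Implicit.
Unset Printing Implicit Defensive.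

(** * Linear changes of variables *)

(** Testing against an arbitrary [u] avoids any power series expansion in the Fock space. The
    passage from boxes to a general [g] is a statement about signed functions: from Re(conj(f) u)
    one subtracts the multiple of prod_j N_j^(2 s_j) with the same integral over {N <= 1}. Both
    terms scale by the same power of [l], so the difference integrates to 0 over every box, and its
    positive and negative parts have the same image under N. Only real parts are treated; imaginary
    parts come from [- i u], which is again in the Fock space. The eigenvalue enters as the weighted
    mean of [g]: once it is subtracted the claim is that an integral vanishes, so neither the volume
    of {N <= 1} nor the area of a sphere has to be known. Two obstacles shape the measure theory.
    The symbol [a] is measurable only up to a null set of the orthant, and null sets must be carried
    from there to C^n; its bound is known only through [phi], so integrability is proved on C^n and
    carried the other way. Finally, the projection is a chosen value, so naming it requires
    uniqueness: entire functions equal almost everywhere are equal. *)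

Section lebesgue_tuple_theory.
Context {R : realType}.
Local Notation RT := (measurableTypeR R).
Local Open Scope ereal_scope.

(** Uniqueness of Lebesgue measure: [c] times its image under [x |-> c x + e] gives every half-open
    interval its length. *)
Lemma ge0_lebesgue_measure_affine (c e : R) (G : RT -> \bar R) :
  (0 < c)%R -> measurable_fun [set: RT] G -> (forall x, 0 <= G x) ->
  c%:E * \int[lebesgue_measure]_x G (c * x + e)%R =
  \int[lebesgue_measure]_x G x.
Proof.
move=> c0 mG G0.
pose phi (x : RT) : RT := (c * x + e)%R.
have mphi : measurable_fun setT phi.
  apply: measurable_funD => //; apply: measurable_funM => //.
pose m := pushforward (@lebesgue_measure R) phi.
pose mm : {measure set RT -> \bar R} := measure_function_pushforward__canonical__measure_function_Measure (@lebesgue_measure R) mphi.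
have c0' : (0 <= c)%R by exact: ltW.
have := @lebesgue_measure_unique R (mscale (NngNum c0') mm).
move=> H.
rewrite (_ : \int[_]_x G x = \int[mscale (NngNum c0') mm]_x G x); last first.
  apply: eq_measure_integral => A mA _; apply: H => //.
  move=> _ [[a b]] _ <- /=.
  rewrite /mscale/= /pushforward.
  rewrite (_ : phi @^-1` _ = `](a - e) / c, (b - e) / c]%classic)%R; last first.
    apply/seteqP; split => x /=; rewrite /phi !in_itv/=.
      by rewrite ltr_pdivrMr// ler_pdivlMr// ltrBlDr lerBrDr ![(x * c)%R]mulrC.
    by rewrite ltr_pdivrMr// ler_pdivlMr// ltrBlDr lerBrDr ![(x * c)%R]mulrC.
  rewrite !lebesgue_measure_itv/= !lte_fin ltr_pM2r ?invr_gt0// ltrD2r.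
  case: ifPn => ab; last by rewrite mule0.
  rewrite -!EFinD -EFinM; congr EFin.
  by rewrite -mulrBl mulrC divfK ?gt_eqF// opprB addrA subrK.
rewrite ge0_integral_mscale//=; congr (_ * _).
by rewrite ge0_integral_pushforward.
Qed.

Lemma ge0_integral_lebesgue_tupleS d (G : d.+1.-tuple RT -> \bar R) :
  measurable_fun setT G -> (forall t, 0 <= G t) ->
  \int[lebesgue_tuple R d.+1]_t G t =
  \int[lebesgue_measure]_x \int[lebesgue_tuple R d]_t G (cons_pair (x, t)).
Proof.
move=> mG G0 /=.
rewrite ge0_integral_pushforward//=; last exact: measurable_cons_pair.
have -> : (\int[(lebesgue_measure \x lebesgue_tuple R d)]_x (G \o cons_pair (d:=d)) x) = \int[lebesgue_measure]_x fubini_F (lebesgue_tuple R d) (G \o cons_pair (d:=d)) x.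
  apply: fubini_tonelli1 => //.
    by apply: measurableT_comp => //; exact: measurable_cons_pair.
  by move=> x; exact: G0.
by [].
Qed.

Lemma ge0_integral_lebesgue_tuple0 (G : 0.-tuple RT -> \bar R) :
  \int[lebesgue_tuple R 0]_t G t = G [tuple].
Proof.
rewrite integral_dirac//; last first.
  apply: (@eq_measurable_fun _ _ _ _ _ (cst (G [tuple]))) => // t _.
  by rewrite (tuple0 t).
by rewrite diracT mul1e.
Qed.

Definition affine_tuple d (c e : 'I_d -> R) (t : d.-tuple RT) : d.-tuple RT :=
  [tuple (c i * tnth t i + e i)%R | i < d].

Lemma measurable_affine_tuple d (c e : 'I_d -> R) :
  measurable_fun setT (affine_tuple c e).
Proof.
apply/measurable_fun_tnthP => i.
apply: (@eq_measurable_fun _ _ _ _ _ (fun t : d.-tuple RT => (c i * tnth t i + e i)%R : RT)).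
  by move=> t _ /=; rewrite tnth_mktuple.
apply: measurable_funD => //; apply: measurable_funM => //.
exact: measurable_tnth.
Qed.

Lemma affine_tuple_cons d (c e : 'I_d.+1 -> R) x (t : d.-tuple RT) :
  affine_tuple c e (cons_pair (x, t)) =
  cons_pair ((c ord0 * x + e ord0)%R : RT,
    affine_tuple (c \o lift ord0) (e \o lift ord0) t).
Proof.
apply: eq_from_tnth => i; rewrite tnth_mktuple.
have [j ->|->] := unliftP ord0 i; last by rewrite !tnth0.
by rewrite !tnthS/= tnth_mktuple.
Qed.

Lemma ge0_lebesgue_tuple_affine d (c e : 'I_d -> R) (G : d.-tuple RT -> \bar R) :
  (forall i, 0 < c i)%R -> measurable_fun setT G -> (forall t, 0 <= G t) ->
  (\prod_(i < d) c i)%:E * \int[lebesgue_tuple R d]_t G (affine_tuple c e t) =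
  \int[lebesgue_tuple R d]_t G t.
Proof.
elim: d => [|d IH] in c e G * => c0 mG G0.
  rewrite big_ord0 mul1e !ge0_integral_lebesgue_tuple0.
  by congr G; exact: tuple0.
have mGp : measurable_fun setT (G \o @cons_pair R d).
  by apply: measurableT_comp => //; exact: measurable_cons_pair.
rewrite !ge0_integral_lebesgue_tupleS//; last first.
  by apply: measurableT_comp => //; exact: measurable_affine_tuple.
pose H x := \int[lebesgue_tuple R d]_t G (cons_pair (x, t)).
have mH : measurable_fun [set: RT] H.
  by apply: (measurable_fun_fubini_tonelli_F (G \o @cons_pair R d)) => //= p.
have H0 x : 0 <= H x by apply: integral_ge0 => *.
apply: (etrans _ (@ge0_lebesgue_measure_affine _ (e ord0) H (c0 ord0) mH H0)).
rewrite big_ord_recl EFinM -muleA; congr (_ * _).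
have p0 : (0 <= \prod_(i < d) c (lift ord0 i))%R by apply: prodr_ge0 => *; exact/ltW.
rewrite -ge0_integralZl_EFin//; last 2 first.
- by move=> x _; apply: integral_ge0.
- apply: (measurable_fun_fubini_tonelli_F (fun p => G (affine_tuple c e (cons_pair p)))) => //.
  apply: (measurableT_comp mG); apply: measurableT_comp => //.
    exact: measurable_affine_tuple.
  exact: measurable_cons_pair.
apply: eq_integral => x _; rewrite /H.
rewrite -(IH (c \o lift ord0) (e \o lift ord0) (fun t => G (cons_pair ((c ord0 * x + e ord0)%R : RT, t))))//; last 2 first.
- by move=> i; exact: c0.
- apply: (measurableT_comp mG); apply: measurableT_comp => //.
  exact: measurable_cons_pair.
by congr (_ * _); apply: eq_integral => t _; rewrite affine_tuple_cons.
Qed.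

(** Gives the volume of cubes, the nullity of hyperplanes and the box masses of the polar
    density. *)
Lemma ge0_integral_lebesgue_tuple_prod d (g : 'I_d -> RT -> R) :
  (forall i, measurable_fun setT (g i)) -> (forall i x, 0 <= g i x)%R ->
  \int[lebesgue_tuple R d]_t (\prod_(i < d) g i (tnth t i))%:E =
  \prod_(i < d) \int[lebesgue_measure]_x (g i x)%:E.
Proof.
elim: d => [|d IH] in g * => mg g0.
  by rewrite ge0_integral_lebesgue_tuple0 !big_ord0.
rewrite ge0_integral_lebesgue_tupleS; last 2 first.
- apply/measurable_EFinP.
  apply: measurable_prod => i _; apply: measurableT_comp => //.
  exact: measurable_tnth.
- by move=> t; rewrite lee_fin prodr_ge0.
rewrite big_ord_recl -[X in _ * X]IH//.
have J0 : 0 <= \int[lebesgue_tuple R d]_t (\prod_(i < d) g (lift ord0 i) (tnth t i))%:E.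
  by apply: integral_ge0 => t _; rewrite lee_fin prodr_ge0.
rewrite -ge0_integralZr//; last 2 first.
- exact/measurable_EFinP.
- by move=> x _; rewrite lee_fin.
apply: eq_integral => x _.
rewrite -ge0_integralZl_EFin//; last 2 first.
- by move=> t _; rewrite lee_fin prodr_ge0.
- apply/measurable_EFinP.
  apply: measurable_prod => i _; apply: measurableT_comp => //.
  exact: measurable_tnth.
apply: eq_integral => t _; rewrite -EFinM big_ord_recl tnth0/=.
by congr (_ * _)%:E; apply: eq_bigr => i _; rewrite tnthS.
Qed.

End lebesgue_tuple_theory.

(** * Dilations and rotations of complex space *)

Section dilation.
Context {R : realType} {n : nat}.
Local Notation RT := (measurableTypeR R).
Local Notation C := R[i].
Local Notation V := (n.-tuple RT).
Local Notation nu := (lebesgue_tuple R n \x lebesgue_tuple R n)%E.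
Local Notation mu := (@lebesgue_complex R n).
Local Open Scope ereal_scope.

Lemma ge0_integral_lebesgue_complex (G : 'cV[C]_n -> \bar R) :
  measurable_fun setT G -> (forall z, 0 <= G z) ->
  \int[mu]_z G z = \int[nu]_p G (of_real_pair p).
Proof.
move=> mG G0; rewrite ge0_integral_pushforward//.
exact: measurable_of_real_pair.
Qed.

Definition shear1 (t : 'I_n -> R) (p : V * V) : V * V :=
  ([tuple (tnth p.1 i + t i * tnth p.2 i)%R | i < n], p.2).

Definition shear2 (t : 'I_n -> R) (p : V * V) : V * V :=
  (p.1, [tuple (tnth p.2 i + t i * tnth p.1 i)%R | i < n]).

Lemma measurable_tnth_fst i : measurable_fun setT (fun p : V * V => tnth p.1 i : RT).
Proof. exact: (measurableT_comp (measurable_tnth _) measurable_fst). Qed.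

Lemma measurable_tnth_snd i : measurable_fun setT (fun p : V * V => tnth p.2 i : RT).
Proof. exact: (measurableT_comp (measurable_tnth _) measurable_snd). Qed.

Lemma measurable_shear1 t : measurable_fun setT (shear1 t).
Proof.
apply/measurable_fun_pairP; split; last exact: measurable_snd.
apply/measurable_fun_tnthP => i.
apply: (@eq_measurable_fun _ _ _ _ _ (fun p : V * V => (tnth p.1 i + t i * tnth p.2 i)%R : RT)).
  by move=> p _ /=; rewrite tnth_mktuple.
apply: measurable_funD; first exact: measurable_tnth_fst.
by apply: measurable_funM => //; exact: measurable_tnth_snd.
Qed.

Lemma measurable_shear2 t : measurable_fun setT (shear2 t).
Proof.
apply/measurable_fun_pairP; split; first exact: measurable_fst.
apply/measurable_fun_tnthP => i.
apply: (@eq_measurable_fun _ _ _ _ _ (fun p : V * V => (tnth p.2 i + t i * tnth p.1 i)%R : RT)).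
  by move=> p _ /=; rewrite tnth_mktuple.
apply: measurable_funD; first exact: measurable_tnth_snd.
by apply: measurable_funM => //; exact: measurable_tnth_fst.
Qed.

(** For frozen [y] the shear is a translation in [x]; Tonelli with [y] outside reduces it to the
    affine case. *)
Lemma ge0_integral_shear1 t (F : V * V -> \bar R) :
  measurable_fun setT F -> (forall p, 0 <= F p) ->
  \int[nu]_p F (shear1 t p) = \int[nu]_p F p.
Proof.
move=> mF F0; rewrite (fubini_tonelli2 F)//.
rewrite (fubini_tonelli2 (F \o shear1 t)); last 2 first.
- by apply: measurableT_comp => //; exact: measurable_shear1.
- by move=> p /=.
apply: eq_integral => y _; rewrite /fubini_G /=.
rewrite -[RHS](@ge0_lebesgue_tuple_affine _ _ (fun=> 1%R) (fun i => t i * tnth y i)%R)//; last first.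
  by apply: measurableT_comp => //; exact: measurable_pair2.
rewrite big1// mul1e; apply: eq_integral => x _.
by congr (F (_, _)); apply: eq_mktuple => i; rewrite mul1r.
Qed.

Lemma ge0_integral_shear2 t (F : V * V -> \bar R) :
  measurable_fun setT F -> (forall p, 0 <= F p) ->
  \int[nu]_p F (shear2 t p) = \int[nu]_p F p.
Proof.
move=> mF F0; rewrite (fubini_tonelli1 F)//.
rewrite (fubini_tonelli1 (F \o shear2 t)); last 2 first.
- by apply: measurableT_comp => //; exact: measurable_shear2.
- by move=> p /=.
apply: eq_integral => x _; rewrite /fubini_F /=.
rewrite -[RHS](@ge0_lebesgue_tuple_affine _ _ (fun=> 1%R) (fun i => t i * tnth x i)%R)//; last first.
  by apply: measurableT_comp => //; exact: measurable_pair1.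
rewrite big1// mul1e; apply: eq_integral => y _.
by congr (F (_, _)); apply: eq_mktuple => i; rewrite mul1r.
Qed.

Definition dilate (c : 'I_n -> C) (z : 'cV[C]_n) : 'cV[C]_n :=
  \col_i (c i * z i 0%R)%R.

Lemma dilateM c d z : dilate c (dilate d z) = dilate (fun i => c i * d i)%R z.
Proof. by apply/matrixP => i j; rewrite !mxE mulrA. Qed.

Lemma measurable_complexP d (T : measurableType d) (f : T -> 'cV[C]_n) :
  (forall i, measurable_fun setT (fun x => complex.Re (f x i 0%R))) ->
  (forall i, measurable_fun setT (fun x => complex.Im (f x i 0%R))) ->
  measurable_fun setT f.
Proof.
move=> mRe mIm.
rewrite (_ : f = @of_real_pair R n \o (fun x => to_real_pair (f x))); last first.
  by apply/funext => x /=; rewrite to_real_pairK.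
apply: measurableT_comp; first exact: measurable_of_real_pair.
apply/measurable_fun_pairP; split; apply/measurable_fun_tnthP => i.
  apply: (@eq_measurable_fun _ _ _ _ _ (fun x => complex.Re (f x i 0%R) : RT)); last exact: mRe.
  by move=> x _ /=; rewrite tnth_mktuple.
apply: (@eq_measurable_fun _ _ _ _ _ (fun x => complex.Im (f x i 0%R) : RT)); last exact: mIm.
by move=> x _ /=; rewrite tnth_mktuple.
Qed.

Lemma measurable_Re_coord i :
  measurable_fun setT (fun z : 'cV[C]_n => complex.Re (z i 0%R) : RT).
Proof.
apply: (@eq_measurable_fun _ _ _ _ _ (fun z : 'cV[C]_n => tnth (to_real_pair z).1 i : RT)).
  by move=> z _; rewrite tnth_mktuple.
exact: (measurableT_comp (measurable_tnth_fst i) (@measurable_to_real_pair R n)).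
Qed.

Lemma measurable_Im_coord i :
  measurable_fun setT (fun z : 'cV[C]_n => complex.Im (z i 0%R) : RT).
Proof.
apply: (@eq_measurable_fun _ _ _ _ _ (fun z : 'cV[C]_n => tnth (to_real_pair z).2 i : RT)).
  by move=> z _; rewrite tnth_mktuple.
exact: (measurableT_comp (measurable_tnth_snd i) (@measurable_to_real_pair R n)).
Qed.

Lemma measurable_dilate c : measurable_fun setT (dilate c).
Proof.
apply: measurable_complexP => i.
  apply: (@eq_measurable_fun _ _ _ _ _ (fun z : 'cV[C]_n =>
    complex.Re (c i) * complex.Re (z i 0%R) - complex.Im (c i) * complex.Im (z i 0%R))%R).
    by move=> z _; rewrite !mxE; case: (c i) => ? ?; case: (z i 0%R).
  apply: measurable_funB; apply: measurable_funM => //.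
    exact: measurable_Re_coord.
  exact: measurable_Im_coord.
apply: (@eq_measurable_fun _ _ _ _ _ (fun z : 'cV[C]_n =>
    complex.Re (c i) * complex.Im (z i 0%R) + complex.Im (c i) * complex.Re (z i 0%R))%R).
  by move=> z _; rewrite !mxE; case: (c i) => ? ?; case: (z i 0%R).
apply: measurable_funD; apply: measurable_funM => //.
  exact: measurable_Im_coord.
exact: measurable_Re_coord.
Qed.

Lemma ge0_integral_dilate_pos (c : 'I_n -> R) (G : 'cV[C]_n -> \bar R) :
  (forall i, 0 < c i)%R -> measurable_fun setT G -> (forall z, 0 <= G z) ->
  (\prod_(i < n) c i ^+ 2)%:E * \int[mu]_z G (dilate (fun i => (c i)%:C) z) =
  \int[mu]_z G z.
Proof.
move=> c0 mG G0.
have mGd : measurable_fun setT (G \o dilate (fun i => (c i)%:C)).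
  by apply: measurableT_comp => //; exact: measurable_dilate.
have mGr : measurable_fun setT (G \o @of_real_pair R n).
  by apply: measurableT_comp => //; exact: measurable_of_real_pair.
have pc : (0 <= \prod_(i < n) c i)%R by apply: prodr_ge0 => i _; exact/ltW.
rewrite !ge0_integral_lebesgue_complex//.
rewrite (fubini_tonelli1 (G \o @of_real_pair R n))//; last by move=> p /=.
rewrite (fubini_tonelli1 (G \o dilate (fun i => (c i)%:C) \o @of_real_pair R n))//; last by move=> p /=.
rewrite /fubini_F.
have dilE x y : dilate (fun i => (c i)%:C) (of_real_pair (x, y)) =
    of_real_pair (affine_tuple c (fun=> 0%R) x, affine_tuple c (fun=> 0%R) y).
  apply/matrixP => i j; rewrite !mxE /= !tnth_mktuple !addr0.
  by apply/eqP; rewrite eq_complex/= !mul0r subr0 addr0 !eqxx.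
pose H (x : V) := \int[lebesgue_tuple R n]_y G (of_real_pair (x, y)).
have mH : measurable_fun setT H.
  apply: (measurable_fun_fubini_tonelli_F (G \o @of_real_pair R n)) => //.
  by move=> p /=.
have H0 x : 0 <= H x by apply: integral_ge0.
apply: (etrans _ (@ge0_lebesgue_tuple_affine R n c (fun=> 0%R) H c0 mH H0)).
rewrite prodrXl expr2 EFinM -muleA; congr (_ * _).
rewrite -ge0_integralZl_EFin//; last 2 first.
- by move=> x _; apply: integral_ge0 => y _ /=.
- apply: (measurable_fun_fubini_tonelli_F
    (G \o dilate (fun i => (c i)%:C) \o @of_real_pair R n)).
    by apply: measurableT_comp => //; exact: measurable_of_real_pair.
  by move=> p /=.
apply: eq_integral => x _; rewrite /H.
rewrite -(@ge0_lebesgue_tuple_affine _ _ c (fun=> 0%R)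
  (fun y => G (of_real_pair (affine_tuple c (fun=> 0%R) x, y))))//; last first.
  apply: (measurableT_comp mGr); exact: measurable_pair1.
by congr (_ * _); apply: eq_integral => y _ /=; rewrite dilE.
Qed.

(** A rotation by theta is a product of three shears, with coefficients - tan(theta/2), sin theta, -
    tan(theta/2), and shears preserve Lebesgue measure. The second hypothesis excludes theta = pi,
    where the tangent is infinite. *)
Lemma ge0_integral_rotate_aux (c : 'I_n -> C) (G : 'cV[C]_n -> \bar R) :
  (forall i, complex.Re (c i) ^+ 2 + complex.Im (c i) ^+ 2 = 1)%R ->
  (forall i, 1 + complex.Re (c i) != 0)%R ->
  measurable_fun setT G -> (forall z, 0 <= G z) ->
  \int[mu]_z G (dilate c z) = \int[mu]_z G z.
Proof.
move=> c1 cN1 mG G0.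
have mGd : measurable_fun setT (G \o dilate c).
  by apply: measurableT_comp => //; exact: measurable_dilate.
have mGr : measurable_fun setT (G \o @of_real_pair R n).
  by apply: measurableT_comp => //; exact: measurable_of_real_pair.
rewrite !ge0_integral_lebesgue_complex//.
pose t i := (- (complex.Im (c i) / (1 + complex.Re (c i))))%R.
pose b i := complex.Im (c i).
have rotE p : dilate c (of_real_pair p) =
    of_real_pair (shear1 t (shear2 b (shear1 t p))).
  apply/matrixP => i j; rewrite !mxE /= !tnth_mktuple /t /b.
  move: (c1 i) (cN1 i); case: (c i) => x y /= xy x1.
  have xy' : (y ^+ 2 = 1 - x ^+ 2)%R by rewrite -xy; ring.
  set p1 := tnth p.1 i; set p2 := tnth p.2 i.
  have yy : (y * (y / (1 + x)) = 1 - x)%R.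
    by rewrite mulrA -expr2 xy'; field.
  apply/eqP; rewrite eq_complex/=; apply/andP; split; apply/eqP.
    rewrite !mulrDr !mulNr !mulrN opprK.
    rewrite [(y / (1 + x) * (y * p1))%R]mulrA [(y / (1 + x) * (y * _))%R]mulrA.
    rewrite [(y / (1 + x) * y)%R]mulrC yy.
    have -> : (y / (1 + x) * p2 = y * p2 * (1 + x)^-1)%R by ring.
    by field.
  rewrite !mulrDr !mulNr !mulrN [(y * (y / (1 + x) * p2))%R]mulrA yy; ring.
under eq_integral do rewrite rotE.
rewrite (@ge0_integral_shear1 t (fun p => G (of_real_pair (shear1 t (shear2 b p)))))//; last first.
  apply: (measurableT_comp mGr); apply: measurableT_comp;
    [exact: measurable_shear1|exact: measurable_shear2].
rewrite (@ge0_integral_shear2 b (fun p => G (of_real_pair (shear1 t p))))//; last first.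
  by apply: (measurableT_comp mGr); exact: measurable_shear1.
by rewrite (@ge0_integral_shear1 t (fun p => G (of_real_pair p))).
Qed.

Lemma ge0_integral_rotate (c : 'I_n -> C) (G : 'cV[C]_n -> \bar R) :
  (forall i, complex.Re (c i) ^+ 2 + complex.Im (c i) ^+ 2 = 1)%R ->
  measurable_fun setT G -> (forall z, 0 <= G z) ->
  \int[mu]_z G (dilate c z) = \int[mu]_z G z.
Proof.
move=> c1 mG G0.
(* The excluded value -1 is split as the square of the imaginary unit, whose factors satisfy the
   condition of the three-shear argument; any other value is left to [c3] alone. *)
pose c2 i : C := if (1 + complex.Re (c i) == 0)%R then 'i%C else 1%R.
pose c3 i : C := if (1 + complex.Re (c i) == 0)%R then 'i%C else c i.
have cE : (fun i => c3 i * c2 i)%R = c.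
  apply/funext => i; rewrite /c3 /c2; case: ifPn => [|_]; last by rewrite mulr1.
  move: (c1 i); case: (c i) => x y /= xy; rewrite addrC addr_eq0 => /eqP x1.
  move: xy; rewrite x1 sqrrN expr1n => /eqP; rewrite -subr_eq0 addrAC subrr add0r.
  by rewrite sqrf_eq0 => /eqP ->; apply/eqP; rewrite eq_complex/=; apply/andP; split; apply/eqP; ring.
transitivity (\int[mu]_z G (dilate c3 (dilate c2 z))).
  by apply: eq_integral => z _; rewrite dilateM cE.
rewrite (@ge0_integral_rotate_aux c2 (G \o dilate c3))//=.
- rewrite ge0_integral_rotate_aux// => i; rewrite /c3; case: ifPn => //= _.
  by rewrite expr0n/= expr1n add0r.
- by move=> i; rewrite /c2; case: ifPn => /= _; rewrite ?expr0n/= ?expr1n ?addr0 ?add0r.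
- by move=> i; rewrite /c2; case: ifPn => /= _; rewrite ?addr0 ?oner_eq0.
- by apply: measurableT_comp => //; exact: measurable_dilate.
Qed.

(** Polar decomposition of each [c i]: the modulus is a real scaling of both coordinates, hence the
    square in the Jacobian, and the argument is a rotation. *)
Lemma ge0_integral_dilate (c : 'I_n -> C) (G : 'cV[C]_n -> \bar R) :
  (forall i, c i != 0)%R -> measurable_fun setT G -> (forall z, 0 <= G z) ->
  (\prod_(i < n) ComplexField.Normc.normc (c i) ^+ 2)%:E *
    \int[mu]_z G (dilate c z) = \int[mu]_z G z.
Proof.
move=> c0 mG G0.
pose r i := ComplexField.Normc.normc (c i).
have r0 i : (0 < r i)%R.
  rewrite /r lt_neqAle eq_sym; apply/andP; split.
    by apply: contra (c0 i) => /eqP /ComplexField.Normc.eq0_normc ->.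
  by case: (c i) => x y; exact: sqrtr_ge0.
pose u i : C := ((complex.Re (c i) / r i) +i* (complex.Im (c i) / r i))%R.
rewrite -(@ge0_integral_dilate_pos r G)//; congr (_ * _).
rewrite -(@ge0_integral_rotate u (fun z => G (dilate (fun i => (r i)%:C) z)))//; last 2 first.
- move=> i; rewrite /u/=; move: (r0 i); rewrite /r; case: (c i) => x y /= s0.
  rewrite !exprMn -mulrDl exprVn sqr_sqrtr ?addr_ge0 ?sqr_ge0// divff//.
  by move: s0; rewrite sqrtr_gt0 => /gt_eqF ->.
- by apply: measurableT_comp => //; exact: measurable_dilate.
apply: eq_integral => z _; rewrite dilateM; congr (G (dilate _ z)).
apply/funext => i; rewrite /u; apply/eqP; rewrite eq_complex/=.
move: (r0 i); case: (c i) => x y /= s0.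
have ri0 : r i != 0%R by rewrite gt_eqF.
by apply/andP; split; apply/eqP; field.
Qed.

End dilation.

(** * Goursat's theorem on the unit square *)

Section goursat.
Context {R : realType}.
Local Notation J f a b := (\int[@lebesgue_measure R]_(t in `[a, b]) f t).

Lemma continuous_integrable_itv (f : R -> R) (a b : R) : continuous f ->
  (@lebesgue_measure R).-integrable `[a, b] (EFin \o f).
Proof.
move=> cf; apply: continuous_compact_integrable; first exact: segment_compact.
exact: continuous_subspaceT.
Qed.

Lemma Rintegral_itv_chasles (f : R -> R) (a b c : R) : continuous f ->
  a <= b -> b <= c -> J f a c = J f a b + J f b c.
Proof.
move=> cf ab bc.
rewrite -(@Rintegral_itv_obnd_cbnd R b (BRight c)); last first.
  by apply: (integrableS _ _ _ (continuous_integrable_itv b c cf)) => //; exact: subset_itv_oc_cc.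
rewrite -(@Rintegral_itvB R f (BLeft a) (BRight c) b)//.
- by rewrite addrC subrK.
- exact: continuous_integrable_itv.
Qed.

Lemma Rintegral_itv_near_cst (f : R -> R) (a d c K : R) : continuous f -> 0 <= d ->
  (forall t, a <= t <= a + d -> `|f t - c| <= K) ->
  `|J f a (a + d) - c * d| <= K * d.
Proof.
move=> cf d0 fK.
have lenE : fine (@lebesgue_measure R `[a, a + d]%classic) = d.
  rewrite lebesgue_measure_itv/= lte_fin ltrDl; case: ltP => d1.
    by rewrite /= addrC addKr.
  by apply/eqP; rewrite eq_le d0 d1.
have ci (k : R) : (@lebesgue_measure R).-integrable `[a, a + d] (EFin \o cst k).
  by apply: continuous_integrable_itv => x; exact: cvg_cst.
have cfc : continuous (fun t => f t - c).
  by move=> t; apply: cvgB; [exact: cf|exact: cvg_cst].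
have cE k : k * d = J (fun=> k) a (a + d) by rewrite Rintegral_cst// lenE.
rewrite (cE c) (cE K) -RintegralB//; last 2 first.
- exact: continuous_integrable_itv.
- exact: ci.
apply: le_trans (le_normr_Rintegral _ _) _ => //.
  exact: continuous_integrable_itv.
apply: le_Rintegral => //.
- apply: continuous_integrable_itv => t.
  by apply: cvg_norm; exact: cfc.
- exact: ci.
Qed.

Variables A B : R -> R -> R.
Hypothesis cA : forall y, continuous (A ^~ y).
Hypothesis cB : forall x, continuous (B x).
(** The coefficient [a2] shared by the two expansions expresses closedness: it is both the
    y-derivative of [A] and the x-derivative of [B]. No continuity of the coefficients in [x], [y]
    is asked. *)
Hypothesis dAB : forall x y, exists a1 a2 b2 : R, forall e : R, 0 < e ->
  exists2 d : R, 0 < d & forall s t, `|s - x| <= d -> `|t - y| <= d ->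
    `|A s t - A x y - (a1 * (s - x) + a2 * (t - y))| <= e * (`|s - x| + `|t - y|) /\
    `|B s t - B x y - (a2 * (s - x) + b2 * (t - y))| <= e * (`|s - x| + `|t - y|).

(** The counterclockwise integral of [A dx + B dy] along the boundary of a square of side [d], with
    [p] its lower left corner. *)
Let bd (d : R) (p : R * R) : R :=
  (J (A ^~ p.2) p.1 (p.1 + d) - J (A ^~ (p.2 + d)) p.1 (p.1 + d)) +
  (J (B (p.1 + d)) p.2 (p.2 + d) - J (B p.1) p.2 (p.2 + d)).

Let bd_split (h : R) (p : R * R) : 0 <= h ->
  bd (h + h) p = bd h p + bd h (p.1 + h, p.2) + bd h (p.1, p.2 + h)
    + bd h (p.1 + h, p.2 + h).
Proof.
move=> h0; rewrite /bd/= !addrA.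
have hA y : J (A ^~ y) p.1 (p.1 + h + h) =
    J (A ^~ y) p.1 (p.1 + h) + J (A ^~ y) (p.1 + h) (p.1 + h + h).
  by apply: Rintegral_itv_chasles => //; rewrite lerDl.
have hB x : J (B x) p.2 (p.2 + h + h) =
    J (B x) p.2 (p.2 + h) + J (B x) (p.2 + h) (p.2 + h + h).
  by apply: Rintegral_itv_chasles => //; rewrite lerDl.
by rewrite !hA !hB; ring.
Qed.

(** Pigeonhole on the four half-size squares: inner sides cancel, so one of them carries at least a
    quarter of the boundary integral. The witness [q] is its corner. *)
Let bd_step (h : R) (p : R * R) : 0 <= h -> exists q : R * R,
  [/\ p.1 <= q.1 <= p.1 + h, p.2 <= q.2 <= p.2 + h &
      `|bd (h + h) p| <= 4 * `|bd h q|].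
Proof.
move=> h0; apply: contrapT => /forallNP H.
have {}H q : p.1 <= q.1 <= p.1 + h -> p.2 <= q.2 <= p.2 + h ->
    4 * `|bd h q| < `|bd (h + h) p|.
  by move=> q1 q2; rewrite ltNge; apply/negP => q3; apply: (H q).
have H1 := H p; have H2 := H (p.1 + h, p.2).
have H3 := H (p.1, p.2 + h); have H4 := H (p.1 + h, p.2 + h).
move: H1 H2 H3 H4; rewrite /= !lexx !lerDl !h0 => /(_ isT isT) H1.
move=> /(_ isT isT) H2 /(_ isT isT) H3 /(_ isT isT) H4.
have : `|bd (h + h) p| <= `|bd h p| + `|bd h (p.1 + h, p.2)| + `|bd h (p.1, p.2 + h)|
    + `|bd h (p.1 + h, p.2 + h)|.
  rewrite bd_split//; apply: le_trans (ler_normD _ _) _; rewrite lerD2r.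
  by apply: le_trans (ler_normD _ _) _; rewrite lerD2r; exact: ler_normD.
lra.
Qed.

(** Constants and the terms in [a1], [b2] cancel between opposite sides; the terms in [a2]
    contribute - a2 h^2 and a2 h^2, which cancel too. What is left is a remainder of at most 2 e h
    along each of four sides of length h, whence the 8. *)
Let bd_local x y (e : R) : 0 < e -> exists2 d : R, 0 < d & forall (h : R) (p : R * R),
  0 <= h <= d -> p.1 <= x <= p.1 + h -> p.2 <= y <= p.2 + h ->
  `|bd h p| <= 8 * e * h ^+ 2.
Proof.
move=> e0; have [a1 [a2 [b2 H]]] := dAB x y.
have [d d0 {}H] := H e e0.
exists d => // h p /andP[h0 hd] /andP[px1 px2] /andP[py1 py2].
have near (u v : R) : v <= u + h -> u <= v -> forall s : R, u <= s <= u + h -> `|s - v| <= h.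
  by move=> vu uv s /andP[us su]; rewrite ler_norml; apply/andP; split; lra.
have Hn s t : p.1 <= s <= p.1 + h -> p.2 <= t <= p.2 + h ->
    `|A s t - A x y - (a1 * (s - x) + a2 * (t - y))| <= e * (h + h) /\
    `|B s t - B x y - (a2 * (s - x) + b2 * (t - y))| <= e * (h + h).
  move=> ps pt; have sx := near _ _ px2 px1 s ps; have ty := near _ _ py2 py1 t pt.
  have [|| HA HB] := H s t; [exact: le_trans hd|exact: le_trans hd|].
  have le2 : e * (`|s - x| + `|t - y|) <= e * (h + h).
    by apply: ler_wpM2l; [exact: ltW|exact: lerD].
  by split; exact: le_trans le2.
have bot : p.2 <= p.2 <= p.2 + h by rewrite lexx lerDl.
have top : p.2 <= p.2 + h <= p.2 + h by rewrite lexx lerDl h0.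
have lft : p.1 <= p.1 <= p.1 + h by rewrite lexx lerDl.
have rgt : p.1 <= p.1 + h <= p.1 + h by rewrite lexx lerDl h0.
have cA' : continuous (fun s => A s p.2 - A s (p.2 + h)).
  by move=> s; apply: cvgB; exact: cA.
have cB' : continuous (fun t => B (p.1 + h) t - B p.1 t).
  by move=> s; apply: cvgB; exact: cB.
rewrite /bd -RintegralB//; last 2 first.
- exact: continuous_integrable_itv.
- exact: continuous_integrable_itv.
rewrite -RintegralB//; last 2 first.
- exact: continuous_integrable_itv.
- exact: continuous_integrable_itv.
have := @Rintegral_itv_near_cst _ p.1 h (- (a2 * h)) (4 * e * h) cA' h0.
have := @Rintegral_itv_near_cst _ p.2 h (a2 * h) (4 * e * h) cB' h0.
set IA := Rintegral _ _ _; set IB := Rintegral _ _ _ => HB HA.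
have {}HA : `|IB - - (a2 * h) * h| <= 4 * e * h * h.
  apply: HA => s ps.
  have [+ _] := Hn s _ ps bot; have [+ _] := Hn s _ ps top.
  by rewrite !ler_norml => /andP[? ?] /andP[? ?]; apply/andP; split; lra.
have {}HB : `|IA - a2 * h * h| <= 4 * e * h * h.
  apply: HB => t pt.
  have [_ +] := Hn _ t lft pt; have [_ +] := Hn _ t rgt pt.
  by rewrite !ler_norml => /andP[? ?] /andP[? ?]; apply/andP; split; lra.
move: HA HB; rewrite expr2 !ler_norml => /andP[? ?] /andP[? ?].
by apply/andP; split; lra.
Qed.

(* Goursat's bisection; [A dx + B dy] is closed in the pointwise sense only. *)
Lemma goursat_square :
  J (A ^~ 0) 0 1 - J (A ^~ 1) 0 1 + (J (B 1) 0 1 - J (B 0) 0 1) = 0.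
Proof.
have -> : J (A ^~ 0) 0 1 - J (A ^~ 1) 0 1 + (J (B 1) 0 1 - J (B 0) 0 1) = bd 1 (0, 0).
  by rewrite /bd/= !add0r.
pose h m : R := 2^-1 ^+ m.
have h0 m : 0 <= h m by apply: exprn_ge0; lra.
have hS m : h m = h m.+1 + h m.+1 by rewrite /h exprS; lra.
(* [F m p] is a chosen corner of a bad quarter of the square of side [h m] at [p]; iterating it
   gives the nested squares [P]. *)
have [F HF] : exists F : nat -> R * R -> R * R, forall m p,
    [/\ p.1 <= (F m p).1 <= p.1 + h m.+1, p.2 <= (F m p).2 <= p.2 + h m.+1 &
      `|bd (h m) p| <= 4 * `|bd (h m.+1) (F m p)|].
  have HH (mp : nat * (R * R)) : {q : R * R | [/\ mp.2.1 <= q.1 <= mp.2.1 + h mp.1.+1,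
      mp.2.2 <= q.2 <= mp.2.2 + h mp.1.+1 &
      `|bd (h mp.1) mp.2| <= 4 * `|bd (h mp.1.+1) q|]}.
    by apply: cid; rewrite (hS mp.1); exact: bd_step.
  exists (fun m p => sval (HH (m, p))) => m p.
  by case: (HH (m, p)).
pose P := fix P m : R * R := if m is m'.+1 then F m' (P m') else (0, 0).
have P1 m k : (P m).1 <= (P (m + k)%N).1 /\ (P (m + k)%N).1 + h (m + k)%N <= (P m).1 + h m.
  elim: k => [|k [IH1 IH2]]; first by rewrite addn0.
  have [/andP[? ?] _ _] := HF (m + k)%N (P (m + k)%N).
  by rewrite addnS /=; have := hS (m + k)%N; split; lra.
have P2 m k : (P m).2 <= (P (m + k)%N).2 /\ (P (m + k)%N).2 + h (m + k)%N <= (P m).2 + h m.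
  elim: k => [|k [IH1 IH2]]; first by rewrite addn0.
  have [_ /andP[? ?] _] := HF (m + k)%N (P (m + k)%N).
  by rewrite addnS /=; have := hS (m + k)%N; split; lra.
have bdP m : `|bd 1 (0, 0)| * h m ^+ 2 <= `|bd (h m) (P m)|.
  elim: m => [|m IH]; first by rewrite /h !expr0 expr1n mulr1.
  have [_ _ /(le_trans IH)] := HF m (P m).
  have -> : h m ^+ 2 = 4 * h m.+1 ^+ 2 by rewrite (hS m); ring.
  by rewrite mulrCA ler_pM2l.
(* Nested intervals: the supremum of the left ends lies in all of them. *)
have lim (c : nat -> R) : (forall m k, c m <= c (m + k)%N /\ c (m + k)%N + h (m + k)%N <= c m + h m) ->
    exists x, forall m, c m <= x <= c m + h m.
  move=> Hc.
  have ub m : ubound (range c) (c m + h m).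
    move=> _ [k _ <-]; have [km|mk] := leP k m.
      have [] := Hc k (m - k)%N; rewrite subnKC// => ? _; have := h0 m; lra.
    have [] := Hc m (k - m)%N; rewrite subnKC ?(ltnW mk)// => _ ?; have := h0 k; lra.
  exists (sup (range c)) => m; apply/andP; split.
    by apply: ub_le_sup; [exists (c 0%N + h 0%N); exact: ub|exists m].
  by apply: ge_sup; [exists (c m), m|exact: ub].
have [x Hx] := lim (fun m => (P m).1) P1.
have [y Hy] := lim (fun m => (P m).2) P2.
apply/eqP; rewrite -normr_le0; apply/ler_addgt0Pl => e e0; rewrite addr0.
(* The 8 offsets the constant of [bd_local]; the factor [h m ^+ 2] there then cancels against the
   one in [bdP]. *)
have e80 : 0 < e / 8 by lra.
have [d d0 Hd] := bd_local x y e80.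
have [m hm] : exists m, h m <= d.
  have : h @ \oo --> (0 : R) by apply: cvg_expr; rewrite ger0_norm; lra.
  move=> /cvgrPdist_le /(_ d d0) [m _ Hm]; exists m.
  by have := Hm m (leqnn m); rewrite sub0r normrN ger0_norm.
have hm0 : 0 < h m by apply: exprn_gt0; lra.
have := Hd (h m) (P m); rewrite h0 hm => /(_ isT (Hx m) (Hy m)).
move=> /(le_trans (bdP m)).
by rewrite ler_pM2r ?exprn_gt0//; lra.
Qed.

End goursat.

(** * Complex derivatives, the exponential, and Cauchy's theorem on the unit square *)

Section derive_expansion.
Context {K : numFieldType}.
Implicit Types (f : K -> K) (x a e d h : K).

(** The difference quotient multiplied out, so that the increment 0 is no longer an exception and no
    division is left. *)
Lemma is_derive_nearP f x a : is_derive x 1 f a <->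
  forall e : K, 0 < e -> exists2 d : K, 0 < d &
    forall h : K, `|h| < d -> `|f (x + h) - f x - a * h| <= e * `|h|.
Proof.
pose q (h : K) : K := h^-1 *: ((f \o shift x) (h *: 1) - f x).
have E l h : h != 0 -> `|f (x + h) - f x - l * h| = `|l - q h| * `|h|.
  move=> h0; rewrite -normrM distrC; congr (`| _ |); rewrite /q /= /shift/=.
  by rewrite /GRing.scale /= mulr1 [h + x]addrC; field.
split=> [[df <-] e e0|H].
  have {}df : q @ 0^' --> 'D_1 f x by [].
  move/cvgrPdist_le : df => /(_ e e0) [d /= d0 Hd]; exists d => // h hd.
  have [->|h0] := eqVneq h 0; first by rewrite addr0 subrr mulr0 subr0 normr0 mulr0.
  rewrite E// ler_wpM2r//; apply: Hd => //=.
  by rewrite sub0r normrN.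
have qa : q @ 0^' --> a.
  apply/cvgrPdist_le => e e0; have [d d0 Hd] := H e e0.
  exists d => //= h /= hd h0; rewrite sub0r normrN in hd.
  by have := Hd h hd; rewrite E// ler_pM2r// normr_gt0.
apply: DeriveDef; first by apply/cvg_ex; exists a.
exact: cvg_lim.
Qed.

End derive_expansion.

Section complex_differentiability.
Context {R : realType}.
Local Notation C := R[i].
Local Notation normc := ComplexField.Normc.normc.

Lemma normrC_normc (z : C) : `|z| = (normc z)%:C.
Proof. by case: z. Qed.

Lemma normc_ge0 (z : C) : 0 <= normc z.
Proof. by case: z => x y; exact: sqrtr_ge0. Qed.

Lemma normc_gt0 (z : C) : (0 < normc z) = (z != 0).
Proof. by rewrite -ltcR -normrC_normc normr_gt0. Qed.

Lemma ler_normcD (y z : C) : normc (y + z) <= normc y + normc z.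
Proof. exact: (le_normcD (y : Rcomplex R)). Qed.

Lemma normcN (z : C) : normc (- z) = normc z.
Proof. by case: z => x y; rewrite /= !sqrrN. Qed.

Lemma normr_le_normc_Re (z : C) : `|complex.Re z| <= normc z.
Proof. by have := normc_ge_Re z; rewrite normrC_normc lecR. Qed.

Lemma normr_le_normc_Im (z : C) : `|complex.Im z| <= normc z.
Proof.
case: z => x y /=; rewrite -sqrtr_sqr ler_wsqrtr// lerDr; exact: sqr_ge0.
Qed.

Lemma normc_le_ReIm (z : C) : normc z <= `|complex.Re z| + `|complex.Im z|.
Proof.
case: z => x y /=; rewrite -[leRHS]ger0_norm ?addr_ge0// -sqrtr_sqr ler_wsqrtr//.
have := mulr_ge0 (normr_ge0 x) (normr_ge0 y).
rewrite -[x ^+ 2]real_normK ?num_real// -[y ^+ 2]real_normK ?num_real//; lra.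
Qed.

Lemma gt0_complexE (e : C) : 0 < e -> exists2 r : R, 0 < r & e = r%:C.
Proof.
by case: e => x y; rewrite ltcE/= => /andP[/eqP -> x0]; exists x.
Qed.

Lemma is_derive_normcP (f : C -> C) (w a : C) : is_derive w 1 f a <->
  forall e : R, 0 < e -> exists2 d : R, 0 < d &
    forall h : C, normc h < d -> normc (f (w + h) - f w - a * h) <= e * normc h.
Proof.
split=> [/is_derive_nearP H e e0|H].
  have [|_ /gt0_complexE[d d0 ->] Hd] := H e%:C; first by rewrite ltcR.
  exists d => // h hd; have := Hd h; rewrite !normrC_normc ltcR => /(_ hd).
  by rewrite -rmorphM lecR.
apply/is_derive_nearP => _ /gt0_complexE[e e0 ->].
have [d d0 Hd] := H e e0; exists d%:C; first by rewrite ltcR.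
by move=> h; rewrite !normrC_normc ltcR -rmorphM lecR; exact: Hd.
Qed.

(** Built from real functions: the addition law reduces to those of [expR], [cos] and [sin], and
    measurability is immediate. *)
Definition cexp (w : C) : C :=
  (expR (complex.Re w) * cos (complex.Im w)) +i*
  (expR (complex.Re w) * sin (complex.Im w)).

Lemma cexpD v w : cexp (v + w) = cexp v * cexp w.
Proof.
case: v w => [x y] [s t]; rewrite /cexp /= expRD cosD sinD.
by apply/eqP; rewrite eq_complex/=; apply/andP; split; apply/eqP; ring.
Qed.

Lemma cexp0 : cexp 0 = 1.
Proof. by rewrite /cexp /= expR0 cos0 sin0 mulr1 mulr0. Qed.

Lemma normc_cexp w : normc (cexp w) = expR (complex.Re w).
Proof.
rewrite /cexp /= !exprMn -mulrDr cos2Dsin2 mulr1 sqrtr_sqr.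
by rewrite ger0_norm// expR_ge0.
Qed.

Lemma cexp_neq0 w : cexp w != 0.
Proof. by rewrite -normc_gt0 normc_cexp expR_gt0. Qed.

Lemma is_derive_cexp0 : is_derive (0 : C) 1 cexp (1 : C).
Proof.
apply/is_derive_normcP => e e0.
(* The bound [e1 <= 1] gives [expR x <= 3]; the two components of the remainder are then at most 4
   e1 N and 5 e1 N, and 9/16 of [e N] is enough. *)
have [e1 [e10 e11 e18]] : exists e1 : R, [/\ 0 < e1, e1 <= 1 & e1 <= e / 16].
  exists (Num.min 1 (e / 16)); rewrite lt_min ltr01 !ge_min !lexx orbT; split => //.
  by rewrite divr_gt0.
have [d1 d10 H1] := (is_derive_nearP _ _ _).1 (is_derive_expR (0 : R)) e1 e10.
have [d2 d20 H2] := (is_derive_nearP _ _ _).1 (is_derive_sin (0 : R)) e1 e10.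
have [d3 d30 H3] := (is_derive_nearP _ _ _).1 (is_derive_cos (0 : R)) e1 e10.
pose d := Num.min e1 (Num.min d1 (Num.min d2 d3)).
exists d; first by rewrite !lt_min e10 d10 d20 d30.
move=> h; have := normr_le_normc_Re h; have := normr_le_normc_Im h.
set N := normc h => hI hR hd.
move: (hd); rewrite !lt_min => /and4P[N1 N2 N3 N4].
move: hI hR; case: h @N hd N1 N2 N3 N4 => x y N hd N1 N2 N3 N4 /= hI hR.
have := H1 x (le_lt_trans hR N2); have := H2 y (le_lt_trans hI N3).
have := H3 y (le_lt_trans hI N4).
rewrite !add0r expR0 cos0 sin0 oppr0 mul0r !subr0 !mul1r => Hc Hs He.
apply: le_trans (normc_le_ReIm ((expR x * cos y - 1 - x) +i*
  (expR x * sin y - 0 - (y + 0 * x)))) _ => /=.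
have E0 := expR_ge0 x; have x1 : `|x| <= e1 by apply: le_trans hR (ltW N1).
have Ex : `|expR x - 1| <= 2 * `|x|.
  have -> : expR x - 1 = (expR x - 1 - x) + x by ring.
  apply: le_trans (ler_normD _ _) _.
  have : e1 * `|x| <= 1 * `|x| by rewrite ler_wpM2r.
  lra.
have E3 : expR x <= 3.
  by have := le_trans (ler_norm _) Ex; lra.
have HR : `|expR x * cos y - 1 - x| <= e1 * N + 3 * (e1 * N).
  have -> : expR x * cos y - 1 - x = (expR x - 1 - x) + expR x * (cos y - 1) by ring.
  apply: le_trans (ler_normD _ _) _; rewrite normrM (ger0_norm E0); apply: lerD.
    by apply: le_trans He _; rewrite ler_wpM2l// ltW.
  apply: ler_pM => //; apply: le_trans Hc _.
  by rewrite ler_wpM2l// ltW.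
have HI : `|expR x * sin y - 0 - (y + 0 * x)| <= 3 * (e1 * N) + 2 * e1 * N.
  have -> : expR x * sin y - 0 - (y + 0 * x) =
    expR x * (sin y + 0 - y) + (expR x - 1) * y by ring.
  apply: le_trans (ler_normD _ _) _; rewrite !normrM (ger0_norm E0); apply: lerD.
    apply: ler_pM => //; apply: le_trans Hs _.
    by rewrite ler_wpM2l// ltW.
  apply: ler_pM => //; apply: le_trans Ex _; lra.
have : e1 * N <= e / 16 * N by rewrite ler_wpM2r// (le_trans _ hR).
have : 0 <= e * N by apply: mulr_ge0; [exact: ltW|exact: le_trans hR].
lra.
Qed.

Lemma is_derive_cexp (w : C) : is_derive w 1 cexp (cexp w).
Proof.
apply/is_derive_normcP => e e0.
have cw : 0 < normc (cexp w) by rewrite normc_gt0 cexp_neq0.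
have [|d d0 Hd] := (is_derive_normcP _ _ _).1 is_derive_cexp0 (e / normc (cexp w)).
  by rewrite divr_gt0.
exists d => // h hd; have := Hd h hd.
rewrite add0r cexp0 mul1r cexpD => H.
have -> : cexp w * cexp h - cexp w - cexp w * h = cexp w * (cexp h - 1 - h) by ring.
rewrite ComplexField.Normc.normcM mulrC -ler_pdivlMr//.
by rewrite mulrAC.
Qed.

Lemma locally_lipschitz_continuous (f : R -> R) (x K d : R) : 0 < d ->
  (forall s, `|s - x| <= d -> `|f s - f x| <= K * `|s - x|) ->
  {for x, continuous f}.
Proof.
move=> d0 H; apply/cvgrPdist_le => /= e e0.
have K0 : 0 < `|K| + 1 by have := normr_ge0 K; lra.
have m0 : 0 < Num.min d (e / (`|K| + 1)) by rewrite lt_min d0 divr_gt0.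
exists (Num.min d (e / (`|K| + 1))) => //= s /=; rewrite lt_min => /andP[sd se].
rewrite distrC; apply: le_trans (H s _) _; first by rewrite distrC ltW.
rewrite distrC; apply: (@le_trans _ _ ((`|K| + 1) * `|x - s|)).
  by rewrite ler_wpM2r// (le_trans (ler_norm K))// lerDl.
by rewrite mulrC -ler_pdivlMr// ltW.
Qed.

Local Notation J f := (\int[@lebesgue_measure R]_(t in `[0, 1]) f t).

(** The imaginary part of the contour integral of g dw around the unit square, by Im(g dw) = Im g dx
    + Re g dy. Pointwise differentiability does not provide a continuous derivative, hence bisection
    rather than Green's formula. *)
Lemma goursat_complex (g : C -> C) : (forall w : C, differentiable g w) ->
  J (fun t => complex.Re (g (1 +i* t))) - J (fun t => complex.Re (g (0 +i* t))) =
  J (fun t => complex.Im (g (t +i* 1))) - J (fun t => complex.Im (g (t +i* 0))).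
Proof.
move=> dg.
pose A x y := complex.Im (g (x +i* y)).
pose B x y := complex.Re (g (x +i* y)).
have dAB x y : exists a1 a2 b2 : R, forall e : R, 0 < e ->
  exists2 d : R, 0 < d & forall s t, `|s - x| <= d -> `|t - y| <= d ->
    `|A s t - A x y - (a1 * (s - x) + a2 * (t - y))| <= e * (`|s - x| + `|t - y|) /\
    `|B s t - B x y - (a2 * (s - x) + b2 * (t - y))| <= e * (`|s - x| + `|t - y|).
  have /derivable1_diffP/derivableP := dg (x +i* y).
  set a := 'D_1 g _ => /is_derive_normcP H.
  (* Cauchy-Riemann: Im g has increment Im a dx + Re a dy and Re g has increment Re a dx - Im a dy,
     so the shared coefficient is Re a. *)
  exists (complex.Im a), (complex.Re a), (- complex.Im a) => e e0.
  have [d d0 Hd] := H e e0.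
  (* Two coordinates within d/3 keep the complex increment strictly below d. *)
  exists (d / 3) => [|s t sx ty]; first by rewrite divr_gt0.
  have hs := normc_le_ReIm ((s - x) +i* (t - y)); rewrite /= in hs.
  have /(Hd _) : normc ((s - x) +i* (t - y)) < d.
    by apply: le_lt_trans hs _; lra.
  have -> : (x +i* y) + ((s - x) +i* (t - y)) = s +i* t.
    by apply/eqP; rewrite eq_complex/=; apply/andP; split; apply/eqP; ring.
  set r := g _ - _ - _ => Hr.
  have {}Hr : normc r <= e * (`|s - x| + `|t - y|).
    by apply: le_trans Hr _; rewrite ler_pM2l.
  split.
    apply: le_trans Hr; apply: le_trans (normr_le_normc_Im _).
    rewrite /r /A; case: (g _) => ? ?; case: (g _) => ? ?; case: (a) => ? ? /=.
    by rewrite [X in _ <= `|_ - X|]addrC.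
  apply: le_trans Hr; apply: le_trans (normr_le_normc_Re _).
  rewrite /r /B; case: (g _) => ? ?; case: (g _) => ? ?; case: (a) => ? ? /=.
  by rewrite mulNr.
have cA y : continuous (A ^~ y).
  move=> x; have [a1 [a2 [b2 /(_ 1 ltr01)[d d0 H]]]] := dAB x y.
  apply: (@locally_lipschitz_continuous _ _ (`|a1| + 1) d d0) => s sx.
  have [|+ _] := H s y sx; first by rewrite subrr normr0 ltW.
  rewrite subrr normr0 mulr0 !addr0 mul1r => Hs.
  rewrite -[A s y - A x y](subrK (a1 * (s - x))).
  by apply: le_trans (ler_normD _ _) _; rewrite normrM mulrDl mul1r addrC lerD2l.
have cB x : continuous (B x).
  move=> y; have [a1 [a2 [b2 /(_ 1 ltr01)[d d0 H]]]] := dAB x y.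
  apply: (@locally_lipschitz_continuous _ _ (`|b2| + 1) d d0) => s sx.
  have [|_ +] := H x s _ sx; first by rewrite subrr normr0 ltW.
  rewrite subrr normr0 mulr0 !add0r mul1r => Hs.
  rewrite -[B x s - B x y](subrK (b2 * (s - y))).
  by apply: le_trans (ler_normD _ _) _; rewrite normrM mulrDl mul1r addrC lerD2l.
have := goursat_square cA cB dAB; rewrite /A /B.
set a1 := Rintegral _ _ _; set a2 := Rintegral _ _ _.
set a3 := Rintegral _ _ _; set a4 := Rintegral _ _ _; lra.
Qed.

Lemma differentiable_cexpM (a w : C) : differentiable (fun v : C => cexp (v * a)) w.
Proof.
have d1 : differentiable (fun v : C => v * a) w by exact: differentiableM.
have d2 : differentiable cexp (w * a).
  by apply/derivable1_diffP; have := is_derive_cexp (w * a); case.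
exact: (differentiable_comp d1 d2).
Qed.

Lemma differentiable_dilate_cexp n (u : 'cV[C]_n -> C) (tau : 'I_n -> R)
    (s : R) (c : C) (z : 'cV[C]_n) : (forall z : 'cV[C]_n, differentiable u z) -> forall w : C,
  differentiable (fun v : C => c * u (dilate (fun i => cexp (v * (tau i)%:C)) z) *
                           cexp (v * s%:C)) w.
Proof.
move=> du w.
(* The curve is written as a finite sum of scalar functions times basis vectors, so that the sum
   rule applies before the chain rule with [u]. *)
pose p (w : C) := \sum_(i < n) (cexp (w * (tau i)%:C) * z i 0) *: (delta_mx i 0 : 'cV[C]_n).
have pE v : dilate (fun i => cexp (v * (tau i)%:C)) z = p v.
  apply/matrixP => i j; rewrite ord1 summxE (bigD1 i)//= big1 ?addr0; last first.
    by move=> l li; rewrite !mxE eq_sym (negbTE li) mulr0.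
  by rewrite !mxE !eqxx mulr1.
have dp : differentiable p w.
  rewrite (_ : p = \sum_(i < n) (fun w => (cexp (w * (tau i)%:C) * z i 0) *: (delta_mx i 0 : 'cV[C]_n))); last first.
    by apply/funext => v; rewrite /p fct_sumE.
  apply: differentiable_sum => i; apply: differentiableZl.
  by apply: differentiableM => //; exact: differentiable_cexpM.
apply: differentiableM; last exact: differentiable_cexpM.
apply: differentiableM => //.
under eq_fun do rewrite pE.
by apply: differentiable_comp => //; exact: du.
Qed.

End complex_differentiability.

(** * Continuous functions on complex space *)

Section complex_space_theory.
Context {R : realType} {n : nat}.
Local Notation RT := (measurableTypeR R).
Local Notation C := R[i].
Local Notation normc := ComplexField.Normc.normc.
Local Notation mu := (@lebesgue_complex R n).
Implicit Types (u : 'cV[C]_n -> C) (z : 'cV[C]_n).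

Lemma continuous_normcP u z : {for z, continuous u} ->
  forall e : R, 0 < e -> exists2 d : R, 0 < d &
    forall v : 'cV[C]_n, (forall i, normc (z i 0 - v i 0) < d) -> normc (u z - u v) < e.
Proof.
move=> /cvgrPdist_lt uz e e0.
have /nbhs_ballP[_ /= /gt0_complexE[d d0 ->] Hd] := uz e%:C ltac:(by rewrite ltcR).
exists d => // v vd; rewrite -ltcR -normrC_normc; apply: Hd.
split=> [|i j]; first by rewrite ltcR.
by rewrite ord1 /ball/= normrC_normc ltcR; exact: vd.
Qed.

(** The sigma-algebra is transported from products of real lines and not generated by open sets, so
    continuity is turned into measurability by hand: [r] is the pointwise limit of its values at the
    grid points [pt m (kap m z)] of mesh 1/(m+1), and each approximation takes countably many values
    on measurable cells. *)
Lemma normc_continuous_measurable (r : 'cV[C]_n -> R) :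
  (forall z, forall e : R, 0 < e -> exists2 d : R, 0 < d &
    forall v : 'cV[C]_n, (forall i, normc (z i 0 - v i 0) < d) -> `|r z - r v| < e) ->
  measurable_fun setT r.
Proof.
move=> cr.
pose K := (n.-tuple int * n.-tuple int)%type.
pose kap (m : nat) z : K :=
  ([tuple Num.floor (m.+1%:R * complex.Re (z i 0)) | i < n],
   [tuple Num.floor (m.+1%:R * complex.Im (z i 0)) | i < n]).
pose pt (m : nat) (c : K) : 'cV[C]_n :=
  \col_i (((tnth c.1 i)%:~R / m.+1%:R) +i* ((tnth c.2 i)%:~R / m.+1%:R)).
apply: (@measurable_fun_cvg _ _ _ _ (fun m z => r (pt m (kap m z)))) => [m|z _].
  have mfl (g : 'cV[C]_n -> R) (c : int) : measurable_fun setT g ->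
      measurable [set z | Num.floor (m.+1%:R * g z) = c].
    move=> mg.
    rewrite (_ : [set z | _] = setT `&` (fun z => m.+1%:R * g z) @^-1` `[c%:~R, (c + 1)%:~R[).
      by apply: measurable_funM.
    rewrite setTI; apply/seteqP; split => z /=; rewrite in_itv/=.
      by move=> <-; apply: real_floor_itv; exact: num_real.
    by move=> /floor_def.
  have mkap c : measurable [set z | kap m z = c].
    have -> : [set z | kap m z = c] = \bigcap_(i in [set: 'I_n])
        ([set z | Num.floor (m.+1%:R * complex.Re (z i 0)) = tnth c.1 i] `&`
         [set z | Num.floor (m.+1%:R * complex.Im (z i 0)) = tnth c.2 i]).
      apply/seteqP; split => z /=.
        by move=> <- i _ /=; rewrite !tnth_mktuple.
      move=> H; case: c H => c1 c2 H; congr pair; apply: eq_from_tnth => i;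
        by rewrite tnth_mktuple; have [] := H i I.
    apply: fin_bigcap_measurable => // i _; apply: measurableI; apply: mfl.
      exact: measurable_Re_coord.
    exact: measurable_Im_coord.
  move=> _ Y mY; rewrite setTI.
  rewrite (_ : _ @^-1` Y = \bigcup_(c : K) ([set z | kap m z = c] `&` [set z | Y (r (pt m c))])).
    apply: countable_bigcupT_measurable; first exact: countableP.
    move=> c; have [Yc|nYc] := pselect (Y (r (pt m c))).
      rewrite (_ : [set z | Y _] = setT); first by rewrite setIT.
      by apply/seteqP; split.
    rewrite (_ : [set z | Y _] = set0); first by rewrite setI0.
    by apply/seteqP; split.
  apply/seteqP; split => [z Yz|z [c _ [/= <-]]] //.
  by exists (kap m z).
apply/cvgrPdist_lt => e e0; have [d d0 Hd] := cr z e e0.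
have : (fun m : nat => m.+1%:R^-1 : R) @ \oo --> (0 : R).
  exact: cvg_harmonic.
move=> /cvgrPdist_lt /(_ (d / 2)); rewrite divr_gt0// => /(_ isT).
apply: filterS => m /=; rewrite sub0r normrN ger0_norm// => md.
apply: Hd => i; rewrite !mxE/= !tnth_mktuple.
have fl (x : R) : `|x - (Num.floor (m.+1%:R * x))%:~R / m.+1%:R| <= m.+1%:R^-1.
  have m0 : 0 < m.+1%:R :> R by rewrite ltr0n.
  have /andP[] := real_floor_itv (num_real (m.+1%:R * x)).
  set c := Num.floor _; rewrite intrD => f1 f2.
  have -> : x - c%:~R / m.+1%:R = (m.+1%:R * x - c%:~R) / m.+1%:R by field; rewrite gt_eqF.
  by rewrite normrM normfV (ger0_norm (ltW m0)) ler_pdivrMr// mulVf ?gt_eqF// ger0_norm; lra.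
apply: le_lt_trans (normc_le_ReIm _) _.
move: md (fl (complex.Re (z i 0))) (fl (complex.Im (z i 0))).
case: (z i 0) => x y /=.
set X := `|x - _|; set Y := `|y - _|; set q := _^-1.
lra.
Qed.

Lemma continuous_measurable_ReIm u : (forall z, {for z, continuous u}) ->
  measurable_fun setT (fun z => complex.Re (u z)) /\
  measurable_fun setT (fun z => complex.Im (u z)).
Proof.
move=> cu; split; apply: normc_continuous_measurable => z e e0;
  have [d d0 Hd] := continuous_normcP (cu z) e0; exists d => // v /Hd;
  apply: le_lt_trans.
  by apply: le_trans (normr_le_normc_Re _); case: (u z) => ? ?; case: (u v).
by apply: le_trans (normr_le_normc_Im _); case: (u z) => ? ?; case: (u v).
Qed.

Lemma ler_dist_normc (a b : C) : `|normc a - normc b| <= normc (a - b).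
Proof.
have H (x y : C) : normc x <= normc (x - y) + normc y.
  by rewrite -{1}[x](subrK y) ler_normcD.
have := H a b; have := H b a; rewrite -[b - a]opprB normcN => ? ?.
by rewrite ler_norml; apply/andP; split; lra.
Qed.

(** The extreme value theorem on a cube of R^(2n), through the real and imaginary parts of the
    coordinates. *)
Lemma continuous_locally_bounded u : continuous u -> forall L : R,
  exists M : R, forall z, (forall i, normc (z i 0) <= L) -> normc (u z) <= M.
Proof.
(* Truncating the radius at 0 puts the origin in the cube, which must be nonempty for a maximum to
   exist. *)
move=> cu L0; pose L := Num.max L0 0.
have [Lge L0' ]: L0 <= L /\ 0 <= L by rewrite !le_max !lexx orbT.
suff [M HM] : exists M : R, forall z, (forall i, normc (z i 0) <= L) -> normc (u z) <= M.
  by exists M => z Hz; apply: HM => i; exact: le_trans Lge.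
pose F (x : 'rV[R]_(n + n)) : 'cV[C]_n :=
  \col_i (x 0 (lshift n i) +i* x 0 (rshift n i)).
have cF (x : 'rV[R]_(n + n)) : {for x, continuous (fun x => normc (u (F x)))}.
  apply/(@cvgrPdist_lt _ _ _ (nbhs x)) => e e0.
  have [d d0 Hd] := continuous_normcP (cu (F x)) e0.
  apply/nbhs_ballP; exists (d / 2) => [|y [_ xy]] /=; first by rewrite divr_gt0.
  have lt1 := Hd (F y); apply: le_lt_trans (lt1 _).
    exact: ler_dist_normc.
  move=> i; rewrite !mxE /=.
  have := xy 0 (lshift n i); have := xy 0 (rshift n i).
  rewrite /ball/= => h1 h2; apply: le_lt_trans (normc_le_ReIm (_ +i* _)) _ => /=.
  by rewrite (splitr d) ltrD.
have cA : compact [set x : 'rV[R]_(n + n) | forall i, `[- L, L]%classic (x ord0 i)].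
  apply: (@rV_compact _ _ (fun=> `[- L, L]%classic)) => i; exact: segment_compact.
have [] := EVT_max_rV _ cA (continuous_subspaceT cF).
  by exists 0 => i /=; rewrite mxE in_itv/= oppr_le0 L0'.
move=> c _ Hc; exists (normc (u (F c))) => z zL.
pose x := row_mx (\row_i complex.Re (z i 0)) (\row_i complex.Im (z i 0)).
have -> : z = F x.
  apply/matrixP => i j; rewrite ord1 [RHS]mxE /x row_mxEl row_mxEr !mxE.
  by case: (z i 0).
apply: Hc; rewrite inE => i /=; rewrite in_itv/= -ler_norml /x.
by case: (split_ordP i) => l ->; rewrite ?row_mxEl ?row_mxEr mxE;
  apply: le_trans (zL l); [exact: normr_le_normc_Re|exact: normr_le_normc_Im].
Qed.

Lemma measurable_tuple_box d (c : 'I_d -> R) (e : R) :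
  measurable [set t : d.-tuple RT | forall i, `|c i - tnth t i| < e].
Proof.
have -> : [set t : d.-tuple RT | forall i, `|c i - tnth t i| < e] =
    \bigcap_(i in [set: 'I_d]) [set t : d.-tuple RT | `](c i - e), (c i + e)[%classic (tnth t i)].
  apply/seteqP; split => t /= H i; rewrite ?in_itv/=.
    by move=> _; rewrite in_itv/=; have := H i; rewrite ltr_norml => /andP[? ?]; apply/andP; split; lra.
  have := H i I; rewrite /= in_itv/= => /andP[? ?].
  by rewrite ltr_norml; apply/andP; split; lra.
apply: fin_bigcap_measurable => // i _.
rewrite -[X in measurable X]setTI; exact: measurable_tnth.
Qed.

Lemma lebesgue_tuple_boxE d (c : 'I_d -> R) (e : R) : 0 < e ->
  lebesgue_tuple R d [set t | forall i, `|c i - tnth t i| < e]%R = ((2 * e) ^+ d)%:E.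
Proof.
move=> e0.
pose g i (x : RT) : R := \1_(`](c i - e), (c i + e)[%classic : set RT) x.
have gE (t : d.-tuple RT) :
    \1_[set t : d.-tuple RT | forall i, `|c i - tnth t i| < e] t = \prod_(i < d) g i (tnth t i).
  rewrite /g !indicE; case: (boolP (t \in _)) => [|].
    rewrite inE /= => H; rewrite big1// => i _; rewrite indicE mem_set//= in_itv/=.
    by have := H i; rewrite ltr_norml => /andP[? ?]; apply/andP; split; lra.
  rewrite notin_setE /= => /existsNP[i /negP]; rewrite -leNgt => H.
  rewrite (bigD1 i)//= indicE memNset ?mul0r//= in_itv/= => /andP[? ?].
  by move: H; rewrite leNgt ltr_norml => /negP; apply; apply/andP; split; lra.
have mg i : measurable_fun setT (g i) by exact: measurable_indic.
have mB := measurable_tuple_box c e.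
rewrite -[X in lebesgue_tuple R d X]setTI setIC -integral_indic//.
under eq_integral do rewrite gE.
rewrite ge0_integral_lebesgue_tuple_prod//.
rewrite (eq_bigr (fun=> (2 * e)%:E)) => [|i _].
  by rewrite prodEFin prodr_const card_ord.
rewrite integral_indic// setIT/= lebesgue_measure_itv/= lte_fin.
have -> : c i - e < c i + e by lra.
by rewrite -EFinB; congr EFin; ring.
Qed.

(** Neighbourhoods have positive mass. This gives equality of continuous functions from equality
    almost everywhere, and later excludes a vanishing volume of {N <= 1}. *)
Lemma lebesgue_complex_box z (e : R) : 0 < e ->
  exists2 B : set 'cV[C]_n, measurable B & (0 < mu B)%E /\
    forall v, B v -> forall i, normc (z i 0 - v i 0) < e.
Proof.
move=> e0; have e20 : 0 < e / 2 by rewrite divr_gt0.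
pose X (c : 'I_n -> R) : set (n.-tuple RT) := [set t | forall i, `|c i - tnth t i| < e / 2].
have mX c : measurable (X c) by exact: measurable_tuple_box.
pose x i := complex.Re (z i 0); pose y i := complex.Im (z i 0).
exists (@to_real_pair R n @^-1` (X x `*` X y)).
  rewrite -[X in measurable X]setTI; apply: measurable_to_real_pair => //.
  exact: measurableX.
split.
  rewrite /lebesgue_complex /pushforward -comp_preimage.
  rewrite (_ : _ \o _ = id); last by apply/funext => p /=; rewrite of_real_pairK.
  rewrite preimage_id product_measure1E//.
  have X0 c : (0 < lebesgue_tuple R n (X c))%E.
    by rewrite lebesgue_tuple_boxE// lte_fin exprn_gt0// mulr_gt0.
  by apply: mule_gt0; exact: X0.
move=> v [/= vx vy] i; have := vx i; have := vy i.
rewrite !tnth_mktuple /x /y; case: (z i 0) => a b; case: (v i 0) => a' b' /= h1 h2.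
apply: le_lt_trans (normc_le_ReIm (_ +i* _)) _ => /=.
by rewrite (splitr e) ltrD.
Qed.

(** Near a point where [u] and [v] differ they differ on a whole box, which would lie in the null
    set. This makes the Fock projection a single function. *)
Lemma continuous_ae_eq u v : continuous u -> continuous v ->
  {ae mu, forall z, u z = v z} -> u = v.
Proof.
move=> cu cv [N [mN N0 uvN]]; apply/funext => z; apply: contrapT => uvz.
have e0 : 0 < normc (u z - v z) / 2.
  by rewrite divr_gt0// normc_gt0 subr_eq0; apply/eqP.
have [d1 d10 H1] := continuous_normcP (cu z) e0.
have [d2 d20 H2] := continuous_normcP (cv z) e0.
have d0 : 0 < Num.min d1 d2 by rewrite lt_min d10.
have [B mB [B0 HB]] := lebesgue_complex_box z d0.
have BN : B `<=` N.
  move=> w Bw; apply: uvN => /= uvw.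
  have /H1 h1 : forall i, normc (z i 0 - w i 0) < d1.
    by move=> i; have := HB w Bw i; rewrite lt_min => /andP[].
  have /H2 h2 : forall i, normc (z i 0 - w i 0) < d2.
    by move=> i; have := HB w Bw i; rewrite lt_min => /andP[].
  have : normc (u z - v z) <= normc (u z - u w) + normc (v z - v w).
    rewrite -(normcN (v z - v w)) (_ : u z - v z = (u z - u w) + - (v z - v w)) ?ler_normcD//.
    by rewrite uvw; ring.
  by move=> /le_lt_trans /(_ (ltrD h1 h2)); rewrite -splitr ltxx.
have : (mu B <= mu N)%E by apply: le_measure; rewrite ?inE.
by rewrite N0 leNgt B0.
Qed.

Lemma measurable_coord0 i : measurable [set z : 'cV[C]_n | z i 0 = 0].
Proof.
have -> : [set z : 'cV[C]_n | z i 0 = 0] =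
   (fun z : 'cV[C]_n => complex.Re (z i 0)) @^-1` [set 0] `&`
   (fun z : 'cV[C]_n => complex.Im (z i 0)) @^-1` [set 0].
  by apply/seteqP; split => z /=; case: (z i 0) => a b; [case=> -> ->|case=> /= -> ->].
apply: measurableI; rewrite -[X in measurable X]setTI.
  exact: measurable_Re_coord.
exact: measurable_Im_coord.
Qed.

(** The set lies in the product of a null hyperplane of real parts with all imaginary parts, and 0
    times an infinite measure is 0. *)
Lemma lebesgue_complex_coord0 i : mu [set z : 'cV[C]_n | z i 0 = 0] = 0%E.
Proof.
pose X : set (n.-tuple RT) := [set t | tnth t i = 0].
have mX : measurable X.
  have := @measurable_tnth _ RT n i measurableT [set 0]; rewrite setTI; apply; exact: measurable_set1.
have X0 : lebesgue_tuple R n X = 0%E.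
  pose g j (x : RT) : R := if j == i then \1_([set 0] : set RT) x else 1.
  have gE (t : n.-tuple RT) : \1_X t = \prod_(j < n) g j (tnth t j).
    rewrite (bigD1 i)//= big1 ?mulr1 /g ?eqxx => [|j /negbTE ->//].
    by rewrite !indicE; congr (_%:R); apply/idP/idP; rewrite !inE.
  rewrite -[X in lebesgue_tuple R n X]setTI setIC -integral_indic//.
  under eq_integral do rewrite gE.
  rewrite ge0_integral_lebesgue_tuple_prod//; last 2 first.
  - by move=> j; rewrite /g; case: (j == i) => //; exact: measurable_indic.
  - by move=> j x; rewrite /g; case: (j == i) => //; rewrite indicE.
  rewrite (bigD1 i)//= /g eqxx integral_indic// setIT/= lebesgue_measure_set1 mul0e//.
have mA := measurable_coord0 i.
apply/eqP; rewrite eq_le measure_ge0 andbT.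
apply: (@le_trans _ _ ((lebesgue_tuple R n \x lebesgue_tuple R n)%E (X `*` setT))).
  apply: (@le_measure _ _ _ (lebesgue_tuple R n \x lebesgue_tuple R n)%E
    (@of_real_pair R n @^-1` [set z | z i 0 = 0])); rewrite ?inE.
  - rewrite -[X in measurable X]setTI; exact: measurable_of_real_pair.
  - exact: measurableX.
  - by move=> p /=; rewrite /X mxE => -[].
by rewrite product_measure1E// [X in (X * _)%E](_ : _ = 0%E) ?mul0e.
Qed.

End complex_space_theory.

(** * Polar coordinates through boxes *)

Section density_measure.
Context d (T : measurableType d) (R : realType) (mu : {measure set T -> \bar R}).
Variable F : T -> R.
Hypotheses (mF : measurable_fun setT F) (F0 : forall x, 0 <= F x).
Local Open Scope ereal_scope.

Definition density (A : set T) : \bar R := \int[mu]_(x in A) (F x)%:E.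

Let density0 : density set0 = 0.
Proof. exact: integral_set0. Qed.

Let density_ge0 A : 0 <= density A.
Proof. by apply: integral_ge0 => x _; rewrite lee_fin. Qed.

Let density_semi_sigma_additive : semi_sigma_additive density.
Proof.
move=> /= G mG tG mUG; rewrite /density ge0_integral_bigcup//=.
- apply/cvg_ex => /=.
  exists (\sum_(i <oo) \int[mu]_(x in G i) (F x)%:E); apply: is_cvg_nneseries => n _ _.
  exact: density_ge0.
- by apply/measurable_EFinP; exact: measurable_funTS.
- by move=> x _; rewrite lee_fin.
Qed.

HB.instance Definition _ := isMeasure.Build _ _ _ density
  density0 density_ge0 density_semi_sigma_additive.

Definition density_measure : {measure set T -> \bar R} := density.

Import HBNNSimple.

(** Indicators first, then simple functions, then monotone limits. *)
Lemma ge0_integral_density (G : T -> \bar R) :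
  measurable_fun setT G -> (forall x, 0 <= G x) ->
  \int[density_measure]_x G x = \int[mu]_x (G x * (F x)%:E).
Proof.
move=> mG G0; pose h := nnsfun_approx measurableT mG.
have -> : \int[density_measure]_x G x = lim (\int[density_measure]_x (EFin \o h n) x @[n --> \oo]).
  have fE x : G x = lim ((EFin \o h n) x @[n --> \oo]).
    by apply/esym/cvg_lim => //; exact: cvg_nnsfun_approx.
  under eq_integral do rewrite fE.
  apply: monotone_convergence => //.
  - by move=> n; exact/measurable_EFinP/measurable_funP.
  - by move=> n x _ //=; rewrite lee_fin.
  - by move=> x _ a b ab; rewrite lee_fin; exact/lefP/nd_nnsfun_approx.
have -> : \int[mu]_x (G x * (F x)%:E) =
    lim (\int[mu]_x ((EFin \o h n) x * (F x)%:E) @[n --> \oo]).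
  have fg x : G x * (F x)%:E = lim ((EFin \o h n) x * (F x)%:E @[n --> \oo]).
    apply/esym/cvg_lim => //; apply: cvgeZr => //; exact: cvg_nnsfun_approx.
  under eq_integral do rewrite fg.
  apply: monotone_convergence => [//| | |].
  - move=> n; apply/emeasurable_funM; first exact/measurable_EFinP.
    exact/measurable_EFinP.
  - by move=> n x _ /=; rewrite mule_ge0 ?lee_fin.
  - by move=> x _ a b ab/=; rewrite lee_wpmul2r ?lee_fin//; exact/lefP/nd_nnsfun_approx.
suff suf n : \int[mu]_x ((EFin \o h n) x * (F x)%:E) = \int[density_measure]_x (EFin \o h n) x.
  by under [in RHS]eq_fun do rewrite suf.
transitivity (\int[density_measure]_x
   (\sum_(y \in range (h n)) (y * \1_(h n @^-1` [set y]) x)%:E)); last first.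
  by apply: eq_integral => t tE; rewrite /= fimfunE -fsumEFin.
have indich r : measurable_fun setT (fun x => (r * \1_(h n @^-1` [set r]) x)%:E).
  by apply/measurable_EFinP; exact: measurable_funM.
rewrite ge0_integral_fsum//; last by move=> m y _; exact: nnfun_muleindic_ge0.
transitivity (\int[mu]_x (\sum_(y \in range (h n))
    (y * \1_(h n @^-1` [set y]) x)%:E * (F x)%:E)).
  under [RHS]eq_integral => x xE.
    rewrite -ge0_mule_fsuml => [|y]; last exact: nnfun_muleindic_ge0.
    rewrite fsumEFin // -(fimfunE _ x); over.
  by [].
rewrite ge0_integral_fsum//; last 2 first.
  - by move=> y; apply: emeasurable_funM => //; exact/measurable_EFinP.
  - by move=> m y _; apply: mule_ge0; [exact: nnfun_muleindic_ge0|rewrite lee_fin].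
apply: eq_fsbigr => r rhn.
under [RHS]eq_integral do rewrite EFinM.
rewrite integralZl_indic_nnsfun => //.
under eq_integral do rewrite EFinM -muleA.
rewrite ge0_integralZl//.
- congr (_ * _); rewrite integral_indic// setIT /= /density.
  rewrite [RHS]integral_mkcond; apply: eq_integral => x _.
  by rewrite epatch_indic muleC.
- by apply: emeasurable_funM; exact/measurable_EFinP.
- by move=> t _; rewrite mule_ge0 ?lee_fin.
- by move: rhn; rewrite inE => -[t _ <-]; rewrite lee_fin.
Qed.

End density_measure.

Section tuple_box.
Context {R : realType} {k : nat}.
Local Notation RT := (measurableTypeR R).
Local Open Scope ereal_scope.

(** Unbounded below, so that intersections are coordinatewise minima; pulled back by norms these
    boxes nevertheless become bounded sets. *)
Definition tuple_box (l : 'I_k -> R) : set (k.-tuple RT) :=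
  [set t | forall j, (tnth t j <= l j)%R].

Lemma measurable_box l : measurable (tuple_box l).
Proof.
have -> : tuple_box l = \bigcap_(i in [set: 'I_k])
    [set t : k.-tuple RT | `]-oo, l i]%classic (tnth t i)].
  apply/seteqP; split => t /= H i; first by move=> _ /=; rewrite in_itv/=; exact: H.
  by have := H i I; rewrite /= in_itv.
apply: fin_bigcap_measurable => // i _.
by rewrite -[X in measurable X]setTI; apply: measurable_tnth.
Qed.

Lemma tuple_boxI l m : tuple_box l `&` tuple_box m =
  tuple_box (fun j => Num.min (l j) (m j)).
Proof.
apply/seteqP; split => t /=.
  by move=> [tl tm] j; rewrite le_min tl tm.
by move=> H; split=> j; have := H j; rewrite le_min => /andP[].
Qed.

Let G : set (set (k.-tuple RT)) := range tuple_box.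

Lemma bigcup_tuple_box : \bigcup_i tuple_box (fun=> i%:R) = setT.
Proof.
apply/seteqP; split => // t _; exists (Num.truncn (\sum_(j < k) `|tnth t j|)).+1 => // j.
apply: le_trans (ltW (truncnS_gt _)).
by rewrite (bigD1 j)//= (le_trans (ler_norm _))// lerDl sumr_ge0.
Qed.

Lemma measurable_tuple_boxE : measurable = <<s range tuple_box >>.
Proof.
apply/seteqP; split; last first.
  apply: smallest_sub; first exact: sigma_algebra_measurable.
  by move=> _ [l _ <-]; exact: measurable_box.
have mid : measurable_fun [set: g_sigma_algebraType G] (id : g_sigma_algebraType G -> k.-tuple RT).
  apply/measurable_fun_tnthP => i.
  apply: (measurability _ (RGenInftyO.measurableE R)).
  move=> _ [_ [x ->] <-]; rewrite setTI.
  (* An open half-space is a countable union of boxes: stay 1/(m+1) below the bound in coordinate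
     [i] and below [m] in the others. A point is caught once [m] exceeds the inverse of its distance
     to the bound plus the sum of its absolute coordinates. *)
  have -> : (@tnth k RT ^~ i \o id) @^-1` `]-oo, x[%classic =
     \bigcup_m tuple_box (fun j => if j == i then (x - m.+1%:R^-1)%R else m%:R).
    apply/seteqP; split => t /=; rewrite in_itv/=.
      move=> tx; pose S := (\sum_(j < k) `|tnth t j|)%R.
      have S0 : (0 <= S)%R by exact: sumr_ge0.
      have xt0 : (0 < x - tnth t i)%R by rewrite subr_gt0.
      pose m := (Num.truncn ((x - tnth t i)^-1 + S)).+1.
      have mS : ((x - tnth t i)^-1 + S < m%:R)%R by exact: truncnS_gt.
      have mi : ((x - tnth t i)^-1 < m.+1%:R)%R.
        by apply: le_lt_trans (lt_trans mS _); rewrite ?lerDl// ltr_nat.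
      exists m => // j; case: eqP => [->|_].
        rewrite lerBrDr addrC -lerBrDr -[leRHS]invrK lef_pV2 ?posrE ?invr_gt0//.
        exact: ltW.
      apply: le_trans (ltW mS); apply: (@le_trans _ _ S).
        by rewrite /S (bigD1 j)//= (le_trans (ler_norm _))// lerDl sumr_ge0.
      by rewrite lerDr invr_ge0 ltW.
    move=> [m _] /(_ i); rewrite eqxx => /le_lt_trans; apply.
    by rewrite ltrBlDr ltrDl invr_gt0.
  apply: bigcupT_measurable => m; apply: sub_sigma_algebra.
  by eexists.
by move=> A mA; have := mid measurableT A mA; rewrite setTI.
Qed.

(** The pi-lambda theorem: boxes are stable under intersection, generate the sigma-algebra, and
    exhaust the space with finite mass. *)
Lemma tuple_measure_unique (m1 m2 : {measure set (k.-tuple RT) -> \bar R}) :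
  (forall l, m1 (tuple_box l) = m2 (tuple_box l)) ->
  (forall l, m1 (tuple_box l) < +oo) ->
  forall A, measurable A -> m1 A = m2 A.
Proof.
move=> m12 m1oo; apply: (@measure_unique _ _ _ G (fun i => tuple_box (fun=> i%:R))) => //.
- exact: measurable_tuple_boxE.
- by move=> _ _ [l _ <-] [m _ <-]; rewrite tuple_boxI; eexists.
- by move=> i; eexists.
- exact: bigcup_tuple_box.
- by move=> _ [l _ <-].
Qed.

End tuple_box.

Section box_integrals.
Context {R : realType} {k : nat}.
Local Notation RT := (measurableTypeR R).
Local Open Scope ereal_scope.

(** The integrand is the derivative of [x ^+ e]. The maximum covers [l <= 0], where [0 < e] makes
    both sides 0. *)
Lemma integral_monomial (e : nat) (l : R) : (0 < e)%N ->
  \int[lebesgue_measure]_x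
    (e%:R * x ^+ e.-1 * \1_(`]0%R, l]%classic : set RT) x)%:E =
  ((Num.max l 0%R) ^+ e)%:E.
Proof.
move=> e0.
transitivity (\int[lebesgue_measure]_(x in `]0%R, l]) (e%:R * x ^+ e.-1)%:E).
  rewrite [RHS]integral_mkcond; apply: eq_integral => x _.
  by rewrite epatch_indic EFinM.
have [l0|l0] := leP l 0%R.
  rewrite expr0n gtn_eqF// set_itv_ge ?integral_set0//.
  by rewrite bnd_simp -leNgt.
have ce : continuous (fun x : R => e%:R * x ^+ e.-1)%R.
  by move=> x; apply: cvgMr; exact: exprn_continuous.
rewrite integral_itv_obnd_cbnd; last first.
  apply/measurable_EFinP; apply: measurable_funTS.
  by apply: measurable_funM => //; exact: measurable_funX.
rewrite (@continuous_FTC2 _ _ (fun x => x ^+ e)%R)//.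
- by rewrite expr0n gtn_eqF// sube0.
- exact: continuous_subspaceT.
- split.
  + by move=> x _; exact: exprn_derivable.
  + by apply: cvg_at_right_filter; exact: exprn_continuous.
  + by apply: cvg_at_left_filter; exact: exprn_continuous.
- by move=> x _; rewrite derive1E exp_derive scaler1.
Qed.

Section polar.
Context d (T : measurableType d) (mu : {measure set T -> \bar R}).
Variables (N : T -> k.-tuple RT) (deg : 'I_k -> nat) (K : R).
Hypotheses (mN : measurable_fun setT N) (deg0 : forall j, (0 < deg j)%N).
Hypothesis K0 : (0 <= K)%R.
Hypothesis muN : forall l : 'I_k -> R,
  mu (N @^-1` tuple_box l) = (K * \prod_(j < k) (Num.max (l j) 0) ^+ deg j)%:E.

(** The mixed derivative in [l] of the product of the [l j ^+ deg j], that is, the density having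
    these products as box masses. *)
Definition polar_density (r : k.-tuple RT) : R :=
  (\prod_(j < k) ((deg j)%:R * tnth r j ^+ (deg j).-1)) *
  \1_(@positive_orthant R k) r.

Lemma measurable_positive_orthant : measurable (@positive_orthant R k).
Proof.
have -> : @positive_orthant R k = \bigcap_(i in [set: 'I_k])
    [set t : k.-tuple RT | `]0%R, +oo[%classic (tnth t i)].
  apply/seteqP; split => t /= H i; first by move=> _ /=; rewrite in_itv/= andbT; exact: H.
  by have := H i I; rewrite /= in_itv/= andbT.
apply: fin_bigcap_measurable => // i _.
by rewrite -[X in measurable X]setTI; apply: measurable_tnth.
Qed.

Lemma measurable_polar_density : measurable_fun setT polar_density.
Proof.
apply: measurable_funM; last exact: (measurable_indic measurable_positive_orthant).
apply: measurable_prod => j _; apply: measurable_funM => //.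
by apply: measurable_funX; exact: measurable_tnth.
Qed.

Lemma polar_density_ge0 r : (0 <= polar_density r)%R.
Proof.
rewrite /polar_density indicE; have [|_] := boolP (r \in _); last by rewrite mulr0.
rewrite inE => r0; rewrite mulr1; apply: prodr_ge0 => j _.
by rewrite mulr_ge0// exprn_ge0// ltW// r0.
Qed.

(** Both sides integrate [G] against a measure on R^k, and the two measures agree on boxes: one by
    [muN], the other by Tonelli and the integral of a monomial. *)
Lemma polar_integral (G : k.-tuple RT -> \bar R) :
  measurable_fun setT G -> (forall r, 0 <= G r) ->
  \int[mu]_x G (N x) =
  \int[lebesgue_tuple R k]_r (G r * (K * polar_density r)%:E).
Proof.
move=> mG G0.
have mF : measurable_fun setT (fun r => K * polar_density r)%R.
  by apply: measurable_funM => //; exact: measurable_polar_density.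
have F0 r : (0 <= K * polar_density r)%R by rewrite mulr_ge0 ?polar_density_ge0.
rewrite -(ge0_integral_density (lebesgue_tuple R k) mF F0)//.
rewrite -[LHS](@ge0_integral_pushforward _ _ _ _ _ _ mN mu setT)//.
apply: eq_measure_integral => A mA _.
apply: (@tuple_measure_unique R k (pushforward mu N) (density_measure (lebesgue_tuple R k) mF F0)) => // l.
  rewrite [LHS]muN -[RHS]/(\int[lebesgue_tuple R k]_(r in tuple_box l) (K * polar_density r)%:E).
  rewrite integral_mkcond.
  pose g j (x : RT) : R := ((deg j)%:R * x ^+ (deg j).-1 * \1_(`]0%R, l j]%classic : set RT) x)%R.
  have mg j : measurable_fun setT (g j).
    apply: measurable_funM; last exact: measurable_indic.
    by apply: measurable_funM => //; exact: measurable_funX.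
  have g0 j x : (0 <= g j x)%R.
    rewrite /g indicE; have [|_] := boolP (x \in _); last by rewrite mulr0.
    rewrite inE/= in_itv/= => /andP[x0 _].
    by rewrite mulr1 mulr_ge0// exprn_ge0// ltW.
  transitivity (K%:E * \int[lebesgue_tuple R k]_r (\prod_(j < k) g j (tnth r j))%:E).
    rewrite ge0_integral_lebesgue_tuple_prod// EFinM -prodEFin; congr (_ * _).
    by apply: eq_bigr => j _; rewrite integral_monomial.
  rewrite -ge0_integralZl_EFin//; last 2 first.
  - by move=> r _; rewrite lee_fin prodr_ge0.
  - apply/measurable_EFinP; apply: measurable_prod => j _.
    by apply: measurableT_comp => //; exact: measurable_tnth.
  apply: eq_integral => r _; rewrite epatch_indic /= -!EFinM; congr EFin.
  rewrite -mulrA; congr (K * _)%R.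
  rewrite /polar_density big_split/= -mulrA; congr (_ * _)%R.
  have -> : (\1_(@positive_orthant R k) r * \1_(tuple_box l) r)%R =
      (\1_(@positive_orthant R k `&` tuple_box l) r : R) by rewrite indicI.
  rewrite [RHS]indicE; have [|] := boolP (r \in _).
    rewrite inE => -[r0 rl]; rewrite big1// => j _.
    by rewrite indicE mem_set//= in_itv/= r0 rl.
  rewrite notin_setE => /not_andP H.
  have [j Hj] : exists j, ~ (0 < tnth r j <= l j)%R.
    case: H => /existsNP[j Hj]; exists j => /andP[]; by [move/Hj|move=> _ /Hj].
  by rewrite (bigD1 j)//= indicE memNset ?mul0r//= in_itv.
by rewrite [X in X < _]muN ltry.
Qed.

End polar.

(** Taken as densities, the positive and negative parts of [Y] have images under [N] that agree on
    boxes, hence everywhere. This settles nonnegative functions of [N]; the signed [G] is split into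
    its two parts. *)
Lemma integral_box_eq0 d (T : measurableType d) (mu : {measure set T -> \bar R})
    (N : T -> k.-tuple RT) (Y : T -> R) (G : k.-tuple RT -> R) :
  measurable_fun setT N -> measurable_fun setT Y -> measurable_fun setT G ->
  (forall l, mu.-integrable (N @^-1` tuple_box l) (EFin \o Y)) ->
  (forall l, \int[mu]_(x in N @^-1` tuple_box l) (Y x)%:E = 0) ->
  mu.-integrable setT (fun x => (G (N x) * Y x)%:E) ->
  \int[mu]_x (G (N x) * Y x)%:E = 0.
Proof.
move=> mN mY mG iY Y0 iGY.
pose p (y : R) := Num.max y 0%R.
have p0 y : (0 <= p y)%R by rewrite le_max lexx orbT.
have pE y : (y = p y - p (- y))%R.
  by rewrite /p; case: (leP y 0%R) => y0; case: (leP (- y) 0)%R => y1; lra.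
have pabs y : (p y <= `|y|)%R by rewrite ge_max ler_norm normr_ge0.
have pN y : (p (- y) <= `|y|)%R by rewrite -normrN.
have mp d' (U : measurableType d') (F : U -> R) : measurable_fun setT F ->
    measurable_fun setT (fun x => p (F x)).
  by move=> mF; apply: measurable_maxr.
have mYN : measurable_fun setT (fun x => - Y x)%R by exact: measurableT_comp.
have mGN : measurable_fun setT (fun x => - G x)%R by exact: measurableT_comp.
have mYp := mp _ _ _ mY; have mYn := mp _ _ _ mYN.
have mGp := mp _ _ _ mG; have mGn := mp _ _ _ mGN.
have mNbox l : measurable (N @^-1` tuple_box l).
  by rewrite -[X in measurable X]setTI; apply: mN => //; exact: measurable_box.
have key (H : k.-tuple RT -> R) : measurable_fun setT H -> (forall r, 0 <= H r)%R ->
    \int[mu]_x (H (N x) * p (Y x))%:E = \int[mu]_x (H (N x) * p (- Y x))%:E.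
  move=> mH H0.
  have mHN : measurable_fun setT (fun x => (H (N x))%:E).
    by apply/measurable_EFinP; apply: measurableT_comp mN.
  have HN0 x : 0 <= (H (N x))%:E by rewrite lee_fin.
  under eq_integral do rewrite EFinM.
  under [RHS]eq_integral do rewrite EFinM.
  rewrite -(ge0_integral_density mu mYp (fun=> p0 _) mHN HN0).
  rewrite -(ge0_integral_density mu mYn (fun=> p0 _) mHN HN0).
  have iYp l : mu.-integrable (N @^-1` tuple_box l) (EFin \o (fun x => p (Y x))).
    apply: le_integrable (iY l) => //.
      by apply/measurable_EFinP; exact: measurable_funTS.
    by move=> x _; rewrite lee_fin ger0_norm.
  have iYn l : mu.-integrable (N @^-1` tuple_box l) (EFin \o (fun x => p (- Y x)%R)).
    apply: le_integrable (iY l) => //.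
      by apply/measurable_EFinP; exact: measurable_funTS.
    by move=> x _; rewrite lee_fin ger0_norm.
  have EH (m : {measure set T -> \bar R}) : \int[m]_x (H (N x))%:E = \int[pushforward m N]_r (H r)%:E.
    rewrite (@ge0_integral_pushforward _ _ _ _ _ _ mN m setT)//.
      exact/measurable_EFinP.
    by move=> r _; rewrite lee_fin.
  rewrite !EH; apply: eq_measure_integral => A mA _.
  apply: (@tuple_measure_unique R k (pushforward (density_measure mu mYp (fun=> p0 _)) N) (pushforward (density_measure mu mYn (fun=> p0 _)) N)) => // l.
    rewrite -[LHS]/(\int[mu]_(x in N @^-1` tuple_box l) (p (Y x))%:E).
    rewrite -[RHS]/(\int[mu]_(x in N @^-1` tuple_box l) (p (- Y x))%:E).
    have YE : \int[mu]_(x in N @^-1` tuple_box l) (Y x)%:E =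
        \int[mu]_(x in N @^-1` tuple_box l) ((p (Y x))%:E - (p (- Y x))%:E).
      by apply: eq_integral => x _; rewrite -EFinB -pE.
    move: (Y0 l); rewrite YE integralB// => /eqP; rewrite sube_eq ?add0e//; first by move=> /eqP.
    by apply: integrable_fin_num; [exact: mNbox|exact: iYp].
  rewrite -[X in X < _]/(\int[mu]_(x in N @^-1` tuple_box l) (p (Y x))%:E).
  by rewrite -ge0_fin_numE ?integrable_fin_num// integral_ge0// => x _; rewrite lee_fin.
have WE x : (G (N x) * Y x)%:E =
    (p (G (N x)) * p (Y x) + p (- G (N x)) * p (- Y x))%:E -
    (p (G (N x)) * p (- Y x) + p (- G (N x)) * p (Y x))%:E.
  rewrite -EFinB; congr EFin; rewrite {1}(pE (G (N x))) {1}(pE (Y x)); ring.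
(* One of [p g] and [p (- g)] is 0, so each sum reduces to one product below [|g * y|]. Both groups
   are therefore integrable and their integrals may be subtracted. *)
have bound (g y : R) : (p g * p y + p (- g) * p (- y) <= `|g * y|)%R /\
    (p g * p (- y) + p (- g) * p y <= `|g * y|)%R.
  have [g0|g0] := leP g 0%R.
    have -> : (p g = 0)%R by apply/max_idPr.
    rewrite !mul0r !add0r normrM.
    by split; apply: ler_pM.
  have -> : (p (- g) = 0)%R by apply/max_idPr; rewrite oppr_le0 ltW.
  rewrite !mul0r !addr0 normrM.
  by split; apply: ler_pM.
have mGpN : measurable_fun setT (fun x => p (G (N x))) by exact: (measurableT_comp mGp mN).
have mGnN : measurable_fun setT (fun x => p (- G (N x))%R) by exact: (measurableT_comp mGn mN).
have m1 : measurable_fun setT (fun x => p (G (N x)) * p (Y x) + p (- G (N x)) * p (- Y x))%R.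
  by apply: measurable_funD; apply: measurable_funM.
have m2 : measurable_fun setT (fun x => p (G (N x)) * p (- Y x) + p (- G (N x)) * p (Y x))%R.
  by apply: measurable_funD; apply: measurable_funM.
have i1 : mu.-integrable setT (fun x => (p (G (N x)) * p (Y x) + p (- G (N x)) * p (- Y x))%:E).
  apply: le_integrable iGY => //; first exact/measurable_EFinP.
  move=> x _; rewrite lee_fin ger0_norm ?addr_ge0 ?mulr_ge0//.
  exact: (bound _ _).1.
have i2 : mu.-integrable setT (fun x => (p (G (N x)) * p (- Y x) + p (- G (N x)) * p (Y x))%:E).
  apply: le_integrable iGY => //; first exact/measurable_EFinP.
  move=> x _; rewrite lee_fin ger0_norm ?addr_ge0 ?mulr_ge0//.
  exact: (bound _ _).2.
under eq_integral do rewrite WE.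
rewrite integralB//.
have -> : \int[mu]_x (p (G (N x)) * p (Y x) + p (- G (N x)) * p (- Y x))%:E =
   \int[mu]_x (p (G (N x)) * p (- Y x) + p (- G (N x)) * p (Y x))%:E.
  under eq_integral do rewrite EFinD.
  under [RHS]eq_integral do rewrite EFinD.
  rewrite !ge0_integralD//; try by move=> x _; rewrite lee_fin mulr_ge0.
  by rewrite (key _ mGp)// (key _ mGn).
  1-4: by apply/measurable_EFinP; exact: measurable_funM.
by rewrite subee// integrable_fin_num.
Qed.

End box_integrals.

(** * The image of Lebesgue measure under a map of norms *)

Section norm_map.
Context {R : realType} {n k : nat}.
Local Notation RT := (measurableTypeR R).
Local Notation C := R[i].
Local Notation normc := ComplexField.Normc.normc.
Local Notation mu := (@lebesgue_complex R n).
(** Abstract because it has two instances: the block norms, with degrees [2 * b j], and the single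
    Euclidean norm, with degree [2 * n]. *)
Variables (blk : 'I_n -> 'I_k) (N : 'cV[C]_n -> k.-tuple RT) (deg : 'I_k -> nat).
Hypotheses (mN : measurable_fun setT N).
Hypothesis NZ : forall (c : 'I_k -> C) z j,
  tnth (N (dilate (c \o blk) z)) j = normc (c j) * tnth (N z) j.
Hypothesis NG : forall (z : 'cV[C]_n) i, normc (z i 0) <= tnth (N z) (blk i).
Hypothesis blk_surj : forall j, exists i, blk i = j.
Hypothesis degE : forall F : 'I_k -> R,
  \prod_(i < n) F (blk i) ^+ 2 = \prod_(j < k) F j ^+ deg j.

Let box1 : 'I_k -> R := fun=> 1.

Lemma deg_gt0 j : (0 < deg j)%N.
Proof.
rewrite lt0n; apply/negP => /eqP dj; have [i ij] := blk_surj j.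
(* Test function equal to 0 at [j] and 1 elsewhere: some coordinate lies over [j], so the left side
   is 0, whereas [deg j = 0] would make the right side 1. *)
have := degE (fun j' => (j' != j)%:R).
rewrite (bigD1 i)//= ij eqxx expr0n mul0r (bigD1 j)//= dj expr0 big1 => [|j' j'j].
  by rewrite mulr1 => /eqP; rewrite eq_sym oner_eq0.
by rewrite j'j expr1n.
Qed.

Lemma norm_map_ge0 z j : 0 <= tnth (N z) j.
Proof. by have [i <-] := blk_surj j; rewrite (le_trans _ (NG z i))// normc_ge0. Qed.

Lemma measurable_norm_map_box l : measurable (N @^-1` tuple_box l).
Proof. by rewrite -[X in measurable X]setTI; apply: mN => //; exact: measurable_box. Qed.

(** Each norm dominates some coordinate, and coordinate hyperplanes are null. *)
Lemma norm_map_gt0 : {ae mu, forall z, forall j, 0 < tnth (N z) j}.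
Proof.
have : {ae mu, forall z : 'cV[C]_n, forall i, z i 0 != 0}.
  apply: filter_forall => i; exists [set z : 'cV[C]_n | z i 0 = 0]; split => //.
  - exact: measurable_coord0.
  - exact: lebesgue_complex_coord0.
  - by move=> z /= /negP; rewrite negbK => /eqP.
apply: filterS => z z0 j; have [i <-] := blk_surj j.
by rewrite (lt_le_trans _ (NG z i))// normc_gt0.
Qed.

Lemma norm_map_box_fin : (mu (N @^-1` tuple_box box1) < +oo)%E.
Proof.
pose X : set (n.-tuple RT) := [set t | forall i, `|0 - tnth t i| < 2].
have X2 : (lebesgue_tuple R n X < +oo)%E by rewrite lebesgue_tuple_boxE// ltry.
apply: (@le_lt_trans _ _ ((lebesgue_tuple R n \x lebesgue_tuple R n)%E (X `*` X))).
  apply: (@le_measure _ _ _ (lebesgue_tuple R n \x lebesgue_tuple R n)%E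
    (@of_real_pair R n @^-1` (N @^-1` tuple_box box1))); rewrite ?inE.
  - rewrite -[X in measurable X]setTI; apply: measurable_of_real_pair => //.
    exact: measurable_norm_map_box.
  - by apply: measurableX; exact: measurable_tuple_box.
  - move=> p /= H; split => i; have := NG (of_real_pair p) i; rewrite mxE /=;
      move=> /le_trans/(_ (H _)) Hi; rewrite sub0r normrN.
      have := normr_le_normc_Re (tnth p.1 i +i* tnth p.2 i) => /= /le_trans/(_ Hi).
      by move=> /le_lt_trans; apply; rewrite ltr1n.
    have := normr_le_normc_Im (tnth p.1 i +i* tnth p.2 i) => /= /le_trans/(_ Hi).
    by move=> /le_lt_trans; apply; rewrite ltr1n.
rewrite product_measure1E//; last 2 first.
- exact: measurable_tuple_box.
- exact: measurable_tuple_box.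
by rewrite lte_mul_pinfty// ge0_fin_numE.
Qed.

(** The volume of {N <= 1}. It is never computed: that it is positive and finite suffices, since it
    cancels in every quotient. *)
Definition kappa : R := fine (mu (N @^-1` tuple_box box1)).

Lemma kappaE : mu (N @^-1` tuple_box box1) = kappa%:E.
Proof. by rewrite fineK// ge0_fin_numE// norm_map_box_fin. Qed.

(** For positive [l] the dilation with factor [l j] on the coordinates over [j] carries the unit box
    to this one. If some [l j <= 0] the preimage is null, because norms are positive almost
    everywhere. *)
Lemma norm_map_box l :
  mu (N @^-1` tuple_box l) = (kappa * \prod_(j < k) (Num.max (l j) 0) ^+ deg j)%:E.
Proof.
have [lp|] := pselect (forall j, 0 < l j).
  pose c i : C := (l (blk i))%:C.
  have c0 i : c i != 0 by rewrite eq_complex/= negb_and gt_eqF ?lp.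
  have normcl j : normc (l j)%:C = l j.
    by rewrite /= expr0n addr0 sqrtr_sqr gtr0_norm.
  have E : (\prod_(i < n) normc (c i) ^+ 2 = \prod_(j < k) (Num.max (l j) 0) ^+ deg j).
    rewrite -degE; apply: eq_bigr => i _; rewrite normcl.
    by rewrite (max_idPl (ltW (lp _))).
  have mB := measurable_norm_map_box.
  have muE m : mu (N @^-1` tuple_box m) = (\int[mu]_z (\1_(N @^-1` tuple_box m) z)%:E)%E.
    by rewrite integral_indic// setIT.
  rewrite muE -(@ge0_integral_dilate R n c _ c0); last 2 first.
  - by apply/measurable_EFinP; exact: measurable_indic.
  - by move=> z; rewrite lee_fin indicE.
  rewrite E mulrC EFinM -kappaE; congr (_ * _)%E.
  rewrite muE; apply: eq_integral => z _; congr EFin; rewrite !indicE; congr ((nat_of_bool _)%:R).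
  apply/idP/idP; rewrite !inE /= => H j; have := H j.
    have := NZ (fun j => (l j)%:C) z j; rewrite normcl /comp => ->.
    by rewrite ger_pMr.
  have := NZ (fun j => (l j)%:C) z j; rewrite normcl /comp => ->.
  by rewrite ger_pMr.
move=> /existsNP[j /negP]; rewrite -leNgt => lj.
rewrite (bigD1 j)//= (max_idPr lj) expr0n.
have [i ij] := blk_surj j.
have -> : deg j == 0%N = false by rewrite gtn_eqF ?deg_gt0.
rewrite mul0r mulr0; apply/negligibleP; first exact: measurable_norm_map_box.
apply: negligibleS norm_map_gt0 => z /= Hz H; have := H j.
by rewrite ltNge => /negP; apply; exact: le_trans (Hz j) lj.
Qed.

(** Otherwise all boxes would be null by scaling; countably many of them cover the space, against
    the positive measure of a cube. *)
Lemma kappa_gt0 : 0 < kappa.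
Proof.
rewrite lt_neqAle fine_ge0 ?measure_ge0// andbT; apply/eqP => k0.
have [B mB [B0 _]] := @lebesgue_complex_box R n 0 1 ltr01.
have N0 : mu.-negligible (\bigcup_m N @^-1` tuple_box (fun=> m%:R)).
  apply: negligible_bigcup => m; apply/negligibleP.
    exact: measurable_norm_map_box.
  by apply: etrans (norm_map_box _) _; rewrite -k0 mul0r.
have : mu.-negligible B.
  apply: negligibleS N0 => z _; rewrite -preimage_bigcup bigcup_tuple_box//.
move=> /(negligibleP _ mB) B00; move: B0.
by rewrite [X in (_ < X)%E]B00 ltxx.
Qed.

Lemma norm_map_integral (G : k.-tuple RT -> \bar R) :
  measurable_fun setT G -> (forall r, 0 <= G r)%E ->
  (\int[mu]_z G (N z) =
   \int[lebesgue_tuple R k]_r (G r * (kappa * polar_density deg r)%:E))%E.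
Proof.
apply: polar_integral => //.
- by move=> j; exact: deg_gt0.
- exact/ltW/kappa_gt0.
- exact: norm_map_box.
Qed.

End norm_map.

(** * The block norms *)

Section blocks.
Context {R : realType} {k : nat} {b : 'I_k -> nat}.
Local Notation C := R[i].
Local Notation n := (\sum_(j < k) b j)%N.
Local Notation RT := (measurableTypeR R).
Local Notation normc := ComplexField.Normc.normc.
Local Notation mu := (@lebesgue_complex R n).
Implicit Types z : 'cV[C]_n.
Notation blk := (@tagnat.sig1 k b).

Lemma enormZ m (c : C) (w : 'cV[C]_m) : enorm (c *: w) = normc c * enorm w.
Proof.
rewrite /enorm (eq_bigr (fun j => normc c ^+ 2 * normc (w j 0) ^+ 2)) => [|j _].
  by rewrite -mulr_sumr sqrtrM ?sqr_ge0// sqrtr_sqr ger0_norm// normc_ge0.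
by rewrite !mxE ComplexField.Normc.normcM exprMn.
Qed.

Lemma normc_le_enorm m (w : 'cV[C]_m) i : normc (w i 0) <= enorm w.
Proof.
rewrite /enorm -[leLHS]ger0_norm ?normc_ge0// -sqrtr_sqr ler_wsqrtr//.
by rewrite (bigD1 i)//= lerDl sumr_ge0// => j _; exact: sqr_ge0.
Qed.

Lemma measurable_enorm m : measurable_fun setT (@enorm R m).
Proof.
have msq : measurable_fun [set: R] (@Num.sqrt R).
  by apply: continuous_measurable_fun; exact: sqrt_continuous.
apply: (measurableT_comp msq).
apply: measurable_sum => i.
rewrite (_ : (fun z : 'cV[C]_m => normc (z i 0) ^+ 2) =
  (fun z : 'cV[C]_m => complex.Re (z i 0) ^+ 2 + complex.Im (z i 0) ^+ 2)).
  apply: measurable_funD; apply: measurable_funX.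
    exact: measurable_Re_coord.
  exact: measurable_Im_coord.
apply/funext => z; case: (z i 0) => x y /=.
by rewrite sqr_sqrtr// addr_ge0// sqr_ge0.
Qed.

Lemma big_block (T : Type) (idx : T) (op : Monoid.com_law idx) (F : 'I_n -> T) :
  \big[op/idx]_i F i = \big[op/idx]_(j < k) \big[op/idx]_(i < b j) F (tagnat.Rank j i).
Proof.
rewrite sig_big_dep/= (reindex _ tagnat.sig_bij_on)/=.
by apply: eq_bigr => i _; rewrite tagnat.sig2K.
Qed.

Lemma submxcol_dilate (c : 'I_k -> C) z j :
  submxcol (dilate (c \o blk) z) j = c j *: submxcol z j.
Proof. by apply/matrixP => i l; rewrite !mxE /= tagnat.Rank1K ord1. Qed.

Lemma sqr_enorm_blocks z : enorm z = Num.sqrt (\sum_(j < k) tnth (block_norms z) j ^+ 2).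
Proof.
rewrite {1}/enorm big_block; congr Num.sqrt; apply: eq_bigr => j _.
rewrite tnth_mktuple /enorm sqr_sqrtr; last by apply: sumr_ge0 => i _; exact: sqr_ge0.
by apply: eq_bigr => i _; rewrite mxE.
Qed.

Lemma measurable_block_norms : measurable_fun setT (@block_norms R k b).
Proof.
apply/measurable_fun_tnthP => j.
apply: (@eq_measurable_fun _ _ _ _ _ (fun z : 'cV[C]_n => enorm (submxcol z j) : RT)).
  by move=> z _ /=; rewrite tnth_mktuple.
apply: measurableT_comp; first exact: measurable_enorm.
apply: measurable_complexP => i.
  rewrite (_ : (fun z => _) = (fun z : 'cV[C]_n => complex.Re (z (tagnat.Rank j i) 0))).
    exact: measurable_Re_coord.
  by apply/funext => z; rewrite mxE.
rewrite (_ : (fun z => _) = (fun z : 'cV[C]_n => complex.Im (z (tagnat.Rank j i) 0))).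
  exact: measurable_Im_coord.
by apply/funext => z; rewrite mxE.
Qed.

Lemma block_normsZ (c : 'I_k -> C) z j :
  tnth (block_norms (dilate (c \o blk) z)) j = normc (c j) * tnth (block_norms z) j.
Proof. by rewrite !tnth_mktuple submxcol_dilate enormZ. Qed.

Lemma normc_le_block_norms z i : normc (z i 0) <= tnth (block_norms z) (blk i).
Proof.
rewrite tnth_mktuple; have := normc_le_enorm (submxcol z (blk i)) (tagnat.sig2 i).
by rewrite mxE tagnat.sig2K.
Qed.

Lemma prod_block (F : 'I_k -> R) :
  \prod_(i < n) F (blk i) ^+ 2 = \prod_(j < k) F j ^+ (2 * b j).
Proof.
rewrite big_block; apply: eq_bigr => j _.
rewrite (eq_bigr (fun=> F j ^+ 2)) => [|i _]; last by rewrite tagnat.Rank1K.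
by rewrite prodr_const card_ord exprM.
Qed.

End blocks.

(** * Rotations and scaling of box integrals *)

Section complex_measurable_functions.
Context {R : realType} d (T : measurableType d).
Local Notation C := R[i].
Local Notation normc := ComplexField.Normc.normc.
Implicit Types F G : T -> C.

Definition cmeasurable F : Prop :=
  measurable_fun setT (fun x => complex.Re (F x)) /\
  measurable_fun setT (fun x => complex.Im (F x)).

Lemma cmeasurableM F G : cmeasurable F -> cmeasurable G ->
  cmeasurable (fun x => F x * G x).
Proof.
move=> [F1 F2] [G1 G2]; split.
  rewrite (_ : (fun x => complex.Re (F x * G x)) = (fun x =>
    complex.Re (F x) * complex.Re (G x) - complex.Im (F x) * complex.Im (G x))).
    by apply: measurable_funB; apply: measurable_funM.
  by apply/funext => x; case: (F x) => ? ?; case: (G x).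
rewrite (_ : (fun x => complex.Im (F x * G x)) = (fun x =>
    complex.Re (F x) * complex.Im (G x) + complex.Im (F x) * complex.Re (G x))).
  by apply: measurable_funD; apply: measurable_funM.
by apply/funext => x; case: (F x) => ? ?; case: (G x).
Qed.

Lemma cmeasurableD F G : cmeasurable F -> cmeasurable G ->
  cmeasurable (fun x => F x + G x).
Proof.
move=> [F1 F2] [G1 G2]; split.
  rewrite (_ : (fun x => complex.Re (F x + G x)) = (fun x =>
    complex.Re (F x) + complex.Re (G x))); first exact: measurable_funD.
  by apply/funext => x; case: (F x) => ? ?; case: (G x).
rewrite (_ : (fun x => complex.Im (F x + G x)) = (fun x =>
    complex.Im (F x) + complex.Im (G x))); first exact: measurable_funD.
by apply/funext => x; case: (F x) => ? ?; case: (G x).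
Qed.

Lemma cmeasurable_conj F : cmeasurable F -> cmeasurable (fun x => conjc (F x)).
Proof.
move=> [F1 F2]; split.
  by rewrite (_ : (fun x => _) = (fun x => complex.Re (F x)))//; apply/funext => x; case: (F x).
rewrite (_ : (fun x => _) = (fun x => - complex.Im (F x))).
  exact: measurableT_comp.
by apply/funext => x; case: (F x).
Qed.

Lemma cmeasurable_cst (c : C) : cmeasurable (fun=> c).
Proof. by split; exact: measurable_cst. Qed.

Lemma cmeasurable_cexp F : cmeasurable F -> cmeasurable (fun x => cexp (F x)).
Proof.
have me : measurable_fun [set: R] (@expR R) by exact: measurable_expR.
have mc : measurable_fun [set: R] (@cos R).
  by apply: continuous_measurable_fun; exact: continuous_cos.
have ms : measurable_fun [set: R] (@sin R).
  by apply: continuous_measurable_fun; exact: continuous_sin.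
by move=> [F1 F2]; split; apply: measurable_funM; apply: measurableT_comp.
Qed.

Lemma cmeasurable_normc F : cmeasurable F -> measurable_fun setT (fun x => normc (F x)).
Proof.
move=> [F1 F2].
have msq : measurable_fun [set: R] (@Num.sqrt R).
  by apply: continuous_measurable_fun; exact: sqrt_continuous.
rewrite (_ : (fun x => _) = (fun x => Num.sqrt (complex.Re (F x) ^+ 2 + complex.Im (F x) ^+ 2))).
  by apply: (measurableT_comp msq); apply: measurable_funD; apply: measurable_funX.
by apply/funext => x; case: (F x).
Qed.

Lemma cmeasurable_coord n (Z : T -> 'cV[C]_n) : measurable_fun setT Z ->
  forall i, cmeasurable (fun x => Z x i 0).
Proof.
move=> mZ i; split.
  exact: (measurableT_comp (measurable_Re_coord i) mZ).
exact: (measurableT_comp (measurable_Im_coord i) mZ).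
Qed.

Lemma cmeasurable_cV n (Z : T -> 'cV[C]_n) :
  (forall i, cmeasurable (fun x => Z x i 0)) -> measurable_fun setT Z.
Proof. by move=> mZ; apply: measurable_complexP => i; have [] := mZ i. Qed.

Lemma continuous_cmeasurable n (u : 'cV[C]_n -> C) (Z : T -> 'cV[C]_n) :
  continuous u -> measurable_fun setT Z -> cmeasurable (fun x => u (Z x)).
Proof.
move=> cu mZ; have [m1 m2] := continuous_measurable_ReIm cu.
by split; [exact: (measurableT_comp m1 mZ)|exact: (measurableT_comp m2 mZ)].
Qed.

End complex_measurable_functions.

Section real_integrals.
Context {R : realType}.
Local Notation C := R[i].
Local Notation normc := ComplexField.Normc.normc.

Lemma integrable_bounded_on d (T : measurableType d) (mu : {measure set T -> \bar R})
    (B : set T) (F : T -> R) (M : R) : measurable B -> (mu B < +oo)%E ->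
  measurable_fun setT F -> (forall x, B x -> `|F x| <= M) ->
  mu.-integrable B (EFin \o F).
Proof.
move=> mB Boo mF FM; apply: measurable_bounded_integrable => //.
  exact: measurable_funTS.
exists M; split; first exact: num_real.
by move=> y My x Bx /=; apply: le_trans (FM x Bx) (ltW My).
Qed.

Lemma Rintegral_dilate n (c : 'I_n -> C) (F : 'cV[C]_n -> R) :
  (forall i, c i != 0) -> measurable_fun setT F ->
  (lebesgue_complex n).-integrable setT (EFin \o F) ->
  \int[lebesgue_complex n]_z F z =
  (\prod_(i < n) normc (c i) ^+ 2) * \int[lebesgue_complex n]_z F (dilate c z).
Proof.
move=> c0 mF iF; set K := \prod_(i < n) _.
have K0 : 0 < K by apply: prodr_gt0 => i _; rewrite exprn_gt0// normc_gt0.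
have mFE : measurable_fun setT (EFin \o F) by exact/measurable_EFinP.
(* [fine] sends infinity to 0, so finiteness has to be carried across the dilation: a positive
   multiple of an infinite integral would be infinite. *)
have pos (P : 'cV[C]_n -> \bar R) (mP : measurable_fun setT P) (P0 : forall z, (0 <= P z)%E) :
    (\int[lebesgue_complex n]_z P z \is a fin_num ->
     \int[lebesgue_complex n]_z P (dilate c z) \is a fin_num)%E.
  have := ge0_integral_dilate c0 mP P0; rewrite -/K.
  have : (0 <= \int[lebesgue_complex n]_z P (dilate c z))%E by apply: integral_ge0.
  case: (\int[_]_z P (dilate c z))%E => //.
  by move=> _ <-; rewrite gt0_muley// lte_fin.
have f1 := integrable_fin_num measurableT (integrable_funepos measurableT iF).
have f2 := integrable_fin_num measurableT (integrable_funeneg measurableT iF).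
have mp := measurable_funepos mFE; have mn := measurable_funeneg mFE.
have g1 := pos _ mp (funepos_ge0 _) f1; have g2 := pos _ mn (funeneg_ge0 _) f2.
have EF : (\int[lebesgue_complex n]_z (F z)%:E =
    \int[lebesgue_complex n]_z (EFin \o F)^\+ z -
    \int[lebesgue_complex n]_z (EFin \o F)^\- z)%E by exact: integralE.
have EFd : (\int[lebesgue_complex n]_z (F (dilate c z))%:E =
    \int[lebesgue_complex n]_z (EFin \o F)^\+ (dilate c z) -
    \int[lebesgue_complex n]_z (EFin \o F)^\- (dilate c z))%E.
  transitivity (\int[lebesgue_complex n]_z ((EFin \o F) \o dilate c) z)%E => //.
  by rewrite integralE funepos_comp funeneg_comp.
rewrite /Rintegral EF (fineB f1 f2) EFd (fineB g1 g2) mulrBr; congr (_ - _).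
  by rewrite -(ge0_integral_dilate c0 mp (funepos_ge0 _)) fineM.
by rewrite -(ge0_integral_dilate c0 mn (funeneg_ge0 _)) fineM.
Qed.

(** Fubini for the integrand cut off by an indicator; the bound and the finite measure of both
    domains supply integrability. *)
Lemma Rintegral_swap_bounded d (T : measurableType d)
    (mu : {sigma_finite_measure set T -> \bar R}) (B : set T) (W : T -> R -> R) (M : R) :
  measurable B -> (mu B < +oo)%E ->
  measurable_fun setT (fun p : T * measurableTypeR R => W p.1 p.2) ->
  (forall z t, B z -> `[0, 1]%classic t -> `|W z t| <= M) ->
  \int[mu]_(z in B) \int[lebesgue_measure]_(t in `[0, 1]) W z t =
  \int[lebesgue_measure]_(t in `[0, 1]) \int[mu]_(z in B) W z t.
Proof.
move=> mB Boo mW WM.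
pose leb := @lebesgue_measure R.
have I1 : leb `[0, 1]%classic = 1%E.
  by rewrite /leb lebesgue_measure_itv/= lte_fin ltr01 sube0.
have Ioo : (leb `[0%R, 1%R]%classic < +oo)%E by rewrite I1 ltry.
have iWt z : B z -> leb.-integrable `[0, 1] (EFin \o W z).
  move=> Bz; apply: (@integrable_bounded_on _ _ _ _ _ M) => //.
    exact: (measurableT_comp mW (measurable_pair1 z)).
  by move=> t It; exact: WM.
have iWz t : `[0, 1]%classic t -> mu.-integrable B (EFin \o W ^~ t).
  move=> It; apply: (@integrable_bounded_on _ _ _ _ _ M) => //.
    exact: (measurableT_comp mW (measurable_pair2 t)).
  by move=> z Bz; exact: WM.
pose A : set (T * measurableTypeR R) := B `*` `[0, 1]%classic.
have mA : measurable A by exact: measurableX.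
pose g (p : T * measurableTypeR R) : \bar R := (W p.1 p.2 * \1_A p)%:E.
have AE : (mu \x leb)%E A = mu B.
  by rewrite /A product_measure1E// [X in (_ * X)%E](_ : _ = 1%E) ?mule1.
have ig : (mu \x leb)%E.-integrable setT g.
  rewrite (_ : g = (EFin \o (fun p => W p.1 p.2)) \_ A); last first.
    by apply/funext => p; rewrite epatch_indic /g EFinM.
  apply/integrable_restrict => //; rewrite setTI.
  apply: (@integrable_bounded_on _ _ _ _ _ M) => //.
    by apply: (@le_lt_trans _ _ (mu B)) Boo; rewrite -AE.
  by move=> [z t] [/= Bz It]; exact: WM.
have := Fubini ig.
rewrite /Rintegral => E; congr fine.
have gE z t : g (z, t) = (W z t * (\1_B z * \1_(`[0, 1]%classic) t))%:E.
  by rewrite /g /A !indicE in_setX/= -mulnb natrM.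
transitivity (\int[mu]_z \int[leb]_t g (z, t))%E.
  rewrite integral_mkcond; apply: eq_integral => z _.
  rewrite patchE; case: ifPn => [|] zB.
    have Bz : B z by rewrite inE in zB.
    rewrite fineK; last exact: (integrable_fin_num _ (iWt z Bz)).
    rewrite integral_mkcond; apply: eq_integral => t _.
    by rewrite epatch_indic gE [\1_B z]indicE zB mul1r EFinM.
  by rewrite integral0_eq// => t _; rewrite gE [\1_B z]indicE (negbTE zB) mul0r mulr0.
rewrite E [RHS]integral_mkcond; apply: eq_integral => t _.
rewrite patchE; case: ifPn => [|] tI.
  have It : `[0, 1]%classic t by rewrite inE in tI.
  rewrite fineK; last exact: (integrable_fin_num _ (iWz t It)).
  rewrite [RHS]integral_mkcond; apply: eq_integral => z _.
  by rewrite epatch_indic gE [\1_(`[_, _]%classic) t]indicE tI mulr1 EFinM.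
by rewrite integral0_eq// => z _; rewrite gE [\1_(`[_, _]%classic) t]indicE (negbTE tI) !mulr0.
Qed.

End real_integrals.

Lemma integrable_EFinB {R : realType} d (T : measurableType d)
    (mu : {measure set T -> \bar R}) (D : set T) (F G : T -> R) : measurable D ->
  mu.-integrable D (EFin \o F) -> mu.-integrable D (EFin \o G) ->
  mu.-integrable D (EFin \o (fun x => F x - G x)).
Proof.
move=> mD iF iG; rewrite (_ : _ \o _ = (fun x => (EFin \o F) x - (EFin \o G) x)%E) //.
exact: integrableB.
Qed.

(** * The scaling law of box integrals *)

Section block_mean.
Context {R : realType} {k : nat} {b : 'I_k -> nat}.
Local Notation C := R[i].
Local Notation n := (\sum_(j < k) b j)%N.
Local Notation RT := (measurableTypeR R).
Local Notation normc := ComplexField.Normc.normc.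
Local Notation mu := (@lebesgue_complex R n).
Notation blk := (@tagnat.sig1 k b).
Notation N := (@block_norms R k b).
Notation leb := (@lebesgue_measure R).
Notation J F := (\int[leb]_(t in `[0%R, 1%R]) F t).

Lemma measurable_block_box (l : 'I_k -> R) : measurable (N @^-1` tuple_box l).
Proof.
by rewrite -[X in measurable X]setTI; apply: measurable_block_norms => //; exact: measurable_box.
Qed.

Hypothesis b0 : forall j, (0 < b j)%N.

Let blk_surj j : exists i, blk i = j.
Proof. by exists (tagnat.Rank j (Ordinal (b0 j))); rewrite tagnat.Rank1K. Qed.

Lemma block_box_fin (l : 'I_k -> R) : (mu (N @^-1` tuple_box l) < +oo)%E.
Proof.
rewrite [X in (X < _)%E](norm_map_box measurable_block_norms block_normsZ
  normc_le_block_norms blk_surj prod_block).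
by rewrite ltry.
Qed.

Lemma Rintegral_block_box_dilate (F : 'cV[C]_n -> R) l : (forall j, 0 < l j) ->
  measurable_fun setT F -> mu.-integrable (N @^-1` tuple_box l) (EFin \o F) ->
  \int[mu]_(z in N @^-1` tuple_box l) F z =
  (\prod_(j < k) l j ^+ (2 * b j)) *
  \int[mu]_(z in N @^-1` tuple_box (fun=> 1)) F (dilate (fun i => (l (blk i))%:C) z).
Proof.
move=> l0 mF iF; pose A := N @^-1` tuple_box l; pose B := N @^-1` tuple_box (fun=> 1 : R).
have mA : measurable A := measurable_block_box l.
have E (D : set 'cV[C]_n) (H : 'cV[C]_n -> R) :
    \int[mu]_(z in D) H z = \int[mu]_z (H z * \1_D z).
  rewrite Rintegral_mkcond; apply: eq_Rintegral => z _.
  by rewrite patchE indicE; case: (z \in D); rewrite ?mulr1 ?mulr0.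
pose c i : C := (l (blk i))%:C.
have c0 i : c i != 0 by rewrite eq_complex/= negb_and gt_eqF ?l0.
have cn i : normc (c i) = l (blk i).
  by rewrite /= expr0n addr0 sqrtr_sqr gtr0_norm.
have iFA : mu.-integrable setT (EFin \o (fun z => F z * \1_A z)).
  rewrite (_ : EFin \o _ = (EFin \o F) \_ A); last first.
    by apply/funext => p; rewrite epatch_indic /= EFinM.
  by apply/integrable_restrict => //; rewrite setTI.
have mFA : measurable_fun setT (fun z => F z * \1_A z).
  by apply: measurable_funM => //; exact: measurable_indic.
rewrite E (Rintegral_dilate c0 mFA iFA).
have -> : \prod_(i < n) normc (c i) ^+ 2 = \prod_(j < k) l j ^+ (2 * b j).
  by rewrite -prod_block; apply: eq_bigr => i _; rewrite cn.
have cE : c = (fun j => (l j)%:C) \o blk by [].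
have AB z : \1_A (dilate c z) = \1_B z :> R.
  rewrite !indicE; congr ((nat_of_bool _)%:R); apply/idP/idP; rewrite !inE /A /B /= => H j.
    by have := H j; rewrite cE block_normsZ /= expr0n addr0 sqrtr_sqr gtr0_norm// -ler_pdivlMl// mulVf ?gt_eqF.
  by rewrite cE block_normsZ /= expr0n addr0 sqrtr_sqr gtr0_norm// -ler_pdivlMl// mulVf ?gt_eqF.
by under eq_Rintegral do rewrite AB; rewrite -[X in _ * X = _]E.
Qed.

Variables (s : 'I_k -> nat) (f u : 'cV[C]_n -> C).
Hypothesis df : forall z, differentiable f z.
Hypothesis du : forall z, differentiable u z.
Hypothesis fZ : forall (c : 'I_k -> C) z,
  f (dilate (c \o blk) z) = (\prod_(j < k) c j ^+ s j) * f z.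

Let cf : continuous f. Proof. by move=> z; exact: differentiable_continuous. Qed.
Let cu : continuous u. Proof. by move=> z; exact: differentiable_continuous. Qed.

Let X z : R := complex.Re (conjc (f z) * u z).

Let cmf : cmeasurable f.
Proof. exact: (continuous_cmeasurable cf (@measurable_id _ _ setT)). Qed.

Let cmu : cmeasurable u.
Proof. exact: (continuous_cmeasurable cu (@measurable_id _ _ setT)). Qed.

Section rotation.
Variable tau : 'I_k -> R.
Let sigma : R := \sum_(j < k) (s j)%:R * tau j.
Let c (w : C) (j : 'I_k) : C := cexp (w * (tau j)%:C).
Let G (z : 'cV[C]_n) (w : C) : C :=
  conjc (f z) * u (dilate (c w \o blk) z) * cexp (w * (- sigma)%:C).
Let B := N @^-1` tuple_box (fun=> 1).

Let conj_cexp (y : R) (t : R) :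
  conjc (cexp ((0 +i* y) * t%:C)) = cexp ((0 +i* y) * (- t)%:C).
Proof.
by apply/eqP; rewrite /cexp eq_complex/= ?mul0r ?mulr0 ?addr0 ?add0r ?subr0 ?oppr0 !mulrN cosN sinN mulrN !eqxx.
Qed.

Let prod_cexp (w : C) : \prod_(j < k) c w j ^+ s j = cexp (w * sigma%:C).
Proof.
have cX (v : C) m : cexp v ^+ m = cexp (m%:R * v).
  elim: m => [|m IH]; first by rewrite mul0r cexp0 expr0.
  by rewrite exprS IH -cexpD -[in RHS]natr1 mulrDl mul1r addrC.
have cS (F : 'I_k -> C) : \prod_(j < k) cexp (F j) = cexp (\sum_(j < k) F j).
  elim/big_ind2 : _ => [|? ? ? ? -> ->|//]; first by rewrite cexp0.
  by rewrite cexpD.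
under eq_bigr do rewrite /c cX.
rewrite cS; congr cexp; rewrite /sigma rmorph_sum/= mulr_sumr; apply: eq_bigr => j _.
by rewrite rmorphM/= rmorph_nat mulrCA.
Qed.

(** The rotation multiplies conj(f) by e^(- i y sigma), since conj reverses the phase. This is
    exactly the change of the factor e^(- w sigma) when [w] moves by [i y]. *)
Let Grot z (x y : R) : G z (x +i* y) = G (dilate (c (0 +i* y) \o blk) z) (x +i* 0).
Proof.
have xy : (x +i* y) = (x +i* 0) + (0 +i* y) :> C.
  by apply/eqP; rewrite eq_complex/= addr0 add0r !eqxx.
rewrite /G fZ prod_cexp dilateM.
have -> : conjc (cexp ((0 +i* y) * sigma%:C) * f z) =
    cexp ((0 +i* y) * (- sigma)%:C) * conjc (f z).
  by rewrite -conj_cexp; exact: rmorphM.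
have -> : (fun i => (c (x +i* 0) \o blk) i * (c (0 +i* y) \o blk) i) = c (x +i* y) \o blk.
  by apply/funext => i /=; rewrite /c xy mulrDl cexpD.
rewrite [in LHS]xy mulrDl cexpD.
set p := cexp _; set q := cexp _; rewrite -xy.
by ring.
Qed.

Let normc_rot (y : R) j : normc (c (0 +i* y) j) = 1.
Proof. by rewrite /c normc_cexp /= !mul0r mulr0 subr0 expR0. Qed.

Let Brot (y : R) z : \1_B (dilate (c (0 +i* y) \o blk) z) = \1_B z :> R.
Proof.
have Nr : N (dilate (c (0 +i* y) \o blk) z) = N z.
  by apply: eq_from_tnth => j; rewrite block_normsZ normc_rot mul1r.
by rewrite !indicE; congr ((nat_of_bool _)%:R); apply/idP/idP; rewrite !inE /B /= Nr.
Qed.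

Let cmG d (T : measurableType d) (Z : T -> 'cV[C]_n) (W : T -> C) :
  measurable_fun setT Z -> cmeasurable W -> cmeasurable (fun x => G (Z x) (W x)).
Proof.
move=> mZ mW; apply: cmeasurableM; last first.
  by apply: cmeasurable_cexp; apply: cmeasurableM => //; exact: cmeasurable_cst.
apply: cmeasurableM.
  by apply: cmeasurable_conj; exact: continuous_cmeasurable.
apply: continuous_cmeasurable => //; apply: cmeasurable_cV => i.
rewrite (_ : (fun x => _) = (fun x => c (W x) (blk i) * Z x i 0)).
  apply: cmeasurableM; last exact: cmeasurable_coord.
  by apply: cmeasurable_cexp; apply: cmeasurableM => //; exact: cmeasurable_cst.
by apply/funext => x; rewrite !mxE.
Qed.

Let Gbound : exists M : R, forall z w, B z -> `|complex.Re w| <= 1 -> normc (G z w) <= M.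
Proof.
(* On [B] the coordinates of [z] are at most 1, and for [|Re w| <= 1] those of the dilated point are
   at most e^|tau_j|. One radius serves [f] and [u]; the imaginary part of [w] is irrelevant to
   moduli. *)
pose L : R := 1 + \sum_(j < k) expR `|tau j|.
have L1 : 1 <= L by rewrite lerDl sumr_ge0// => j _; exact: expR_ge0.
have [M0 HM0] := continuous_locally_bounded cf L.
have [M1 HM1] := continuous_locally_bounded cu L.
exists (M0 * M1 * expR `|sigma|) => z w Bz w1.
have z1 i : normc (z i 0) <= 1.
  by apply: le_trans (normc_le_block_norms z i) _; exact: Bz.
have le_exp (t : R) : complex.Re (w * t%:C) <= `|t|.
  case: w w1 => x y /= x1; rewrite mulr0 subr0 (le_trans (ler_norm _))// normrM.
  by rewrite ler_piMl.
rewrite /G !ComplexField.Normc.normcM; apply: ler_pM => //.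
- by rewrite mulr_ge0 ?normc_ge0.
- exact: normc_ge0.
- apply: ler_pM; rewrite ?normc_ge0//.
    have -> : normc (conjc (f z)) = normc (f z) by case: (f z) => ? ? /=; rewrite sqrrN.
    by apply: HM0 => i; exact: le_trans (z1 i) L1.
  apply: HM1 => i; rewrite mxE ComplexField.Normc.normcM.
  have -> : normc ((c w \o blk) i) = expR (complex.Re (w * (tau (blk i))%:C)).
    exact: normc_cexp.
  apply: le_trans (_ : expR `|tau (blk i)| * 1 <= L).
    by apply: ler_pM; rewrite ?expR_ge0 ?normc_ge0// ler_expR.
  rewrite mulr1 /L (bigD1 (blk i))//= addrCA lerDl addr_ge0// sumr_ge0//.
- by rewrite normc_cexp ler_expR (le_trans (le_exp _))// normrN.
Qed.

Let mB : measurable B. Proof. exact: measurable_block_box. Qed.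

(** The rotation preserves both Lebesgue measure and [B]. [Q] stands for the real part on vertical
    sides of the square and for the imaginary part on horizontal ones. *)
Let int_rot (x y : R) (Q : C -> R) :
  (forall F : 'cV[C]_n -> C, cmeasurable F -> measurable_fun setT (fun z => Q (F z))) ->
  (forall w, `|Q w| <= normc w) -> `|x| <= 1 ->
  \int[mu]_(z in B) Q (G z (x +i* y)) = \int[mu]_(z in B) Q (G z (x +i* 0)).
Proof.
move=> mQ Qn x1; have [M HM] := Gbound.
have mQG : measurable_fun setT (fun z => Q (G z (x +i* 0))).
  by apply: mQ; apply: cmG; [exact: measurable_id|exact: cmeasurable_cst].
pose F z := Q (G z (x +i* 0)) * \1_B z.
have mF : measurable_fun setT F.
  by apply: measurable_funM => //; exact: measurable_indic.
have iF : mu.-integrable setT (EFin \o F).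
  rewrite (_ : EFin \o F = (EFin \o (fun z => Q (G z (x +i* 0)))) \_ B); last first.
    by apply/funext => p; rewrite epatch_indic /F /= EFinM.
  apply/integrable_restrict => //; rewrite setTI.
  apply: (@integrable_bounded_on _ _ _ _ _ _ M) => //; first exact: block_box_fin.
  by move=> z Bz; apply: le_trans (Qn _) _; exact: HM.
have E (H : 'cV[C]_n -> R) : \int[mu]_(z in B) H z = \int[mu]_z (H z * \1_B z).
  rewrite Rintegral_mkcond; apply: eq_Rintegral => z _.
  by rewrite patchE indicE; case: (z \in B); rewrite ?mulr1 ?mulr0.
rewrite !E.
rewrite (_ : \int[mu]_z (Q (G z (x +i* y)) * \1_B z) =
  \int[mu]_z F (dilate (c (0 +i* y) \o blk) z)); last first.
  by apply: eq_Rintegral => z _; rewrite /F Brot Grot.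
rewrite [RHS](@Rintegral_dilate _ _ (c (0 +i* y) \o blk) F)//; last first.
  by move=> i; exact: cexp_neq0.
rewrite [X in _ = X * _](_ : _ = 1) ?mul1r// big1// => i _.
by rewrite [normc _]normc_rot expr1n.
Qed.

Lemma Rintegral_dilate_exp :
  \int[mu]_(z in B) X (dilate (fun i => (expR (tau (blk i)))%:C) z) =
  expR (2 * sigma) * \int[mu]_(z in B) X z.
Proof.
have [M HM] := Gbound.
have RI (w : C) : `|complex.Re w| <= normc w /\ `|complex.Im w| <= normc w.
  by split; [exact: normr_le_normc_Re|exact: normr_le_normc_Im].
have cpt (p q : 'cV[C]_n * measurableTypeR R -> R) : measurable_fun setT p ->
    measurable_fun setT q -> cmeasurable (fun x => p x +i* q x) by [].
have mt : measurable_fun setT (fun p : 'cV[C]_n * measurableTypeR R => (p.2 : R)).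
  exact: measurable_snd.
have mk (r : R) : measurable_fun setT (fun p : 'cV[C]_n * measurableTypeR R => r).
  exact: measurable_cst.
(* The difference of the two sides of Cauchy's identity, before integration in [t]. For fixed [z]
   its integral in [t] is 0; for fixed [t] its integral in [z] is [K 1 - K 0]. Exchanging the
   integrals gives [K 1 = K 0]. *)
pose D z t := complex.Re (G z (1 +i* t)) - complex.Re (G z (0 +i* t)) -
  (complex.Im (G z (t +i* 1)) - complex.Im (G z (t +i* 0))).
have mz : measurable_fun setT (@fst 'cV[C]_n (measurableTypeR R)) by exact: measurable_fst.
have mD : measurable_fun setT (fun p : 'cV[C]_n * measurableTypeR R => D p.1 p.2).
  apply: measurable_funB; apply: measurable_funB.
  - by have [] := cmG mz (cpt _ _ (mk 1) mt).
  - by have [] := cmG mz (cpt _ _ (mk 0) mt).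
  - by have [] := cmG mz (cpt _ _ mt (mk 1)).
  - by have [] := cmG mz (cpt _ _ mt (mk 0)).
have DM z t : B z -> `[0%R, 1%R]%classic t -> `|D z t| <= M + M + (M + M).
  rewrite /= in_itv/= => Bz /andP[t0 t1].
  have b1 (w : C) : `|complex.Re w| <= 1 ->
      `|complex.Re (G z w)| <= M /\ `|complex.Im (G z w)| <= M.
    by move=> /(HM _ _ Bz) H; have [h1 h2] := RI (G z w); split; exact: le_trans H.
  have [|h1 _] := b1 (1 +i* t); first by rewrite /= normr1.
  have [|h2 _] := b1 (0 +i* t); first by rewrite /= normr0.
  have [|_ h3] := b1 (t +i* 1); first by rewrite /= ger0_norm.
  have [|_ h4] := b1 (t +i* 0); first by rewrite /= ger0_norm.
  by rewrite /D; do 3 (apply: le_trans (ler_normB _ _) _; apply: lerD => //).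
have Jint (F : R -> R) : measurable_fun setT (F : measurableTypeR R -> R) ->
    (forall t, `[0%R, 1%R]%classic t -> `|F t| <= M) ->
    leb.-integrable `[0%R, 1%R] (EFin \o F).
  move=> mF FM; apply: (@integrable_bounded_on _ _ _ _ _ _ M) => //.
  by apply: le_lt_trans (ltry 1); rewrite [leLHS](lebesgue_measure_itv `[0%R, 1%R])/= lte_fin ltr01 sube0.
have ReG z x : B z -> `|x| <= 1 ->
    leb.-integrable `[0%R, 1%R] (EFin \o (fun t => complex.Re (G z (x +i* t)))).
  move=> Bz x1; apply: Jint.
    by have [] := @cmG _ _ (fun=> z) (fun t : measurableTypeR R => x +i* (t : R))
       (measurable_cst _) (conj (measurable_cst _) (@measurable_id _ _ _)).
  by move=> t _; apply: le_trans (RI _).1 _; exact: HM.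
have ImG z y : B z ->
    leb.-integrable `[0%R, 1%R] (EFin \o (fun t => complex.Im (G z (t +i* y)))).
  move=> Bz; apply: Jint.
    by have [] := @cmG _ _ (fun=> z) (fun t : measurableTypeR R => (t : R) +i* y)
       (measurable_cst _) (conj (@measurable_id _ _ _) (measurable_cst _)).
  move=> t; rewrite /= in_itv/= => /andP[t0 t1]; apply: le_trans (RI _).2 _.
  by apply: HM => //=; rewrite ger0_norm.
have iB (Q : C -> R) (w : C) :
    (forall F : 'cV[C]_n -> C, cmeasurable F -> measurable_fun setT (fun z => Q (F z))) ->
    (forall v, `|Q v| <= normc v) -> `|complex.Re w| <= 1 ->
    mu.-integrable B (EFin \o (fun z => Q (G z w))).
  move=> mQ Qn w1; apply: (@integrable_bounded_on _ _ _ _ _ _ M) => //.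
  - exact: block_box_fin.
  - by apply: mQ; apply: cmG; [exact: measurable_id|exact: cmeasurable_cst].
  - by move=> z Bz; apply: le_trans (Qn _) _; exact: HM.
have mRe (F : 'cV[C]_n -> C) : cmeasurable F -> measurable_fun setT (fun z => complex.Re (F z)).
  by case.
have mIm (F : 'cV[C]_n -> C) : cmeasurable F -> measurable_fun setT (fun z => complex.Im (F z)).
  by case.
have D0 z : B z -> J (D z) = 0.
  move=> Bz; rewrite /D.
  have n1 : `|1 : R| <= 1 by rewrite normr1.
  have n0 : `|0 : R| <= 1 by rewrite normr0.
  have I0 : measurable (`[0%R, 1%R]%classic : set (measurableTypeR R)).
    exact: measurable_itv.
  have r1 := ReG z 1 Bz n1; have r0 := ReG z 0 Bz n0.
  rewrite (RintegralB I0 (integrable_EFinB I0 r1 r0)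
    (integrable_EFinB I0 (ImG z 1 Bz) (ImG z 0 Bz))).
  rewrite (RintegralB I0 r1 r0) (RintegralB I0 (ImG z 1 Bz) (ImG z 0 Bz)).
  apply/eqP; rewrite subr_eq0; apply/eqP; apply: (@goursat_complex _ (G z)) => w.
  exact: (differentiable_dilate_cexp _ _ _ _ du).
pose K x := \int[mu]_(z in B) complex.Re (G z (x +i* 0)).
have KE t : `[0%R, 1%R]%classic t -> \int[mu]_(z in B) D z t = K 1 - K 0.
  rewrite /= in_itv/= => /andP[t0 t1].
  have n1 : `|1 : R| <= 1 by rewrite normr1.
  have n0 : `|0 : R| <= 1 by rewrite normr0.
  have nt : `|t| <= 1 by rewrite ger0_norm.
  have i1 := iB _ (1 +i* t) mRe (fun w => (RI w).1) n1.
  have i2 := iB _ (0 +i* t) mRe (fun w => (RI w).1) n0.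
  have i3 := iB _ (t +i* 1) mIm (fun w => (RI w).2) nt.
  have i4 := iB _ (t +i* 0) mIm (fun w => (RI w).2) nt.
  rewrite /D (RintegralB mB (integrable_EFinB mB i1 i2) (integrable_EFinB mB i3 i4)).
  rewrite (RintegralB mB i1 i2) (RintegralB mB i3 i4).
  have RIm w := (RI w).2; have RRe w := (RI w).1.
  (* Here the two horizontal sides cancel; what remains no longer depends on [t]. *)
  rewrite (int_rot 1 mIm RIm nt) subrr subr0.
  by rewrite (int_rot t mRe RRe n1) (int_rot t mRe RRe n0).
have swap := Rintegral_swap_bounded (@measurable_block_box (fun=> 1)) (block_box_fin _) mD DM.
have EL : \int[mu]_(z in B) J (D z) = 0.
  rewrite (@eq_Rintegral _ _ _ mu B (cst 0)) ?Rintegral_cst ?mul0r// => z.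
  by rewrite inE => Bz; exact: (D0 _ Bz).
have ER : J (fun t => \int[mu]_(z in B) D z t) = K 1 - K 0.
  rewrite (@eq_Rintegral _ _ _ leb `[0%R, 1%R] (cst (K 1 - K 0))).
    apply: etrans (Rintegral_cst _ _ _) _; first exact: measurable_itv.
    rewrite [X in _ * fine X](_ : _ = 1%E) ?mulr1//.
    by apply: etrans (lebesgue_measure_itv _) _; rewrite /= lte_fin ltr01 sube0.
  by move=> t; rewrite inE => It; exact: (KE _ It).
have K10 : K 1 = K 0 by apply: subr0_eq; apply: (etrans (esym ER)); exact: (etrans (esym swap) EL).
have cE (x : R) (r : R) : cexp ((x +i* 0) * r%:C) = (expR (x * r))%:C.
  by apply/eqP; rewrite /cexp eq_complex/= !mulr0 subr0 mul0r addr0 cos0 sin0 mulr1 mulr0 !eqxx.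
have K0E : K 0 = \int[mu]_(z in B) X z.
  apply: eq_Rintegral => z _; rewrite /G cE mul0r expR0 mulr1 /X.
  rewrite (_ : dilate _ z = z)//; apply/matrixP => i j.
  by rewrite !mxE /= /c cE mul0r expR0 mul1r ord1.
have n1 : `|1 : R| <= 1 by rewrite normr1.
rewrite -K0E -K10 -(RintegralZl _ mB (iB _ (1 +i* 0) mRe (fun w => (RI w).1) n1)).
apply: eq_Rintegral => z _.
have -> : dilate (fun i => (expR (tau (blk i)))%:C) z = dilate (c (1 +i* 0) \o blk) z.
  by congr dilate; apply/funext => i; rewrite /= /c cE mul1r.
rewrite /X fZ prod_cexp /G !cE !mul1r.
(* One factor e^sigma is the homogeneity of [f], the other undoes the factor e^(- sigma) in [G] at w
   = 1. *)
rewrite (_ : 2 * sigma = sigma + sigma) ?expRD; last by rewrite mulr_natl.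
case: (f z) => p q; case: (u _) => p' q' /=.
have : expR sigma * expR (- sigma) = 1 by rewrite -expRD subrr expR0.
move: (expR sigma) (expR (- sigma)) => A A' AA.
by transitivity (A * (p * p' + q * q') * (A * A')); [rewrite AA; ring|ring].
Qed.
End rotation.

Let mX : measurable_fun setT X.
Proof. by have [] := cmeasurableM (cmeasurable_conj cmf) cmu. Qed.

Lemma integrable_block_box l : mu.-integrable (N @^-1` tuple_box l) (EFin \o X).
Proof.
pose L := \sum_(j < k) `|l j|.
have [M HM] := continuous_locally_bounded cf L.
have [M' HM'] := continuous_locally_bounded cu L.
apply: (@integrable_bounded_on _ _ _ _ _ _ (M * M')) => //.
- exact: measurable_block_box.
- exact: block_box_fin.
move=> z Bz; have zL i : normc (z i 0) <= L.
  apply: le_trans (normc_le_block_norms z i) _.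
  apply: le_trans (Bz _) _; apply: le_trans (ler_norm _) _.
  by rewrite /L (bigD1 (blk i))//= lerDl sumr_ge0.
apply: le_trans (normr_le_normc_Re _) _; rewrite ComplexField.Normc.normcM.
apply: ler_pM; rewrite ?normc_ge0 ?HM'//.
by have -> : normc (conjc (f z)) = normc (f z) by [case: (f z) => ? ? /=; rewrite sqrrN]; exact: HM.
Qed.

(** Take [tau j = ln (l j)]: the exponents [2 * b j] are the Jacobian of the dilation and [2 * s j]
    comes from the exponential scaling law. *)
Lemma Rintegral_block_box l : (forall j, 0 < l j) ->
  \int[mu]_(z in N @^-1` tuple_box l) X z =
  (\prod_(j < k) l j ^+ (2 * s j + 2 * b j)) *
  \int[mu]_(z in N @^-1` tuple_box (fun=> 1)) X z.
Proof.
move=> l0; apply: etrans (Rintegral_block_box_dilate l0 mX (integrable_block_box l)) _.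
have cE : (fun i => (l (blk i))%:C) = fun i => (expR (ln (l (blk i))))%:C :> C.
  by apply/funext => i; rewrite lnK ?posrE.
have := Rintegral_dilate_exp (fun j => ln (l j)); rewrite -cE => H.
apply: etrans (congr1 ( *%R _) H) _; rewrite mulrA; congr (_ * _).
rewrite (_ : \prod_(j < k) l j ^+ (2 * s j + 2 * b j) =
  \prod_(j < k) l j ^+ (2 * b j) * \prod_(j < k) l j ^+ (2 * s j)); last first.
  by rewrite -big_split; apply: eq_bigr => j _ /=; rewrite -exprD addnC.
congr (_ * _); rewrite mulr_sumr expR_sum; apply: eq_bigr => j _.
by rewrite mulrA -natrM -mulr_natl mulr_natl expRM_natl lnK ?posrE.
Qed.

End block_mean.

(** * Functions of the block norms *)

Section ae_integral.
Context d (T : measurableType d) (R : realType).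
Variable mu : {measure set T -> \bar R}.
Local Open Scope ereal_scope.
Import HBNNSimple.

(** The integral is a supremum over simple functions below [f]; setting such a function to 0 on the
    null set keeps its integral and puts it below [g]. Neither [f] nor [g] has to be measurable. *)
Let ge0_ae_le_integral (f g : T -> \bar R) :
  (forall x, 0 <= f x) -> (forall x, 0 <= g x) ->
  {ae mu, forall x, f x = g x} -> \int[mu]_x f x <= \int[mu]_x g x.
Proof.
move=> f0 g0 [A [mA A0 fgA]].
rewrite (ge0_integralTE mu f0) (ge0_integralTE mu g0).
apply: ge_ereal_sup => _ [h hf <-].
rewrite -integralT_nnsfun.
pose h' := proj_nnsfun h (measurableC mA).
have h'E x : h' x = (h x * (x \in ~` A)%:R)%R by rewrite /h' /proj_nnsfun/= mindicE.
have hh' : \int[mu]_x (h x)%:E = \int[mu]_x (h' x)%:E.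
  apply: ae_eq_integral => //.
  - exact/measurable_EFinP.
  - exact/measurable_EFinP.
  - exists A; split => // x H; apply: contrapT => Ax; apply: H => _.
    by apply/esym; rewrite (h'E x) mem_set ?mulr1.
rewrite hh' integralT_nnsfun; apply: ereal_sup_ubound; exists h' => //.
move=> x; apply: (@le_trans _ _ (h' x)%:E) => //; rewrite h'E; have [/set_mem Ax|_] := boolP (x \in ~` A).
  rewrite mulr1 (_ : g x = f x); first exact: hf.
  by apply: contrapT => gf; apply: Ax; apply: fgA => /= fg; exact: gf.
by rewrite mulr0.
Qed.

(* The library version of this fact asks for measurable functions. *)
Lemma ae_eq_integral_nonmeasurable (D : set T) (f g : T -> \bar R) :
  {ae mu, forall x, D x -> f x = g x} ->
  \int[mu]_(x in D) f x = \int[mu]_(x in D) g x.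
Proof.
move=> fg; rewrite integral_mkcond [RHS]integral_mkcond !(integralE _ _ (_ \_ _)).
have fgD : {ae mu, forall x, (f \_ D) x = (g \_ D) x}.
  apply: filterS fg => x fgx; rewrite !patchE; case: ifPn => // xD.
  by apply: fgx; rewrite inE in xD.
have gfD : {ae mu, forall x, (g \_ D) x = (f \_ D) x} by apply: filterS fgD => x ->.
by congr (_ - _); apply/eqP; rewrite eq_le !ge0_ae_le_integral//;
  [apply: filterS gfD|apply: filterS fgD|apply: filterS gfD|apply: filterS fgD];
  move=> x; rewrite !(funeposE, funenegE) => ->.
Qed.

End ae_integral.

Section norm_map_change.
Context {R : realType} {n k : nat}.
Local Notation RT := (measurableTypeR R).
Local Notation C := R[i].
Local Notation normc := ComplexField.Normc.normc.
Local Notation mu := (@lebesgue_complex R n).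
Variables (blk : 'I_n -> 'I_k) (N : 'cV[C]_n -> k.-tuple RT) (deg : 'I_k -> nat).
Hypotheses (mN : measurable_fun setT N).
Hypothesis NZ : forall (c : 'I_k -> C) z j,
  tnth (N (dilate (c \o blk) z)) j = normc (c j) * tnth (N z) j.
Hypothesis NG : forall (z : 'cV[C]_n) i, normc (z i 0) <= tnth (N z) (blk i).
Hypothesis blk_surj : forall j, exists i, blk i = j.
Hypothesis degE : forall F : 'I_k -> R,
  \prod_(i < n) F (blk i) ^+ 2 = \prod_(j < k) F j ^+ deg j.

(** The density is nonnegative, so it passes inside positive and negative parts; no integrability is
    involved. *)
Lemma norm_map_integralE (G : k.-tuple RT -> R) : measurable_fun setT G ->
  (\int[mu]_z (G (N z))%:E =
   \int[lebesgue_tuple R k]_r (G r * (kappa N * polar_density deg r))%:E)%E.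
Proof.
move=> mG; pose D r := kappa N * polar_density deg r.
have D0 r : 0 <= D r.
  by rewrite mulr_ge0 ?polar_density_ge0// ltW// (kappa_gt0 mN NZ NG blk_surj degE).
have mGE : measurable_fun setT (EFin \o G) by exact/measurable_EFinP.
have EP := norm_map_integral mN NZ NG blk_surj degE (measurable_funepos mGE) (funepos_ge0 _).
have EN := norm_map_integral mN NZ NG blk_surj degE (measurable_funeneg mGE) (funeneg_ge0 _).
transitivity (\int[mu]_z ((EFin \o G) \o N) z)%E => //.
rewrite integralE funepos_comp funeneg_comp.
apply: etrans (congr2 (fun x y => x - y)%E EP EN) _.
have maxM (x y : R) : 0 <= y -> (maxe x%:E 0 * y%:E = maxe (x * y)%:E 0)%E.
  by move=> y0; rewrite -!EFin_max -EFinM maxr_pMl// mul0r.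
rewrite [RHS]integralE; congr (_ - _)%E; apply: eq_integral => r _.
  by rewrite !funeposE maxM//; exact: D0.
by rewrite !funenegE /= maxM ?mulNr//; exact: D0.
Qed.

(** A null set of R^k has integral 0 against the polar density, so its preimage is null. This
    carries a measurable representative of [a] over to [phi]. *)
Lemma norm_map_ae_orthant (P : k.-tuple RT -> Prop) :
  {ae lebesgue_tuple R k, forall r, positive_orthant r -> P r} ->
  {ae mu, forall z, P (N z)}.
Proof.
move=> [A [mA A0 PA]].
have NA0 : mu (N @^-1` A) = 0%E.
  have mNA : measurable (N @^-1` A) by rewrite -[X in measurable X]setTI; exact: mN.
  have E : (mu (N @^-1` A) = \int[mu]_z (\1_A (N z))%:E)%E.
    by have := integral_indic mu measurableT mNA; rewrite setIT => <-.
  rewrite E (norm_map_integralE (measurable_indic mA)).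
  apply: etrans (_ : (\int[lebesgue_tuple R k]_r cst 0 r)%E = _); last exact: integral0.
  apply: ae_eq_integral_nonmeasurable; exists A; split => // r /=.
  move=> H; apply: contrapT => Ar; apply: H => _.
  by rewrite indicE memNset// mul0r.
have nA : {ae mu, forall z, ~ A (N z)}.
  exists (N @^-1` A); split => //; last by move=> z /= /contrapT.
  by rewrite -[X in measurable X]setTI; exact: mN.
apply: filterS2 nA (norm_map_gt0 NG blk_surj) => z NAz N0.
by apply: contrapT => PN; apply: NAz; apply: PA => /= H; exact/PN/H.
Qed.

End norm_map_change.

(** * The weight and its radial moments *)

Section radial_weights.
Context {R : realType}.
Local Notation RT := (measurableTypeR R).
Local Notation C := R[i].
Local Notation normc := ComplexField.Normc.normc.
Variable h : R -> R.
Hypothesis ch : {within `[0, +oo[, continuous h}.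

Lemma enorm_ge0 n (z : 'cV[C]_n) : 0 <= enorm z.
Proof. exact: sqrtr_ge0. Qed.

Lemma measurable_expR_weight d (T : measurableType d) (F : T -> R) :
  measurable_fun setT F -> (forall x, 0 <= F x) ->
  measurable_fun setT (fun x => expR (- (2 * h (F x)))).
Proof.
move=> mF F0; have me : measurable_fun [set: R] (@expR R) by exact: measurable_expR.
have mh : measurable_fun (`[0, +oo[%classic : set (measurableTypeR R)) h.
  exact: subspace_continuous_measurable_fun.
apply: (measurableT_comp me); apply: measurableT_comp => //.
apply: measurable_funM => //.
apply: (measurable_comp _ _ mh mF) => //.
by move=> _ [x _ <-]; rewrite /= in_itv/= F0.
Qed.

Lemma measurable_weight n : measurable_fun setT (@weight R h n).
Proof. apply: measurable_expR_weight; [exact: measurable_enorm|exact: enorm_ge0]. Qed.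

Lemma weight_gt0 n z : 0 < @weight R h n z.
Proof. exact: expR_gt0. Qed.

Let norm_map1 n (z : 'cV[C]_n) : 1.-tuple RT := [tuple enorm z].

(** The polar formula for the single Euclidean norm, where the density is a multiple of r^(2n-1). *)
Lemma radial_moment_fin n m : (0 < n)%N ->
  (\int[lebesgue_measure]_(r in `]0%R, +oo[)
      (r ^+ (2 * m + 2 * n - 1) * expR (- (2 * h r)))%:E < +oo)%E ->
  (\int[@lebesgue_complex R n]_z (enorm z ^+ (2 * m) * weight h z)%:E < +oo)%E.
Proof.
move=> n0 hfin.
have mN : measurable_fun setT (@norm_map1 n).
  apply/measurable_fun_tnthP => j.
  apply: (@eq_measurable_fun _ _ _ _ _ (@enorm R n : 'cV[C]_n -> RT)).
    by move=> z _; rewrite (ord1 j).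
  exact: measurable_enorm.
have NZ (c : 'I_1 -> C) (z : 'cV[C]_n) j :
    tnth (norm_map1 (dilate (c \o (fun=> ord0)) z)) j = normc (c j) * tnth (norm_map1 z) j.
  rewrite !ord1; transitivity (enorm (c ord0 *: z)); last exact: enormZ.
  by congr enorm; apply/matrixP => i l; rewrite (ord1 l) !mxE.
have NG (z : 'cV[C]_n) i : normc (z i 0) <= tnth (norm_map1 z) ((fun=> ord0) i).
  exact: normc_le_enorm.
have surj (j : 'I_1) : exists i : 'I_n, (fun=> ord0) i = j.
  by exists (Ordinal n0); rewrite (ord1 j).
have degE (F : 'I_1 -> R) : \prod_(i < n) F ((fun=> ord0) i) ^+ 2 =
    \prod_(j < 1) F j ^+ ((fun=> 2 * n)%N j).
  by rewrite prodr_const card_ord big_ord1 exprM.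
(* Absolute values keep the argument of [h] in the half-line where it is continuous; they change
   nothing at a norm. *)
pose G (r : 1.-tuple RT) : R := `|tnth r ord0| ^+ (2 * m) * expR (- (2 * h `|tnth r ord0|)).
have mG : measurable_fun setT G.
  have mt : measurable_fun setT (fun r : 1.-tuple RT => `|tnth r ord0| : R).
    by apply: measurableT_comp => //; exact: measurable_tnth.
  by apply: measurable_funM; [exact: measurable_funX|exact: measurable_expR_weight].
rewrite [X in (X < _)%E](_ : _ = \int[@lebesgue_complex R n]_z (G (norm_map1 z))%:E)%E; last first.
  apply: eq_integral => z _; rewrite /G (_ : tnth (norm_map1 z) ord0 = enorm z)//.
  by rewrite (ger0_norm (enorm_ge0 _)).
rewrite (norm_map_integralE mN NZ NG surj degE mG).
pose kap := kappa (@norm_map1 n) * (2 * n)%:R.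
have kappa0 : 0 <= kappa (@norm_map1 n) by exact/ltW/(kappa_gt0 mN NZ NG surj degE).
have kap0 : 0 <= kap by rewrite mulr_ge0.
pose P : set R := `]0%R, +oo[%classic.
have mP : measurable (P : set RT) by exact: measurable_itv.
pose g (x : RT) : R := `|x| ^+ (2 * m) * expR (- (2 * h `|x|)) *
  (kap * `|x| ^+ (2 * n).-1 * \1_P x).
have mabs : measurable_fun setT (fun x : RT => `|x| : R) by exact: measurableT_comp.
have mg : measurable_fun setT g.
  apply: measurable_funM.
    by apply: measurable_funM; [exact: measurable_funX|exact: measurable_expR_weight].
  apply: measurable_funM; last exact: measurable_indic.
  by apply: measurable_funM => //; exact: measurable_funX.
have g0 x : 0 <= g x.
  by rewrite /g indicE !mulr_ge0 ?exprn_ge0 ?expR_ge0 ?kappa0.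
have := @ge0_integral_lebesgue_tuple_prod R 1 (fun=> g) (fun=> mg) (fun=> g0).
rewrite big_ord1 => E.
rewrite [X in (X < _)%E](_ : _ =
    \int[lebesgue_tuple R 1]_t (\prod_(i < 1) g (tnth t i))%:E)%E; last first.
  apply: eq_integral => r _; rewrite big_ord1 /g /G /polar_density big_ord1.
  have -> : \1_(@positive_orthant R 1) r = \1_P (tnth r ord0) :> R.
    rewrite !indicE; congr ((nat_of_bool _)%:R); apply/idP/idP; rewrite !inE /P /= in_itv/= andbT.
      exact.
    by move=> r0 j; rewrite (ord1 j).
  rewrite indicE; have [|_] := boolP (tnth r ord0 \in P); last by rewrite !mulr0.
  rewrite inE /P /= in_itv/= andbT => r0; rewrite !mulr1 !gtr0_norm//.
  by rewrite /kap; congr EFin; rewrite -!mulrA.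
rewrite E.
have -> : (\int[lebesgue_measure]_x (g x)%:E =
    kap%:E * \int[lebesgue_measure]_(r in P) (r ^+ (2 * m + 2 * n - 1) * expR (- (2 * h r)))%:E)%E.
  rewrite [X in (_ * X)%E]integral_mkcond -ge0_integralZl//; last 2 first.
  - rewrite (_ : _ \_ _ = (fun x : RT => (`|x| ^+ (2 * m + 2 * n - 1) *
        expR (- (2 * h `|x|)) * \1_P x)%:E)); last first.
      apply/funext => x; rewrite patchE indicE; case: ifPn => [|_]; last by rewrite mulr0.
      by rewrite inE /P /= in_itv/= andbT => x0; rewrite mulr1 gtr0_norm.
    apply/measurable_EFinP; apply: measurable_funM; last exact: measurable_indic.
    by apply: measurable_funM; [exact: measurable_funX|exact: measurable_expR_weight].
  - move=> x _; rewrite patchE; case: ifPn => //; rewrite inE /P /= in_itv/= andbT => x0.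
    by rewrite lee_fin mulr_ge0 ?expR_ge0// exprn_ge0// ltW.
  apply: eq_integral => x _; rewrite patchE /g indicE; case: ifPn => [|_]; last first.
    by rewrite !mulr0 mule0.
  rewrite inE /P /= in_itv/= andbT => x0; rewrite mulr1 gtr0_norm// -EFinM; congr EFin.
  rewrite (_ : (2 * m + 2 * n - 1 = 2 * m + (2 * n).-1)%N) ?exprD; last first.
    by rewrite -addnBA ?muln_gt0// subn1.
  ring.
by rewrite lte_mul_pinfty.
Qed.
End radial_weights.

(** * Homogeneous polynomials *)

Section polynomials.
Import -(notations) mpoly.
Context {R : realType} {k : nat} {b : 'I_k -> nat}.
Local Notation C := R[i].
Local Notation n := (\sum_(j < k) b j)%N.
Notation blk := (@tagnat.sig1 k b).

Let entM m (f g : 'cV[C]_m -> C) : entire f -> entire g -> entire (fun z => f z * g z).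
Proof. by move=> df dg z; exact: differentiableM. Qed.

Let entD m (f g : 'cV[C]_m -> C) : entire f -> entire g -> entire (fun z => f z + g z).
Proof. by move=> df dg z; exact: differentiableD. Qed.

Let ent_cst m (c : C) : entire (fun _ : 'cV[C]_m => c).
Proof. by move=> z; exact: differentiable_cst. Qed.

Let ent_prod m (I : Type) (r : seq I) (P : pred I) (F : I -> 'cV[C]_m -> C) :
  (forall i, P i -> entire (F i)) -> entire (fun z => \prod_(i <- r | P i) F i z).
Proof.
move=> dF; elim: r => [|i r IH].
  by rewrite (_ : (fun z => _) = fun=> 1)//; apply/funext => z; rewrite big_nil.
rewrite (_ : (fun z => _) = fun z => if P i then F i z * \prod_(i <- r | P i) F i z
    else \prod_(i <- r | P i) F i z); last by apply/funext => z; rewrite big_cons.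
by case E : (P i) => //; apply: entM => //; exact: dF.
Qed.

Let ent_sum m (I : Type) (r : seq I) (P : pred I) (F : I -> 'cV[C]_m -> C) :
  (forall i, P i -> entire (F i)) -> entire (fun z => \sum_(i <- r | P i) F i z).
Proof.
move=> dF; elim: r => [|i r IH].
  by rewrite (_ : (fun z => _) = fun=> 0)//; apply/funext => z; rewrite big_nil.
rewrite (_ : (fun z => _) = fun z => if P i then F i z + \sum_(i <- r | P i) F i z
    else \sum_(i <- r | P i) F i z); last by apply/funext => z; rewrite big_cons.
by case E : (P i) => //; apply: entD => //; exact: dF.
Qed.

Lemma entire_polynomial_tensor (s : 'I_k -> nat) (f : 'cV[C]_n -> C) :
  polynomial_tensor s f -> entire f.
Proof.
move=> [M [c [g [gP ->]]]]; apply: ent_sum => i _; apply: entM => //.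
have [p [pP ->]] := gP i; apply: ent_prod => j _.
have [q _ ->] := pP j.
rewrite (_ : (fun z => _) = fun z : 'cV[C]_n =>
  \sum_(m <- msupp q) mcoeff m q * \prod_i z (tagnat.Rank j i) 0 ^+ fun_of_multinom m i); last first.
  by apply/funext => z; rewrite mevalE; under eq_bigr do under eq_bigr do rewrite mxE.
apply: ent_sum => m _; apply: entM => //; apply: ent_prod => l _.
rewrite (_ : (fun z => _) = fun z : 'cV[C]_n =>
  \prod_(e < fun_of_multinom m l) z (tagnat.Rank j l) 0); last first.
  by apply/funext => z; rewrite prodr_const card_ord.
by apply: ent_prod => e _ z; exact: differentiable_coord.
Qed.

(** Every monomial of the j-th factor has degree [s j]. This multihomogeneity is the form in which
    the tensor product enters the scaling argument. *)
Lemma polynomial_tensorZ (s : 'I_k -> nat) (f : 'cV[C]_n -> C) (c : 'I_k -> C) z :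
  polynomial_tensor s f ->
  f (dilate (c \o blk) z) = (\prod_(j < k) c j ^+ s j) * f z.
Proof.
move=> [M [a [g [gP ->]]]]; rewrite mulr_sumr; apply: eq_bigr => i _.
rewrite mulrCA; congr (_ * _); have [p [pP ->]] := gP i.
rewrite -big_split; apply: eq_bigr => j _ /=; rewrite submxcol_dilate.
have [q qh ->] := pP j; rewrite !mevalE mulr_sumr !big_seq; apply: eq_bigr => m mq.
rewrite mulrCA; congr (_ * _); under eq_bigr do rewrite mxE exprMn.
rewrite big_split /=; congr (_ * _); rewrite -expr_sum; congr (_ ^+ _).
by rewrite -mdegE; exact: dhomog_mf qh _ mq.
Qed.
End polynomials.

(** * The Fock space and the Toeplitz operator *)

Section square_integrable.
Context {R : realType} {n : nat}.
Local Notation C := R[i].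
Local Notation normc := ComplexField.Normc.normc.
Local Notation mu := (@lebesgue_complex R n).
Variable h : R -> R.
Hypothesis ch : {within `[0, +oo[, continuous h}.
Local Notation w := (@weight R h n).
Implicit Types F G : 'cV[C]_n -> C.

(** Unlike in [L2h], the function itself is measurable, not only a representative, so that it can be
    dominated, added and multiplied directly. *)
Definition square_integrable F : Prop :=
  cmeasurable F /\ (\int[mu]_z (normc (F z) ^+ 2 * w z)%:E < +oo)%E.

Let mw : measurable_fun setT w. Proof. exact: measurable_weight. Qed.

Lemma measurable_sqr_normc F : cmeasurable F ->
  measurable_fun setT (fun z => (normc (F z) ^+ 2 * w z)%:E).
Proof.
move=> mF; apply/measurable_EFinP; apply: measurable_funM => //.
exact/measurable_funX/cmeasurable_normc.
Qed.

Let sq_ge0 F z : 0 <= normc (F z) ^+ 2 * w z.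
Proof. by rewrite mulr_ge0 ?sqr_ge0// ltW// weight_gt0. Qed.

Lemma square_integrable_le (M : R) F G : cmeasurable G ->
  {ae mu, forall z, normc (G z) <= M * normc (F z)} ->
  square_integrable F -> square_integrable G.
Proof.
move=> mG GF [mF iF]; split => //.
apply: (@le_lt_trans _ _ (\int[mu]_z ((M ^+ 2)%:E * (normc (F z) ^+ 2 * w z)%:E))%E).
  apply: ae_ge0_le_integral => //.
  - by move=> z _; rewrite lee_fin.
  - exact: measurable_sqr_normc.
  - by move=> z _; rewrite -EFinM lee_fin mulr_ge0 ?sqr_ge0.
  - by apply: emeasurable_funM => //; exact: measurable_sqr_normc.
  - apply: filterS GF => z GF _; rewrite -EFinM lee_fin mulrA -exprMn.
    rewrite ler_wpM2r ?(ltW (weight_gt0 _ _))// ler_sqr// nnegrE ?normc_ge0//.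
    exact: le_trans (normc_ge0 _) GF.
rewrite ge0_integralZl//; last 3 first.
- exact: measurable_sqr_normc.
- by move=> z _; rewrite lee_fin.
- by rewrite lee_fin sqr_ge0.
by rewrite lte_mul_pinfty ?lee_fin ?sqr_ge0.
Qed.

Lemma square_integrableD F G : square_integrable F -> square_integrable G ->
  square_integrable (fun z => F z + G z).
Proof.
move=> [mF iF] [mG iG]; split; first exact: cmeasurableD.
have mS := measurable_sqr_normc mF; have mT := measurable_sqr_normc mG.
have S0 z : (0 <= (normc (F z) ^+ 2 * w z)%:E)%E by rewrite lee_fin.
have T0 z : (0 <= (normc (G z) ^+ 2 * w z)%:E)%E by rewrite lee_fin.
apply: (@le_lt_trans _ _ (\int[mu]_z (2%:E *
    ((normc (F z) ^+ 2 * w z)%:E + (normc (G z) ^+ 2 * w z)%:E)))%E).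
  apply: ge0_le_integral => //.
  - by move=> z _; rewrite lee_fin; exact: (sq_ge0 (fun z => F z + G z)).
  - by apply: measurable_sqr_normc; exact: cmeasurableD.
  - by apply: emeasurable_funM => //; exact: emeasurable_funD.
  - move=> z _; rewrite -EFinD -EFinM lee_fin -mulrDl mulrA.
    rewrite ler_wpM2r ?(ltW (weight_gt0 _ _))//.
    apply: (@le_trans _ _ ((normc (F z) + normc (G z)) ^+ 2)).
      by rewrite ler_sqr ?ler_normcD// nnegrE ?addr_ge0 ?normc_ge0.
    by have := sqr_ge0 (normc (F z) - normc (G z)); rewrite sqrrB sqrrD; lra.
rewrite ge0_integralZl//; last 2 first.
- exact: emeasurable_funD.
- by move=> z _; rewrite adde_ge0.
by rewrite lte_mul_pinfty// ?adde_ge0// ge0_integralD// lte_add_pinfty.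
Qed.

(** Domination by the sum of the two weighted squares, since p q <= p^2 + q^2. *)
Lemma integrable_product (Q : C -> R) F G :
  (forall H : 'cV[C]_n -> C, cmeasurable H -> measurable_fun setT (fun z => Q (H z))) ->
  (forall c, `|Q c| <= normc c) ->
  square_integrable F -> square_integrable G ->
  mu.-integrable setT (EFin \o (fun z => Q (F z * conjc (G z)) * w z)).
Proof.
move=> mQ Qn [mF iF] [mG iG].
have mS := measurable_sqr_normc mF; have mT := measurable_sqr_normc mG.
apply: (@le_integrable _ _ _ mu setT measurableT _
  (fun z => (normc (F z) ^+ 2 * w z)%:E + (normc (G z) ^+ 2 * w z)%:E)%E).
- apply/measurable_EFinP; apply: measurable_funM => //; apply: mQ.
  by apply: cmeasurableM => //; exact: cmeasurable_conj.
- move=> z _; rewrite /= lee_fin.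
  rewrite [leRHS]ger0_norm ?addr_ge0// normrM (gtr0_norm (weight_gt0 _ _)) -mulrDl.
  rewrite ler_wpM2r ?(ltW (weight_gt0 _ _))//.
  apply: le_trans (Qn _) _; rewrite ComplexField.Normc.normcM.
  have -> : normc (conjc (G z)) = normc (G z) by case: (G z) => ? ? /=; rewrite sqrrN.
  have := normc_ge0 (F z); have := normc_ge0 (G z).
  by move: (normc (F z)) (normc (G z)) => p q; nra.
- apply: integrableD => //; apply/integrableP; split => //.
    by under eq_integral do rewrite gee0_abs ?lee_fin//.
  by under eq_integral do rewrite gee0_abs ?lee_fin//.
Qed.

Lemma fock_square_integrable F : fock h F -> square_integrable F.
Proof.
move=> [dF [_ iF]]; split => //.
have cF : continuous F by move=> z; exact: differentiable_continuous.
exact: (continuous_cmeasurable cF (@measurable_id _ _ setT)).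
Qed.

Lemma square_integrable_fock F : entire F -> square_integrable F -> fock h F.
Proof.
move=> dF [[m1 m2] iF]; split => //; split => //.
by exists F; split => //; exact: aeW.
Qed.

End square_integrable.

Lemma integral_ae_gt0 {R : realType} d (T : measurableType d)
    (mu : {measure set T -> \bar R}) (A : set T) (F : T -> R) : measurable A ->
  (0 < mu A)%E -> measurable_fun setT F -> {ae mu, forall x, 0 < F x} ->
  (forall x, 0 <= F x) -> (0 < \int[mu]_(x in A) (F x)%:E)%E.
Proof.
move=> mA A0 mF Fp F0; rewrite lt0e integral_ge0 ?andbT; last first.
  by move=> x _; rewrite lee_fin.
apply/eqP => I0.
have mFA : measurable_fun A (EFin \o F).
  by apply/measurable_EFinP; exact: measurable_funTS.
have [] := ae_eq_integral_abs mu mA mFA.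
rewrite (_ : (\int[mu]_(x in A) `|(EFin \o F) x|)%E = 0%E); last first.
  by rewrite -[RHS]I0; apply: eq_integral => x _; rewrite /= ger0_norm.
move=> /(_ erefl) FA _.
have : mu.-negligible A.
  have : {ae mu, forall x, ~ A x}.
    apply: filterS2 FA Fp => x H Fx Ax; have /= [/eqP] := H Ax.
    by rewrite gt_eqF.
  apply: negligibleS => x Ax /=; exact.
by move=> /(negligibleP _ mA) A00; move: A0; rewrite [X in (_ < X)%E]A00 ltxx.
Qed.

Lemma normc_real {R : realType} (x : R) : ComplexField.Normc.normc x%:C = `|x|.
Proof. by rewrite /= expr0n addr0 sqrtr_sqr. Qed.

(** * Functions of the block norms with weighted mean zero *)

Section vanishing.
Context {R : realType} {k : nat} {b : 'I_k -> nat}.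
Local Notation C := R[i].
Local Notation n := (\sum_(j < k) b j)%N.
Local Notation RT := (measurableTypeR R).
Local Notation normc := ComplexField.Normc.normc.
Local Notation mu := (@lebesgue_complex R n).
Local Notation leb := (lebesgue_tuple R k).
Notation blk := (@tagnat.sig1 k b).
Notation N := (@block_norms R k b).
Variable h : R -> R.
Hypothesis ch : {within `[0, +oo[, continuous h}.
Hypothesis b0 : forall j, (0 < b j)%N.
Hypothesis n0 : (0 < n)%N.
Hypothesis hfin : forall m : nat,
  (\int[lebesgue_measure]_(r in `]0%R, +oo[)
    (r ^+ (2 * m + 2 * n - 1) * expR (- (2 * h r)))%:E < +oo)%E.
Variable s : 'I_k -> nat.
Local Notation w := (@weight R h n).

Let blk_surj j : exists i, blk i = j.
Proof. by exists (tagnat.Rank j (Ordinal (b0 j))); rewrite tagnat.Rank1K. Qed.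

Definition radial_monomial (r : k.-tuple RT) : R := \prod_(j < k) tnth r j ^+ s j.

(** [radial_weight] without its Jacobian part of exponents [2 * b j - 1], which is supplied by the
    polar density. *)
Definition radial_density (r : k.-tuple RT) : R :=
  radial_monomial r ^+ 2 * expR (- (2 * h (Num.sqrt (\sum_(j < k) tnth r j ^+ 2)))).

Let P z : R := radial_monomial (N z).

Let N_ge0 z j : 0 <= tnth (N z) j.
Proof. exact: (norm_map_ge0 normc_le_block_norms blk_surj). Qed.

Let P_ge0 z : 0 <= P z.
Proof. by apply: prodr_ge0 => j _; rewrite exprn_ge0. Qed.

Let measurable_radius :
  measurable_fun setT (fun r : k.-tuple RT => Num.sqrt (\sum_(j < k) tnth r j ^+ 2) : R).
Proof.
have msq : measurable_fun [set: R] (@Num.sqrt R).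
  by apply: continuous_measurable_fun; exact: sqrt_continuous.
apply: (measurableT_comp msq); apply: measurable_sum => j.
by apply: measurable_funX; exact: measurable_tnth.
Qed.

Lemma measurable_radial_monomial : measurable_fun setT radial_monomial.
Proof. by apply: measurable_prod => j _; apply: measurable_funX; exact: measurable_tnth. Qed.

Lemma measurable_radial_density : measurable_fun setT radial_density.
Proof.
apply: measurable_funM; first by apply: measurable_funX; exact: measurable_radial_monomial.
by apply: (measurable_expR_weight ch) => [|r]; [exact: measurable_radius|exact: sqrtr_ge0].
Qed.

Lemma radial_density_block z : radial_density (N z) = P z ^+ 2 * w z.
Proof. by rewrite /radial_density /weight sqr_enorm_blocks. Qed.

Let mP : measurable_fun setT P.
Proof. exact: (measurableT_comp measurable_radial_monomial measurable_block_norms). Qed.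

(** Each block norm is at most the full norm, so the monomial is bounded by |z|^m with m the sum of
    the [s j], and the m-th moment is finite. *)
Lemma square_integrable_monomial : square_integrable h (fun z => (P z)%:C).
Proof.
split; first by split => //; exact: measurable_cst.
apply: le_lt_trans (radial_moment_fin ch n0 (hfin (\sum_(j < k) s j))).
apply: ge0_le_integral => //.
- by move=> z _; rewrite lee_fin mulr_ge0 ?sqr_ge0// ltW// weight_gt0.
- by apply: measurable_sqr_normc => //; split => //; exact: measurable_cst.
- apply/measurable_EFinP; apply: measurable_funM; last exact: measurable_weight.
  by apply: measurable_funX; exact: measurable_enorm.
move=> z _; rewrite lee_fin ler_wpM2r ?(ltW (weight_gt0 _ _))//.
rewrite normc_real (ger0_norm (P_ge0 z)).
rewrite mulnC exprM ler_sqr ?nnegrE ?exprn_ge0 ?enorm_ge0// expr_sum.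
apply: ler_prod => j _; rewrite exprn_ge0//= lerXn2r ?nnegrE ?enorm_ge0//.
rewrite sqr_enorm_blocks -[leLHS]ger0_norm// -sqrtr_sqr ler_wsqrtr//.
by rewrite (bigD1 j)//= lerDl sumr_ge0// => i _; exact: sqr_ge0.
Qed.

(** The volume of {N <= 1} times the constants [2 * b j] of the polar density. *)
Let coef : R := kappa N * \prod_(j < k) (2 * b j)%:R.

Let coef_gt0 : 0 < coef.
Proof.
apply: mulr_gt0.
  exact: (kappa_gt0 measurable_block_norms block_normsZ normc_le_block_norms blk_surj prod_block).
by apply: prodr_gt0 => j _; rewrite ltr0n muln_gt0 b0.
Qed.

Let densityE (g : k.-tuple RT -> R) r :
  g r * radial_density r * (kappa N * polar_density (fun j => 2 * b j)%N r) =
  coef * (g r * radial_weight b h s r) * \1_(@positive_orthant R k) r.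
Proof.
rewrite /radial_density /polar_density /radial_weight /coef big_split/=.
have -> : \prod_(j < k) tnth r j ^+ (2 * s j + 2 * b j - 1) =
    radial_monomial r ^+ 2 * \prod_(j < k) tnth r j ^+ (2 * b j).-1.
  rewrite /radial_monomial -prodrXl -big_split/=; apply: eq_bigr => j _.
  by rewrite -exprM mulnC -exprD -addnBA ?muln_gt0 ?b0// subn1.
ring.
Qed.

Lemma measurable_radial_weight : measurable_fun setT (radial_weight b h s).
Proof.
apply: measurable_funM.
  by apply: measurable_prod => j _; apply: measurable_funX; exact: measurable_tnth.
by apply: (measurable_expR_weight ch) => [|r]; [exact: measurable_radius|exact: sqrtr_ge0].
Qed.

Lemma block_integral_orthant (g : k.-tuple RT -> R) : measurable_fun setT g ->
  (\int[mu]_z (g (N z) * (P z ^+ 2 * w z))%:E =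
   \int[leb]_(r in @positive_orthant R k) (coef * (g r * radial_weight b h s r))%:E)%E.
Proof.
move=> mg.
have mG : measurable_fun setT (fun r => g r * radial_density r).
  by apply: measurable_funM => //; exact: measurable_radial_density.
transitivity (\int[mu]_z ((fun r => g r * radial_density r) (N z))%:E)%E.
  by apply: eq_integral => z _; rewrite radial_density_block.
apply: etrans (norm_map_integralE measurable_block_norms block_normsZ
  normc_le_block_norms blk_surj prod_block mG) _.
rewrite [RHS]integral_mkcond; apply: eq_integral => r _.
by rewrite densityE epatch_indic /= -EFinM.
Qed.

Let orth := @positive_orthant R k.

Let mrw : measurable_fun orth (radial_weight b h s).
Proof. by apply: measurable_funTS; exact: measurable_radial_weight. Qed.

Let rw_ge0 r : orth r -> 0 <= radial_weight b h s r.
Proof.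
move=> r0; rewrite mulr_ge0 ?expR_ge0// prodr_ge0// => j _.
by rewrite exprn_ge0// ltW// r0.
Qed.

(** The polar formula for [|g|]; positivity of [coef] excludes an infinite integral. This direction
    is the one needed, because symbols are known to be bounded only after composition with [N]. *)
Lemma integrable_orthant (g : k.-tuple RT -> R) : measurable_fun setT g ->
  mu.-integrable setT (EFin \o (fun z => g (N z) * (P z ^+ 2 * w z))) ->
  leb.-integrable orth (EFin \o (fun r => g r * radial_weight b h s r)).
Proof.
move=> mg /integrableP[_ ig].
have mgw : measurable_fun orth (fun r => g r * radial_weight b h s r).
  by apply: measurable_funM => //; exact: measurable_funTS.
apply/integrableP; split; first exact/measurable_EFinP.
have mgn : measurable_fun setT (fun r => `|g r|) by exact: measurableT_comp.
have := block_integral_orthant mgn.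
have -> : (\int[mu]_z (`|g (N z)| * (P z ^+ 2 * w z))%:E =
    \int[mu]_z `|(EFin \o (fun z => g (N z) * (P z ^+ 2 * w z))%R) z|)%E.
  apply: eq_integral => z _; rewrite /= normrM [X in _ = (_ * X)%:E]ger0_norm//.
  by rewrite mulr_ge0 ?sqr_ge0// ltW// weight_gt0.
under [in X in _ = X -> _]eq_integral do rewrite EFinM.
rewrite ge0_integralZl//; last 4 first.
- exact: measurable_positive_orthant.
- apply/measurable_EFinP; apply: measurable_funM => //; exact: measurable_funTS.
- by move=> r r0; rewrite lee_fin mulr_ge0// rw_ge0.
- by rewrite lee_fin ltW.
rewrite (_ : (\int[leb]_(x in orth) (`|g x| * radial_weight b h s x)%:E =
    \int[leb]_(x in orth) `|(EFin \o (fun r => g r * radial_weight b h s r)%R) x|)%E); last first.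
  apply: eq_integral => r; rewrite inE => r0.
  by rewrite /= normrM [X in _ = (_ * X)%:E]ger0_norm// rw_ge0.
move=> E; move: ig; rewrite E; have := coef_gt0.
have : (0 <= \int[leb]_(x in orth) `|(EFin \o (fun r => (g r * radial_weight b h s r)%R)) x|)%E.
  by apply: integral_ge0.
case: (\int[leb]_(x in orth) _)%E => [r||]//; first by move=> *; rewrite ltry.
by move=> _ c0; rewrite gt0_muley.
Qed.

Lemma Rintegral_orthant (g : k.-tuple RT -> R) : measurable_fun setT g ->
  mu.-integrable setT (EFin \o (fun z => g (N z) * (P z ^+ 2 * w z))) ->
  \int[mu]_z (g (N z) * (P z ^+ 2 * w z)) =
  coef * \int[leb]_(r in orth) (g r * radial_weight b h s r).
Proof.
move=> mg ig; rewrite -RintegralZl; last exact: integrable_orthant.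
  by rewrite /Rintegral block_integral_orthant.
exact: measurable_positive_orthant.
Qed.

(** The denominator of the eigenvalue. Finiteness of the integral is part of the argument, as [fine]
    would turn an infinite value into 0. *)
Lemma radial_weight_integral_gt0 :
  0 < \int[leb]_(r in orth) radial_weight b h s r.
Proof.
have [_ Pfin] := square_integrable_monomial.
have nP z : normc (P z)%:C ^+ 2 = P z ^+ 2 by rewrite normc_real real_normK// num_real.
have mPw : measurable_fun setT (fun z => P z ^+ 2 * w z).
  by apply: measurable_funM; [exact: measurable_funX|exact: measurable_weight].
have Pw0 z : 0 <= P z ^+ 2 * w z by rewrite mulr_ge0 ?sqr_ge0// ltW// weight_gt0.
have i1 : mu.-integrable setT (EFin \o (fun z => cst 1 (N z) * (P z ^+ 2 * w z))).
  apply/integrableP; split.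
    by apply/measurable_EFinP; apply: measurable_funM.
  apply: le_lt_trans Pfin; rewrite le_eqVlt; apply/orP; left; apply/eqP.
  by apply: eq_integral => z _; rewrite /= mul1r nP ger0_norm.
have := Rintegral_orthant (measurable_cst (1 : R)) i1.
rewrite (@eq_Rintegral _ _ _ leb orth (radial_weight b h s)); last first.
  by move=> r _; rewrite /= mul1r.
move=> E; rewrite -(pmulr_rgt0 _ coef_gt0) -E fine_gt0//; apply/andP; split; last first.
  apply: le_lt_trans Pfin; rewrite le_eqVlt; apply/orP; left; apply/eqP.
  by apply: eq_integral => z _; rewrite /= mul1r nP.
under eq_integral do rewrite /= mul1r.
apply: integral_ae_gt0 => //.
- have k0 : 0 < kappa N :=
    kappa_gt0 measurable_block_norms block_normsZ normc_le_block_norms blk_surj prod_block.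
  apply: (@lt_le_trans _ _ (mu (N @^-1` tuple_box (fun=> 1)))).
    by rewrite [X in (_ < X)%E](kappaE measurable_block_norms normc_le_block_norms).
  apply: le_measure; rewrite ?inE//; exact: measurable_block_box.
- apply: filterS (norm_map_gt0 normc_le_block_norms blk_surj) => z Nz.
  rewrite mulr_gt0 ?weight_gt0// exprn_gt0// prodr_gt0// => j _.
  by rewrite exprn_gt0.
Qed.

Lemma square_integrable_radialM (g : k.-tuple RT -> R) (M : R) (F : 'cV[C]_n -> C) :
  measurable_fun setT g -> {ae mu, forall z, `|g (N z)| <= M} ->
  square_integrable h F -> square_integrable h (fun z => (g (N z))%:C * F z).
Proof.
move=> mg gM sF; apply: (square_integrable_le ch (M := M) _ _ sF).
  apply: cmeasurableM; last by case: sF.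
  split; last exact: measurable_cst.
  exact: (measurableT_comp mg measurable_block_norms).
apply: filterS gM => z gM; rewrite ComplexField.Normc.normcM normc_real.
by rewrite ler_wpM2r ?normc_ge0.
Qed.

Lemma integrable_block_monomial (g : k.-tuple RT -> R) (M : R) :
  measurable_fun setT g -> {ae mu, forall z, `|g (N z)| <= M} ->
  mu.-integrable setT (EFin \o (fun z => g (N z) * (P z ^+ 2 * w z))).
Proof.
move=> mg gM; have sP := square_integrable_monomial.
have mRe (F : 'cV[C]_n -> C) : cmeasurable F -> measurable_fun setT (fun z => complex.Re (F z)).
  by case.
have := integrable_product ch mRe (@normr_le_normc_Re R) (square_integrable_radialM mg gM sP) sP.
by congr (integrable _ _ _); apply/funext => z /=; congr (_%:E); ring.
Qed.

Lemma integrable_bounded_orthant (g : k.-tuple RT -> R) (M : R) :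
  measurable_fun setT g -> {ae mu, forall z, `|g (N z)| <= M} ->
  leb.-integrable orth (EFin \o (fun r => g r * radial_weight b h s r)).
Proof. by move=> mg gM; apply: integrable_orthant mg (integrable_block_monomial mg gM). Qed.

Variable f : 'cV[C]_n -> C.
Hypothesis df : entire f.
Hypothesis fZ : forall (c : 'I_k -> C) z,
  f (dilate (c \o blk) z) = (\prod_(j < k) c j ^+ s j) * f z.

Let cf : continuous f. Proof. by move=> z; exact: differentiable_continuous. Qed.

(** Dividing each block by its norm reaches a point with all block norms 1, where [f] is bounded by
    compactness; homogeneity restores the factor. The bound holds off the null set where some block
    vanishes. *)
Lemma homogeneous_bound :
  exists M : R, {ae mu, forall z, normc (f z) <= M * normc (P z)%:C}.
Proof.
have [M HM] := continuous_locally_bounded cf 1.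
exists M; apply: filterS (norm_map_gt0 normc_le_block_norms blk_surj) => z Nz.
pose c j : C := (tnth (N z) j)%:C; pose d j : C := ((tnth (N z) j)^-1)%:C.
have cd j : c j * d j = 1.
  by rewrite /c /d -rmorphM/= divff ?gt_eqF.
have zE : z = dilate (c \o blk) (dilate (d \o blk) z).
  by rewrite dilateM; apply/matrixP => i l; rewrite !mxE /= cd mul1r ord1.
rewrite zE fZ ComplexField.Normc.normcM -zE mulrC.
have -> : \prod_(j < k) c j ^+ s j = (P z)%:C.
  by rewrite /P /radial_monomial rmorph_prod; apply: eq_bigr => j _; rewrite /= rmorphXn.
apply: ler_wpM2r; first exact: normc_ge0.
apply: HM => i; apply: le_trans (normc_le_block_norms _ _) _.
rewrite block_normsZ normc_real ger0_norm ?invr_ge0 ?(ltW (Nz _))//.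
by rewrite mulVf// gt_eqF.
Qed.

Lemma square_integrable_homogeneous : square_integrable h f.
Proof.
have [M fM] := homogeneous_bound.
apply: square_integrable_le fM square_integrable_monomial => //.
exact: (continuous_cmeasurable cf (@measurable_id _ _ setT)).
Qed.

Variable u : 'cV[C]_n -> C.
Hypothesis uF : fock h u.

Let X z : R := complex.Re (conjc (f z) * u z).
Let B := N @^-1` tuple_box (fun=> 1 : R).

Let mB : measurable B. Proof. exact: measurable_block_box. Qed.

Let P2_box l : mu.-integrable (N @^-1` tuple_box l) (EFin \o (fun z => P z ^+ 2)).
Proof.
apply: (@integrable_bounded_on _ _ _ _ _ _ ((\prod_(j < k) `|l j| ^+ s j) ^+ 2)).
- exact: measurable_block_box.
- exact: block_box_fin.
- exact: measurable_funX.
move=> z Bz; rewrite ger0_norm ?sqr_ge0// ler_sqr ?nnegrE//; last first.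
  by apply: prodr_ge0 => j _; rewrite exprn_ge0.
apply: ler_prod => j _; rewrite exprn_ge0//= lerXn2r ?nnegrE//.
exact: le_trans (Bz j) (ler_norm _).
Qed.

(** The same factor as in the scaling law for conj(f) u, which is what makes [P ^+ 2] the right
    comparison function. *)
Let P2_boxE l : (forall j, 0 < l j) ->
  \int[mu]_(z in N @^-1` tuple_box l) (P z ^+ 2) =
  (\prod_(j < k) l j ^+ (2 * s j + 2 * b j)) * \int[mu]_(z in B) (P z ^+ 2).
Proof.
move=> l0; have mP2 : measurable_fun setT (fun z => P z ^+ 2) by exact: measurable_funX.
apply: etrans (Rintegral_block_box_dilate l0 mP2 (P2_box l)) _.
have PZ z : P (dilate (fun i => (l (blk i))%:C) z) ^+ 2 =
    (\prod_(j < k) l j ^+ (2 * s j)) * P z ^+ 2.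
  rewrite /P /radial_monomial -!prodrXl -big_split; apply: eq_bigr => j _ /=.
  rewrite (block_normsZ (fun j => (l j)%:C)) normc_real gtr0_norm//.
  by rewrite exprMn exprMn -exprM mulnC.
under eq_Rintegral do rewrite PZ.
rewrite (RintegralZl _ mB (P2_box (fun=> 1))).
rewrite mulrA -big_split; congr (_ * _); apply: eq_bigr => j _ /=.
by rewrite -exprD addnC.
Qed.

Let P2_B_neq0 : \int[mu]_(z in B) (P z ^+ 2) != 0.
Proof.
have k0 : 0 < kappa N :=
  kappa_gt0 measurable_block_norms block_normsZ normc_le_block_norms blk_surj prod_block.
have mP2 : measurable_fun setT (fun z => P z ^+ 2) by exact: measurable_funX.
have i2 := integrable_fin_num mB (P2_box (fun=> 1)).
rewrite gt_eqF// -lte_fin fineK//.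
apply: integral_ae_gt0 => //.
- by rewrite [X in (_ < X)%E](kappaE measurable_block_norms normc_le_block_norms).
- apply: filterS (norm_map_gt0 normc_le_block_norms blk_surj) => z Nz.
  by rewrite exprn_gt0// prodr_gt0// => j _; rewrite exprn_gt0.
- by move=> z; exact: sqr_ge0.
Qed.

Let mRe (F : 'cV[C]_n -> C) : cmeasurable F -> measurable_fun setT (fun z => complex.Re (F z)).
Proof. by case. Qed.

Lemma integrable_block_radial (g : k.-tuple RT -> R) (M : R) :
  measurable_fun setT g -> {ae mu, forall z, `|g (N z)| <= M} ->
  mu.-integrable setT (EFin \o (fun z => g (N z) * X z * w z)).
Proof.
move=> mg gM.
have := integrable_product ch mRe (@normr_le_normc_Re R)
  (square_integrable_radialM mg gM square_integrable_homogeneous) (fock_square_integrable uF).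
congr (integrable _ _ _); apply/funext => z /=; congr ((_ * _)%:E).
by rewrite /X; case: (f z) => p q; case: (u z) => p' q' /=; ring.
Qed.

(** Replacing [X] by a multiple of [P ^+ 2] does not change its integral against functions of [N];
    with [P ^+ 2] the integral is a multiple of the weighted mean of [g], which is 0. *)
Lemma Rintegral_block_radial_eq0 (g : k.-tuple RT -> R) (M : R) :
  measurable_fun setT g -> {ae mu, forall z, `|g (N z)| <= M} ->
  \int[leb]_(r in orth) (g r * radial_weight b h s r) = 0 ->
  \int[mu]_z (g (N z) * X z * w z) = 0.
Proof.
move=> mg gM g0.
have [du _] := uF; have sf := square_integrable_homogeneous.
have su := fock_square_integrable uF.
have iX := integrable_block_radial mg gM.
have iP := integrable_block_monomial mg gM.
have P0 : \int[mu]_z (g (N z) * (P z ^+ 2 * w z)) = 0.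
  by rewrite (Rintegral_orthant mg iP) g0 mulr0.
(* Chosen so that [Y] has integral 0 over the unit box; by the common scaling factor it then does so
   over every box. *)
pose c := \int[mu]_(z in B) X z / \int[mu]_(z in B) (P z ^+ 2).
pose Y z := X z - c * P z ^+ 2.
have mX : measurable_fun setT X.
  have [mf _] := sf; have [mu' _] := su.
  by have [] := cmeasurableM (cmeasurable_conj mf) mu'.
have iXb l : mu.-integrable (N @^-1` tuple_box l) (EFin \o X).
  exact: integrable_block_box.
have mY : measurable_fun setT Y.
  by apply: measurable_funB => //; apply: measurable_funM => //; exact: measurable_funX.
have icP l : mu.-integrable (N @^-1` tuple_box l) (EFin \o (fun z => c * P z ^+ 2)).
  exact: (integrableZl (measurable_block_box l) c (P2_box l)).
have iY l : mu.-integrable (N @^-1` tuple_box l) (EFin \o Y).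
  exact: integrable_EFinB (measurable_block_box l) (iXb l) (icP l).
have Y0 l : (\int[mu]_(z in N @^-1` tuple_box l) (Y z)%:E)%E = 0%E.
  have [lp|] := pselect (forall j, 0 < l j); last first.
    move=> /existsNP[j /negP]; rewrite -leNgt => lj.
    apply: (null_set_integral (measurable_block_box l) (measurable_int _ (iY l))).
    apply: etrans (norm_map_box measurable_block_norms block_normsZ
      normc_le_block_norms blk_surj prod_block l) _.
    have -> : \prod_(j < k) Num.max (l j) 0 ^+ (2 * b j) = 0.
      by rewrite (bigD1 j)//= (max_idPr lj) expr0n muln_eq0/= eqn0Ngt b0 mul0r.
    by rewrite mulr0.
  rewrite -(fineK (integrable_fin_num (measurable_block_box l) (iY l))); congr EFin.
  apply: etrans (RintegralB (measurable_block_box l) (iXb l) (icP l)) _.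
  rewrite (RintegralZl _ (measurable_block_box l) (P2_box l)) (P2_boxE lp).
  apply: etrans (congr1 (fun x => x - _) (Rintegral_block_box b0 df du fZ lp)) _.
  by rewrite mulrCA -mulrBr /c (divfK P2_B_neq0) subrr mulr0.
(* The weight is a function of the block norms too, so it is absorbed into the radial factor before
   boxes are used. *)
pose G r := g r * expR (- (2 * h (Num.sqrt (\sum_(j < k) tnth r j ^+ 2)))).
have mG : measurable_fun setT G.
  apply: measurable_funM => //.
  by apply: (measurable_expR_weight ch) => [|r]; [exact: measurable_radius|exact: sqrtr_ge0].
have GN z : G (N z) = g (N z) * w z by rewrite /G /weight sqr_enorm_blocks.
have GY z : G (N z) * Y z = g (N z) * X z * w z - c * (g (N z) * (P z ^+ 2 * w z)).
  by rewrite GN /Y; ring.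
have icgP : mu.-integrable setT (EFin \o (fun z => c * (g (N z) * (P z ^+ 2 * w z)))).
  exact: (integrableZl measurableT c iP).
have iGY : mu.-integrable setT (fun z => (G (N z) * Y z)%:E).
  rewrite (_ : (fun z => _) = EFin \o (fun z => g (N z) * X z * w z -
    c * (g (N z) * (P z ^+ 2 * w z)))); last by apply/funext => z /=; rewrite GY.
  exact: integrable_EFinB.
have := integral_box_eq0 measurable_block_norms mY mG iY Y0 iGY.
move=> /(congr1 fine) E.
have := RintegralB measurableT iX icgP.
rewrite (RintegralZl c measurableT iP) P0 mulr0 subr0 => <-.
by apply: etrans E; apply: eq_Rintegral => z _; rewrite GY.
Qed.
End vanishing.

(** * Uniqueness of the Fock projection *)

Section orthogonal_projection.
Context {R : realType} {n : nat}.
Local Notation C := R[i].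
Local Notation normc := ComplexField.Normc.normc.
Local Notation mu := (@lebesgue_complex R n).

Lemma cintegral_ae d (T : measurableType d) (m : {measure set T -> \bar R})
    (D : set T) (F G : T -> C) : {ae m, forall x, D x -> F x = G x} ->
  cintegral m D F = cintegral m D G.
Proof.
move=> FG; rewrite /cintegral /Rintegral; congr (fine _ +i* fine _);
  apply: ae_eq_integral_nonmeasurable; by apply: filterS FG => x H /H ->.
Qed.

Variable h : R -> R.
Hypothesis ch : {within `[0, +oo[, continuous h}.

Lemma square_integrableZ (c : C) (F : 'cV[C]_n -> C) :
  square_integrable h F -> square_integrable h (fun z => c * F z).
Proof.
move=> sF; apply: (square_integrable_le ch (M := normc c) _ _ sF).
  by apply: cmeasurableM; [exact: cmeasurable_cst|case: sF].
by apply: aeW => z; rewrite ComplexField.Normc.normcM.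
Qed.

Lemma fockZ (c : C) (F : 'cV[C]_n -> C) : fock h F -> fock h (fun z => c * F z).
Proof.
move=> fF; apply: square_integrable_fock.
  by move=> z; apply: differentiableM => //; case: fF.
exact/square_integrableZ/fock_square_integrable.
Qed.

Lemma fockB (F G : 'cV[C]_n -> C) : fock h F -> fock h G -> fock h (fun z => F z - G z).
Proof.
move=> fF fG; apply: square_integrable_fock.
  by move=> z; apply: differentiableB; [case: fF|case: fG].
have sG := square_integrableZ (- 1) (fock_square_integrable fG).
have := square_integrableD ch (fock_square_integrable fF) sG.
by congr (square_integrable _ _); apply/funext => z; rewrite mulN1r.
Qed.

(** Two candidates differ by a Fock function [v] orthogonal to itself, hence 0 almost everywhere and
    then everywhere by continuity. [G] is a measurable representative of [F], needed because symbols
    are measurable only up to a null set. *)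
Lemma fock_projE (F G g : 'cV[C]_n -> C) :
  square_integrable h G -> {ae mu, forall z, F z = G z} -> fock h g ->
  (forall u, fock h u -> inner_h h (fun z => F z - g z) u = 0) ->
  fock_proj h F = g.
Proof.
move=> sG FG fg og; apply: xget_subset1; first by split.
move=> p q [fp op] [fq oq]; pose v z := p z - q z.
have fv : fock h v by exact: fockB.
have mRe (H : 'cV[C]_n -> C) : cmeasurable H -> measurable_fun setT (fun z => complex.Re (H z)).
  by case.
pose K (r : 'cV[C]_n -> C) z := complex.Re ((G z - r z) * conjc (v z)) * weight h z.
have I0 r : fock h r -> (forall u, fock h u -> inner_h h (fun z => F z - r z) u = 0) ->
    mu.-integrable setT (EFin \o K r) /\ \int[mu]_z K r z = 0.
  move=> fr or; split.
    apply: (integrable_product ch mRe (@normr_le_normc_Re R) _ (fock_square_integrable fv)).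
    have sr := square_integrableZ (- 1) (fock_square_integrable fr).
    have := square_integrableD ch sG sr.
    by congr (square_integrable _ _); apply/funext => z; rewrite mulN1r.
  have := or _ fv; rewrite /inner_h.
  rewrite (@cintegral_ae _ _ _ _ _ (fun z => (G z - r z) * conjc (v z) * (weight h z)%:C)); last first.
    by apply: filterS FG => z -> _.
  move=> /(congr1 (@complex.Re R)) /= E; apply: etrans E.
  apply: eq_Rintegral => z _; rewrite /K.
  by case: (_ * conjc _) => x y /=; rewrite mulr0 subr0.
have [ip Ip] := I0 _ fp op; have [iq Iq] := I0 _ fq oq.
have := RintegralB measurableT iq ip; rewrite Ip Iq subrr.
(* Since (G - q) - (G - p) = v, the difference of the two orthogonality relations, tested on [v], is
   the squared norm of [v]. *)
have -> : \int[mu]_z (K q z - K p z) = \int[mu]_z (normc (v z) ^+ 2 * weight h z).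
  apply: eq_Rintegral => z _; rewrite /K -mulrBl; congr (_ * _); rewrite /v.
  case: (G z) => a1 a2; case: (p z) => p1 p2; case: (q z) => q1 q2 /=.
  by rewrite sqr_sqrtr ?addr_ge0 ?sqr_ge0//; ring.
move=> V0.
have [mv iv] := fock_square_integrable fv.
have W0 z : 0 <= normc (v z) ^+ 2 * weight h z.
  by rewrite mulr_ge0 ?sqr_ge0// ltW// weight_gt0.
have v0 : {ae mu, forall z, p z = q z}.
  have [] := ae_eq_integral_abs mu measurableT (measurable_sqr_normc ch mv).
  rewrite (_ : (\int[mu]_z `|(normc (v z) ^+ 2 * weight h z)%:E|)%E = 0%E); last first.
    rewrite (eq_integral (fun z => (normc (v z) ^+ 2 * weight h z)%:E)); last first.
      by move=> z _; rewrite gee0_abs// lee_fin.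
    rewrite -[LHS]fineK; first by congr EFin; exact: V0.
    by rewrite ge0_fin_numE//; apply: integral_ge0 => z _; rewrite lee_fin.
  move=> /(_ erefl) H _; apply: filterS H => z /(_ I) [] /eqP.
  rewrite mulf_eq0 (gt_eqF (weight_gt0 _ _)) orbF expf_eq0/= => /eqP nv.
  by apply/eqP; rewrite -subr_eq0; apply/eqP; exact: ComplexField.Normc.eq0_normc nv.
apply: continuous_ae_eq v0 => z; apply: differentiable_continuous.
  by case: fp.
by case: fq.
Qed.
End orthogonal_projection.

Unset Implicit Arguments.

Theorem theorem6p3 (R : realType) (k : nat) (b : 'I_k -> nat) (h : R -> R)
    (phi : 'cV[R[i]]_(\sum_(j < k) b j) -> R[i])
    (a : k.-tuple (measurableTypeR R) -> R[i]) :
  (1 <= \sum_(j < k) b j)%N ->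
  (forall j, 0 < b j)%N ->
  (forall r, 0 <= r -> 0 <= h r) ->
  {within `[0, +oo[, continuous h} ->
  (forall m : nat,
    (\int[lebesgue_measure]_(r in `]0%R, +oo[)
      (r ^+ (2 * m + 2 * (\sum_(j < k) b j) - 1)
        * expR (- (2 * h r)))%:E < +oo)%E) ->
  Linfty phi ->
  block_unitary_invariant phi ->
  lebesgue_measurable_fun (lebesgue_tuple R k) (@positive_orthant R k) a ->
  {ae lebesgue_complex (\sum_(j < k) b j), forall z, phi z = a (block_norms z)} ->
  forall (s : 'I_k -> nat) (f : 'cV[R[i]]_(\sum_(j < k) b j) -> R[i]),
    polynomial_tensor s f ->
    toeplitz h phi f = fun z => toeplitz_eigenvalue b h a s * f z.
Proof.
pose n := (\sum_(j < k) b j)%N; move=> n0 b0 _ ch hfin [_ [M phiM]] _ [a' [ma1 ma2 aa']] phia s f fs.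
pose mu := @lebesgue_complex R n; pose N := @block_norms R k b.
pose orth := @positive_orthant R k; pose leb := lebesgue_tuple R k.
have df := entire_polynomial_tensor fs.
have fZ (c : 'I_k -> R[i]) (z : 'cV[R[i]]_n) :
    f (dilate (c \o @tagnat.sig1 k b) z) = (\prod_(j < k) c j ^+ s j) * f z.
  exact: polynomial_tensorZ.
have surj (j : 'I_k) : exists i : 'I_n, @tagnat.sig1 k b i = j.
  by exists (tagnat.Rank j (Ordinal (b0 j))); rewrite tagnat.Rank1K.
have mo : measurable orth by exact: measurable_positive_orthant.
(* The representative [a'] is measurable on the orthant only; extension by 0 makes its parts
   measurable everywhere. *)
pose a1 := (fun r => complex.Re (a' r)) \_ orth.
pose a2 := (fun r => complex.Im (a' r)) \_ orth.
have ma1T : measurable_fun setT a1.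
  by apply/(measurable_restrictT _ mo).
have ma2T : measurable_fun setT a2.
  by apply/(measurable_restrictT _ mo).
have aA r : orth r -> a' r = a1 r +i* a2 r.
  by move=> r0; rewrite /a1 /a2 !patchE mem_set//; case: (a' r).
have aE : {ae leb, forall r, orth r -> a r = a1 r +i* a2 r}.
  by apply: filterS aa' => r H r0; rewrite H// aA.
have phiE : {ae mu, forall z, phi z = a1 (N z) +i* a2 (N z)}.
  have aN := norm_map_ae_orthant measurable_block_norms block_normsZ
    normc_le_block_norms surj prod_block aE.
  by apply: filterS2 phia aN => z -> ->.
have b1 : {ae mu, forall z, `|a1 (N z)| <= M}.
  apply: filterS2 phiM phiE => z H E; apply: le_trans (H Logic.I); rewrite E.
  exact: (normr_le_normc_Re (a1 (N z) +i* a2 (N z))).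
have b2 : {ae mu, forall z, `|a2 (N z)| <= M}.
  apply: filterS2 phiM phiE => z H E; apply: le_trans (H Logic.I); rewrite E.
  exact: (normr_le_normc_Im (a1 (N z) +i* a2 (N z))).
pose D := \int[leb]_(r in orth) radial_weight b h s r.
have D0 : 0 < D := radial_weight_integral_gt0 ch b0 n0 hfin s.
(* The weighted mean; on the two parts of the symbol it gives the two parts of the eigenvalue. *)
pose l (g : k.-tuple (measurableTypeR R) -> R) :=
  \int[leb]_(r in orth) (g r * radial_weight b h s r) / D.
have lamE : toeplitz_eigenvalue b h a s = l a1 +i* l a2.
  rewrite /toeplitz_eigenvalue (@cintegral_ae _ _ _ _ _ _
    (fun r => (a1 r +i* a2 r) * (radial_weight b h s r)%:C)); last first.
    by apply: filterS aE => r H r0; rewrite H.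
  rewrite -fmorphV /cintegral.
  have -> : \int[leb]_(r in orth) complex.Re ((a1 r +i* a2 r) * (radial_weight b h s r)%:C) =
      \int[leb]_(r in orth) (a1 r * radial_weight b h s r).
    by apply: eq_Rintegral => r _ /=; rewrite mulr0 subr0.
  have -> : \int[leb]_(r in orth) complex.Im ((a1 r +i* a2 r) * (radial_weight b h s r)%:C) =
      \int[leb]_(r in orth) (a2 r * radial_weight b h s r).
    by apply: eq_Rintegral => r _ /=; rewrite mulr0 add0r.
  by apply/eqP; rewrite eq_complex/= !mulr0 subr0 add0r !eqxx.
(* After subtraction of the mean, a symbol is still bounded along [N] and meets the hypothesis of
   the vanishing lemma. *)
have centered (g : k.-tuple (measurableTypeR R) -> R) : measurable_fun setT g ->
    {ae mu, forall z, `|g (N z)| <= M} ->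
    [/\ measurable_fun setT (fun r => g r - l g),
        {ae mu, forall z, `|g (N z) - l g| <= M + `|l g|} &
        \int[leb]_(r in orth) ((g r - l g) * radial_weight b h s r) = 0].
  move=> mg bg; split; first exact: measurable_funB.
    by apply: filterS bg => z H; apply: le_trans (ler_normB _ _) _; rewrite lerD2r.
  have ig := integrable_bounded_orthant ch b0 n0 hfin s mg bg.
  have i1 : leb.-integrable orth (EFin \o (fun r => l g * radial_weight b h s r)).
    apply: (integrable_bounded_orthant (g := cst (l g)) (M := `|l g|) ch b0 n0 hfin s) => //.
    by apply: aeW => z; exact: lexx.
  have i2 : leb.-integrable orth (EFin \o (fun r => radial_weight b h s r)).
    have := integrable_bounded_orthant (g := cst (1 : R)) (M := 1) ch b0 n0 hfin s
      (measurable_cst _).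
    rewrite (_ : (fun r => cst 1 r * _) = radial_weight b h s); last first.
      by apply/funext => r /=; rewrite mul1r.
    by apply; apply: aeW => z /=; rewrite normr1.
  under eq_Rintegral do rewrite mulrBl.
  rewrite (RintegralB mo ig i1) (RintegralZl _ mo i2) -/D /l divfK ?gt_eqF//.
  by rewrite subrr.
have [m1 c1 z1] := centered _ ma1T b1; have [m2 c2 z2] := centered _ ma2T b2.
have sf : square_integrable h f := square_integrable_homogeneous ch b0 n0 hfin df fZ.
apply: (fock_projE (G := fun z => (a1 (N z) +i* a2 (N z)) * f z) ch).
- have s1 := square_integrable_radialM ch ma1T b1 sf.
  have s2 := square_integrableZ ch (0 +i* 1) (square_integrable_radialM ch ma2T b2 sf).
  have := square_integrableD ch s1 s2; congr (square_integrable _ _).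
  apply/funext => z; rewrite mulrA -mulrDl; congr (_ * _).
  by apply/eqP; rewrite eq_complex/= !mul0r mulr0 mul1r !(addr0, add0r, subr0) !eqxx.
- by apply: filterS phiE => z ->.
- exact: (fockZ ch _ (square_integrable_fock df sf)).
(* The factor - i turns Re(conj(f) u) into Im(conj(f) u). With these as X and Y one has f conj(u) =
   X - i Y, so the product with g1 + i g2 has parts g1 X + g2 Y and g2 X - g1 Y, each a combination
   of vanishing integrals. *)
move=> u fu; have fv := fockZ ch (0 +i* (- 1)) fu.
rewrite /inner_h (@cintegral_ae _ _ _ _ _ _ (fun z =>
  ((a1 (N z) - l a1) +i* (a2 (N z) - l a2)) * f z * conjc (u z) * (weight h z)%:C)); last first.
  apply: filterS phiE => z -> _; rewrite lamE -mulrBl; congr (_ * _ * _ * _).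
pose X z := complex.Re (conjc (f z) * u z).
pose Y z := complex.Re (conjc (f z) * ((0 +i* (- 1)) * u z)).
have z11 := Rintegral_block_radial_eq0 ch b0 n0 hfin df fZ fu m1 c1 z1.
have z12 := Rintegral_block_radial_eq0 ch b0 n0 hfin df fZ fv m1 c1 z1.
have z21 := Rintegral_block_radial_eq0 ch b0 n0 hfin df fZ fu m2 c2 z2.
have z22 := Rintegral_block_radial_eq0 ch b0 n0 hfin df fZ fv m2 c2 z2.
have i11 := integrable_block_radial ch b0 n0 hfin df fZ fu m1 c1.
have i12 := integrable_block_radial ch b0 n0 hfin df fZ fv m1 c1.
have i21 := integrable_block_radial ch b0 n0 hfin df fZ fu m2 c2.
have i22 := integrable_block_radial ch b0 n0 hfin df fZ fv m2 c2.
apply/eqP; rewrite eq_complex/= /cintegral; apply/andP; split; apply/eqP.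
  apply: etrans (_ : _ = \int[mu]_z ((a1 (N z) - l a1) * X z * weight h z +
                                  (a2 (N z) - l a2) * Y z * weight h z)) _.
    apply: eq_Rintegral => z _; rewrite /X /Y.
    by case: (f z) => p q; case: (u z) => p' q' /=; ring.
  by rewrite (RintegralD measurableT i11 i22) z11 z22 addr0.
apply: etrans (_ : _ = \int[mu]_z ((a2 (N z) - l a2) * X z * weight h z -
                                (a1 (N z) - l a1) * Y z * weight h z)) _.
  apply: eq_Rintegral => z _; rewrite /X /Y.
  by case: (f z) => p q; case: (u z) => p' q' /=; ring.
by rewrite (RintegralB measurableT i21 i12) z21 z12 subr0.
Qed.
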